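(* Let $G$ be a non-discrete LCA group with dual $\Gamma$, $V$ an open neighbourhood of $0\in\Gamma$ with compact closure $\bar V$, and for $1\le p<\infty$ let $\mathcal A_p(\Gamma):=\{\psi\in\mathcal A(\Gamma):\psi\in L^p(\Gamma)\}$ with norm $\|\psi\|_{\mathcal A_p}:=\|\psi\|^{\bar V}+\|\psi\|_p$ ($L^p$ with respect to Haar measure on $\Gamma$). For $1\le p<q<\infty$: (i) $(\mathcal A_p(\Gamma),\|\cdot\|_{\mathcal A_p})$ is an isometrically translation invariant Segal algebra in $\mathcal A(\Gamma)$; (ii) $\mathcal A_p(\Gamma)\subsetneqq\mathcal A_q(\Gamma)$.
   Context: $G$ non-discrete LCA with dual $\Gamma$, $(x,\gamma)=\gamma(x)$. For $E\subseteq\Gamma$, $\mathrm{span}(E)$ is the span of the characters in $E$ as functions on $G$, each $p=\sum\hat p(\gamma)\gamma$ uniquely, $\|p\|_\infty=\sup_G|p|$. For $\phi\in C_b(\Gamma)$: $\|\phi\|^{\bar V,\gamma}=\sup\{|\sum_{\gamma'\in\bar V+\gamma}\hat p(\gamma')\phi(\gamma')|:p\in\mathrm{span}(\bar V+\gamma),\|p\|_\infty\le1\}$, $\|\phi\|^{\bar V}=\sup_\gamma\|\phi\|^{\bar V,\gamma}$, $C^{\bar V}_{BSE}(\Gamma)=\{\phi\in C_b(\Gamma):\|\phi\|^{\bar V}<\infty\}$. With $\mathcal K(\Gamma)$ the compact subsets of $\Gamma$ with dense nonempty interior directed by inclusion, $\mathcal A(\Gamma)=\{\psi\in C^{\bar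 V}_{BSE}(\Gamma):\lim_{\Omega\in\mathcal K(\Gamma)}\sup_{\gamma\notin\Omega}\|\psi\|^{\bar V,\gamma}=0\}$, a commutative Banach function algebra under $\|\cdot\|^{\bar V}$. A Segal algebra in $\mathcal A(\Gamma)$ is a dense ideal $\mathcal S$ that is a Banach space under a norm $\|\cdot\|_{\mathcal S}\ge\|\cdot\|^{\bar V}$, with $\|\phi\psi\|_{\mathcal S}\le\|\phi\|_{\mathcal S}\|\psi\|^{\bar V}$ ($\phi\in\mathcal S,\psi\in\mathcal A(\Gamma)$), and having approximate units (for each $\phi\in\mathcal S$, $\varepsilon>0$ some $u\in\mathcal S$ has $\|\phi-u\phi\|_{\mathcal S}<\varepsilon$); it is isometrically translation invariant if $\psi\in\mathcal S$ implies $\psi(\cdot-\gamma)\in\mathcal S$ with the same norm for all $\gamma\in\Gamma$. *)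

(* Defs.v *)
From HB Require Import structures.
From mathcomp Require Import all_boot all_order all_algebra.
From mathcomp Require Import all_classical all_reals all_analysis.
From mathcomp Require Import complex.
Set Implicit Arguments. Unset Strict Implicit. Unset Printing Implicit Defensive.
Import Order.TTheory GRing.Theory Num.Theory.
Local Open Scope classical_set_scope.
Local Open Scope ring_scope.

(** Borel σ-algebra on a topological abelian group (the carrier is given a
    point, 0, as required by [g_sigma_algebraType]) *)
Definition pt (T : topologicalZmodType) : Type := T.
HB.instance Definition _ (T : topologicalZmodType) := Choice.on (pt T).
HB.instance Definition _ (T : topologicalZmodType) := isPointed.Build (pt T) 0.
Notation Borel Γ := (@g_sigma_algebraType (pt Γ) (@open Γ)).

Section Defs.
Variable R : realType.
Local Notation C := (R[i]).

Definition cabs (z : C) : R := Num.sqrt (complex.Re z ^+ 2 + complex.Im z ^+ 2).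

Definition ccontinuous {T : topologicalType} (f : T -> C) :=
  forall t (e : R), 0 < e -> \forall s \near t, cabs (f s - f t) < e.
Definition cbounded {T : Type} (f : T -> C) := exists M : R, forall t, cabs (f t) <= M.
Definition Cb {T : topologicalType} (f : T -> C) := ccontinuous f /\ cbounded f.

Definition LCA (G : topologicalZmodType) :=
  hausdorff_space G /\ locally_compact [set: G].
Definition non_discrete (G : topologicalZmodType) := ~ (forall x : G, open [set x]).

Definition is_character {G : topologicalZmodType} (chi : G -> C) :=
  [/\ forall x y, chi (x + y) = chi x * chi y,
      forall x, cabs (chi x) = 1 & ccontinuous chi].

(** [pair : G -> Γ -> C], (x,γ) = γ(x), identifies Γ with the dual group of G:
    γ ↦ (x ↦ pair x γ) is an injective group homomorphism onto the continuous
    characters, and the topology of Γ is the compact-open topology (uniform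
    convergence on compact subsets of G). *)
Definition dual_pairing {G Γ : topologicalZmodType} (pair : G -> Γ -> C) :=
  [/\ forall γ, is_character (pair^~ γ),
      forall x γ δ, pair x (γ + δ) = pair x γ * pair x δ,
      forall chi : G -> C, is_character chi -> exists γ, forall x, chi x = pair x γ,
      forall γ δ, (forall x, pair x γ = pair x δ) -> γ = δ &
      forall (γ : Γ) (A : set Γ), nbhs γ A <->
        exists (K : set G) (e : R), [/\ compact K, 0 < e &
          [set δ | forall x, K x -> cabs (pair x δ - pair x γ) < e] `<=` A]].


Definition haar {Γ : topologicalZmodType} (mu : {measure set (Borel Γ) -> \bar R}) :=
  [/\ forall (A : set (Borel Γ)) (γ : Γ), measurable A ->
        mu [set a + γ | a in A] = mu A,
      forall U : set Γ, open U -> U !=set0 -> (0 < mu U)%E,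
      forall K : set Γ, compact K -> (mu K < +oo)%E,
      forall A : set (Borel Γ), measurable A ->
        mu A = ereal_inf [set mu U | U in [set U : set Γ | open U /\ A `<=` U]] &
      forall U : set Γ, open U ->
        mu U = ereal_sup [set mu K | K in [set K : set Γ | compact K /\ K `<=` U]]].

Section BSE.
Variables (G Γ : topologicalZmodType) (pair : G -> Γ -> C) (V : set Γ).

Definition Vbar_shift (γ : Γ) : set Γ := [set v + γ | v in closure V].

(** trigonometric polynomials p = Σ_{g ∈ s} c g · (·, g) with frequencies in E;
    by uniqueness of the representation, \hat p(g) = c g for g ∈ s. *)
Definition trig_poly_in (E : set Γ) (s : seq Γ) :=
  uniq s /\ (forall g, g \in s -> E g).
Definition trig_eval (s : seq Γ) (c : Γ -> C) (x : G) : C :=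
  \sum_(g <- s) c g * pair x g.

Definition bse_loc (phi : Γ -> C) (γ : Γ) : \bar R :=
  ereal_sup [set r : \bar R | exists (s : seq Γ) (c : Γ -> C),
     [/\ trig_poly_in (Vbar_shift γ) s,
         forall x, cabs (trig_eval s c x) <= 1 &
         r = (cabs (\sum_(g <- s) c g * phi g))%:E]].

Definition bse_norm (phi : Γ -> C) : \bar R :=
  ereal_sup [set bse_loc phi γ | γ in [set: Γ]].

Definition C_BSE (phi : Γ -> C) := Cb phi /\ (bse_norm phi < +oo)%E.

Definition Kset (O : set Γ) :=
  [/\ compact O, interior O !=set0 & closure (interior O) = O].

Definition Aalg (psi : Γ -> C) :=
  C_BSE psi /\
  forall e : R, 0 < e -> exists O0, Kset O0 /\
    forall O, Kset O -> O0 `<=` O ->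
      (ereal_sup [set bse_loc psi γ | γ in ~` O] <= e%:E)%E.
End BSE.

Definition Lp_norm {Γ : topologicalZmodType} (mu : {measure set (Borel Γ) -> \bar R})
  (p : R) (f : Γ -> C) : \bar R :=
  Lnorm mu p%:E (fun g : Borel Γ => (cabs (f g))%:E).

Definition Ap {G Γ : topologicalZmodType} (pair : G -> Γ -> C) (V : set Γ)
  (mu : {measure set (Borel Γ) -> \bar R}) (p : R) (psi : Γ -> C) :=
  Aalg pair V psi /\ (Lp_norm mu p psi < +oo)%E.
Definition Ap_norm {G Γ : topologicalZmodType} (pair : G -> Γ -> C) (V : set Γ)
  (mu : {measure set (Borel Γ) -> \bar R}) (p : R) (psi : Γ -> C) : \bar R :=
  (bse_norm pair V psi + Lp_norm mu p psi)%E.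

Section Segal.
Variables (G Γ : topologicalZmodType) (pair : G -> Γ -> C) (V : set Γ).
Variables (S : set (Γ -> C)) (N : (Γ -> C) -> \bar R).
Local Notation A := (Aalg pair V).
Local Notation nA := (bse_norm pair V).

Definition segal_subspace :=
  [/\ S `<=` A, S (fun _ => 0) &
      forall phi psi (a : C), S phi -> S psi -> S (fun g => (a * phi g + psi g)%R)].

Definition segal_ideal :=
  forall phi psi, S phi -> A psi -> S (fun g => (phi g * psi g)%R).

Definition segal_dense :=
  forall psi (e : R), A psi -> 0 < e ->
    exists2 phi, S phi & (nA (fun g => (psi g - phi g)%R) < e%:E)%E.

Definition segal_norm :=
  [/\ forall phi, S phi -> (0 <= N phi)%E /\ (N phi < +oo)%E,
      forall phi, S phi -> N phi = 0%E -> phi = (fun _ => 0),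
      forall phi (a : C), S phi -> N (fun g => (a * phi g)%R) = ((cabs a)%:E * N phi)%E &
      forall phi psi, S phi -> S psi ->
        (N (fun g => (phi g + psi g)%R) <= N phi + N psi)%E].

Definition segal_complete :=
  forall u : nat -> Γ -> C, (forall n, S (u n)) ->
    (forall e : R, 0 < e -> exists n0, forall m n, (n0 <= m)%N -> (n0 <= n)%N ->
       (N (fun g => (u m g - u n g)%R) < e%:E)%E) ->
    exists2 phi, S phi & forall e : R, 0 < e -> exists n0, forall n, (n0 <= n)%N ->
       (N (fun g => (u n g - phi g)%R) < e%:E)%E.

Definition segal_bounds :=
  (forall phi, S phi -> (nA phi <= N phi)%E) /\
  (forall phi psi, S phi -> A psi -> (N (fun g => (phi g * psi g)%R) <= N phi * nA psi)%E).

Definition segal_approx_units :=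
  forall phi (e : R), S phi -> 0 < e ->
    exists2 u, S u & (N (fun g => (phi g - u g * phi g)%R) < e%:E)%E.

Definition is_segal :=
  [/\ segal_subspace /\ segal_ideal, segal_dense, segal_norm /\ segal_complete,
      segal_bounds & segal_approx_units].

Definition isometric_translation_invariant :=
  forall psi (γ : Γ), S psi -> S (fun δ => psi (δ - γ)%R) /\ N (fun δ => psi (δ - γ)%R) = N psi.
End Segal.
End Defs.

(* Main.v *)
(* Trigonometric polynomials can be translated in [G], so the local norms [bse_loc] are
   submultiplicative, and a character of [Γ] given by a point of [G] has norm 1; iterating
   [q -> (y + q^2) / 2] gives square roots, hence absolute values, of bounded norm, and products of
   truncations of [Re (x, -)] give bumps supported in [V].  The cut-off
   [1 - \prod_t (1 - h (- - t))], [t] running over a separated net of a compact set, has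
   norm bounded independently of the compact set, because a translate of [closure V] meets boundedly
   many factors.  Cut-offs yield density and approximate units; for the [L^p] part of the norm this
   is dominated convergence, as elements of [Aalg] vanish at infinity.  Completeness is Fatou's
   lemma together with the fact that [bse_loc] is a supremum of continuous functionals.

   For strictness, put copies of a bump of heights [(n+1)^(-1/p)] far apart in [Γ].  This
   needs [Γ] noncompact.  Were [Γ] compact, an open subgroup of [G] would be killed by all
   characters, by equicontinuity, so it suffices to find a nontrivial character of a compactly
   generated subgroup and to extend it by divisibility of the circle.  Modulo a finitely generated
   subgroup everything is precompact, where there is an invariant mean, and a nonzero
   autocorrelation [phi] of mean zero.  A positive definite [psi] that maximizes the mean of
   [|phi * psi|^2], relative to [psi 0 ^ 2], is asymptotically multiplicative and defines the character. *)
Require Import Defs.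
From HB Require Import structures.
From mathcomp Require Import all_boot all_order all_algebra.
From mathcomp Require Import all_classical all_reals all_analysis measurable_realfun.
From mathcomp Require Import complex ring lra zify.
Set Implicit Arguments. Unset Strict Implicit. Unset Printing Implicit Defensive.
Import Order.TTheory GRing.Theory Num.Theory.
Import numFieldNormedType.Exports.
Local Open Scope classical_set_scope.
Local Open Scope ring_scope.

(** * Complex numbers *)

(** Local norms can be estimated for sums, products, translates and pointwise limits, but the bound
    for a product grows exponentially with the number of factors. Constants stay uniform because
    [bse_loc] at [γ] sees a function only on [γ + closure V]: every global construction is arranged
    so that on each such set it involves boundedly many bumps.

    The extremal problem has a spectral meaning. Heuristically, a positive definite [psi] is the
    transform of a positive measure on the characters, with total mass [psi 0], and the mean of
    [|phi * psi|^2] is the sum over characters of the squared coefficient of [phi] times the squared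
    mass of the atom. For fixed total mass this is largest at a point mass, that is, for a character
    at which the coefficient of [phi] is maximal in modulus; mean zero of [phi] keeps the trivial
    character from winning. A maximizing sequence converges only pointwise along an ultrafilter, but
    its convolutions with [phi] are equicontinuous and converge uniformly, which suffices because
    the energy depends on the convolutions alone. *)

Lemma subrACA (V : zmodType) (a b c d : V) : a - b - (c - d) = a - c - (b - d).
Proof. by rewrite !opprB addrACA [RHS]addrACA [- b - c]addrC. Qed.

(** Tolerances [e / (B + 1)] are used for bounds [B] that may be 0; the [+ 1] spares a case
    distinction. *)
Lemma ler_mul_div1 (R : realFieldType) (B e : R) : 0 <= B -> 0 < e -> B * (e / (B + 1)) <= e.
Proof. by move=> B0 e0; rewrite mulrA ler_pdivrMr; nra. Qed.

Section Cabs.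
Variable R : realType.
Local Notation C := R[i].
Implicit Types (z w : C) (x : R).

Lemma normr_cabs z : `|z| = (cabs z)%:C%C.
Proof. by rewrite normc_def. Qed.

Lemma cabsE z : cabs z = complex.Re `|z|.
Proof. by rewrite normr_cabs. Qed.

Lemma cabs_ge0 z : 0 <= cabs z.
Proof. exact: sqrtr_ge0. Qed.

Lemma cabs0 : cabs (0 : C) = 0.
Proof. by rewrite cabsE normr0. Qed.

Lemma cabs1 : cabs (1 : C) = 1.
Proof. by rewrite cabsE normr1. Qed.

Lemma cabs_eq0 z : cabs z = 0 -> z = 0.
Proof. by move=> h; apply/eqP; rewrite -normr_eq0 normr_cabs h. Qed.

Lemma cabsM z w : cabs (z * w) = cabs z * cabs w.
Proof. by apply: complexI; rewrite rmorphM /= -!normr_cabs normrM. Qed.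

Lemma cabsX z n : cabs (z ^+ n) = cabs z ^+ n.
Proof. by elim: n => [|n IH]; rewrite ?expr0 ?cabs1// !exprS cabsM IH. Qed.

Lemma cabsN z : cabs (- z) = cabs z.
Proof. by rewrite !cabsE normrN. Qed.

Lemma cabsB z w : cabs (z - w) = cabs (w - z).
Proof. by rewrite -cabsN opprB. Qed.

Lemma cabs_conj z : cabs z^*%C = cabs z.
Proof. by rewrite !cabsE normcJ. Qed.

Lemma cabs_real x : cabs x%:C%C = `|x|.
Proof. by rewrite /cabs /= expr0n addr0 sqrtr_sqr. Qed.

Lemma cabsD z w : cabs (z + w) <= cabs z + cabs w.
Proof. by rewrite -lecR rmorphD /= -!normr_cabs ler_normD. Qed.

Lemma cabs_sub_trans u z w : cabs (z - w) <= cabs (z - u) + cabs (u - w).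
Proof. by apply: le_trans (cabsD _ _); rewrite addrA subrK. Qed.

Lemma cabs_sub_ge z w : cabs z - cabs w <= cabs (z - w).
Proof. by rewrite lerBlDr -{1}[z](subrK w); exact: cabsD. Qed.

Lemma cabs_sum (I : Type) (s : seq I) (P : pred I) (F : I -> C) :
  cabs (\sum_(i <- s | P i) F i) <= \sum_(i <- s | P i) cabs (F i).
Proof.
elim/big_rec2: _ => [|i y z _ h]; first by rewrite cabs0.
by apply: le_trans (cabsD _ _) _; rewrite lerD2l.
Qed.

Lemma cabs_Re z : `|complex.Re z| <= cabs z.
Proof. by rewrite -lecR -normr_cabs normc_ge_Re. Qed.

Lemma cabs_Im z : `|complex.Im z| <= cabs z.
Proof. 
rewrite /cabs -sqrtr_sqr ler_sqrt ?lerDr ?sqr_ge0//.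
by rewrite addr_ge0// sqr_ge0.
Qed.

Lemma sqr_cabs z : cabs z ^+ 2 = complex.Re z ^+ 2 + complex.Im z ^+ 2.
Proof. by rewrite sqr_sqrtr// addr_ge0// sqr_ge0. Qed.

Lemma cabs_le z : cabs z <= `|complex.Re z| + `|complex.Im z|.
Proof.
rewrite -(@ler_pXn2r _ 2)// ?nnegrE ?cabs_ge0 ?addr_ge0//.
by rewrite sqr_cabs sqrrD !real_normK ?num_real// addrAC lerDl mulrn_wge0// mulr_ge0.
Qed.

Lemma mulC_conj z : z * z^*%C = (cabs z ^+ 2)%:C%C.
Proof. by rewrite -sqr_normc normr_cabs rmorphXn. Qed.

Lemma unimodular_conj z : cabs z = 1 -> z * z^*%C = 1.
Proof. by move=> h; rewrite mulC_conj h expr1n. Qed.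

Lemma ReD z w : complex.Re (z + w) = complex.Re z + complex.Re w.
Proof. by case: z w => [a b] [c d]. Qed.

Lemma ImD z w : complex.Im (z + w) = complex.Im z + complex.Im w.
Proof. by case: z w => [a b] [c d]. Qed.

Lemma ReN z : complex.Re (- z) = - complex.Re z.
Proof. by case: z. Qed.

Lemma ImN z : complex.Im (- z) = - complex.Im z.
Proof. by case: z. Qed.

Lemma ReM z w : complex.Re (z * w) =
  complex.Re z * complex.Re w - complex.Im z * complex.Im w.
Proof. by case: z w => [a b] [c d]. Qed.

Lemma ImM z w : complex.Im (z * w) =
  complex.Re z * complex.Im w + complex.Im z * complex.Re w.
Proof. by case: z w => [a b] [c d]. Qed.

Lemma ReJ z : complex.Re z^*%C = complex.Re z.
Proof. by case: z. Qed.

Lemma ImJ z : complex.Im z^*%C = - complex.Im z.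
Proof. by case: z. Qed.

Lemma Re_sum (I : Type) (s : seq I) (F : I -> C) :
  complex.Re (\sum_(i <- s) F i) = \sum_(i <- s) complex.Re (F i).
Proof. by elim: s => [|i s IH]; rewrite ?big_nil// !big_cons ReD IH. Qed.

Lemma complexP z w :
  complex.Re z = complex.Re w -> complex.Im z = complex.Im w -> z = w.
Proof. by case: z w => [a b] [c d] /= -> ->. Qed.

Lemma conjcD z w : (z + w)^*%C = z^*%C + w^*%C.
Proof. by case: z w => [a b] [c d]; rewrite /= opprD. Qed.

Lemma conjcM z w : (z * w)^*%C = z^*%C * w^*%C.
Proof. by apply: complexP; rewrite ?ReJ ?ImJ !(ReM, ImM) !ReJ !ImJ; ring. Qed.

Lemma conjcR x : (x%:C%C : C)^*%C = x%:C%C.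
Proof. by rewrite /= oppr0. Qed.

Lemma Re_scale x z : complex.Re (x%:C%C * z) = x * complex.Re z.
Proof. by rewrite ReM /= mul0r subr0. Qed.

Lemma Im_scale x z : complex.Im (x%:C%C * z) = x * complex.Im z.
Proof. by rewrite ImM /= mul0r addr0. Qed.

End Cabs.

(** * Invariant means on precompact groups *)

Section Mean.
Variables (R : realType) (H : zmodType) (W : nat -> set H).

(** The sets [W n] act as a base at 0 of a precompact group topology on [H], possibly not Hausdorff
    and never declared as a topology. Sums of three terms are what [in_sum_small] consumes. *)
Definition precompact_chain :=
  [/\ forall n, W n 0, forall n x, W n x -> W n (- x),
      forall n x y z, W n.+1 x -> W n.+1 y -> W n.+1 z -> W n (x + y + z) &
      forall n, exists s : seq H, forall x, exists2 t, t \in s & W n (x - t)].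

Hypothesis chainW : precompact_chain.
Implicit Types (f g : H -> R) (s : seq H) (e : R).

Definition unif_cont (f : H -> R) :=
  forall e : R, 0 < e -> exists n, forall x y, W n (x - y) -> `|f x - f y| <= e.

Definition avg s f x : R := (size s)%:R^-1 * \sum_(t <- s) f (x + t).

(** Von Neumann's mean of an almost periodic function, available without any measure on [H].
    Uniqueness and additivity rest on the commutation of averages ([avgC]). *)
Definition is_mean f (m : R) :=
  forall e, 0 < e -> exists2 s, (0 < size s)%N & forall x, `|avg s f x - m| <= e.

Lemma chain_antitone n m : (n <= m)%N -> W m `<=` W n.
Proof.
have [W0 WN W3 _] := chainW.
elim: m => [|m IH]; first by rewrite leqn0 => /eqP ->.
rewrite leq_eqVlt => /orP[/eqP -> //|]; rewrite ltnS => /IH le_mn x Wx.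
by apply: le_mn; rewrite -[x]addr0 -[x]addr0; apply: W3.
Qed.

Lemma avgE s f x a : (0 < size s)%N ->
  avg s f x - a = (size s)%:R^-1 * \sum_(t <- s) (f (x + t) - a).
Proof.
move=> s0; rewrite sumrB mulrBr; congr (_ - _).
rewrite big_const_seq count_predT iter_addr addr0 -[a *+ _]mulr_natl mulKf//.
by rewrite pnatr_eq0 -lt0n.
Qed.

Lemma avg_dist s f x a e : (0 < size s)%N -> (forall t, `|f t - a| <= e) ->
  `|avg s f x - a| <= e.
Proof.
move=> s0 h; rewrite avgE// normrM ger0_norm ?invr_ge0// ler_pdivrMl ?ltr0n//.
apply: le_trans (ler_norm_sum _ _ _) _.
apply: (@le_trans _ _ (\sum_(t <- s) e)); first exact: ler_sum.
by rewrite big_const_seq count_predT iter_addr addr0 -[leLHS]mulr_natl.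
Qed.

Lemma avg_ge0 s f x : (forall t, 0 <= f t) -> 0 <= avg s f x.
Proof. by move=> h; rewrite mulr_ge0 ?invr_ge0// sumr_ge0. Qed.

Lemma avgD s f g x : avg s (fun t => f t + g t) x = avg s f x + avg s g x.
Proof. by rewrite /avg big_split mulrDr. Qed.

Lemma avgZ s f a x : avg s (fun t => a * f t) x = a * avg s f x.
Proof. by rewrite /avg -mulr_sumr mulrCA. Qed.

Lemma avgA s s' f x :
  avg s (avg s' f) x = avg [seq t + t' | t <- s, t' <- s'] f x.
Proof.
rewrite /avg size_allpairs natrM invfM -mulrA; congr (_ * _).
by rewrite big_allpairs_dep mulr_sumr; apply: eq_bigr => t _; congr (_ * _); apply: eq_bigr => t' _; rewrite addrA.
Qed.

Lemma avgC s s' f x : avg s (avg s' f) x = avg s' (avg s f) x.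
Proof.
rewrite /avg !mulr_sumr.
under eq_bigr do rewrite mulrCA mulr_sumr mulr_sumr.
rewrite exchange_big; apply: eq_bigr => t' _; rewrite mulr_sumr mulr_sumr.
by apply: eq_bigr => t _; rewrite addrAC.
Qed.

Lemma avg_unif s f n e : (0 < size s)%N ->
  (forall x y, W n (x - y) -> `|f x - f y| <= e) ->
  forall x y, W n (x - y) -> `|avg s f x - avg s f y| <= e.
Proof.
move=> s0 h x y xy; rewrite /avg -mulrBr -sumrB normrM ger0_norm ?invr_ge0//.
rewrite ler_pdivrMl ?ltr0n//; apply: le_trans (ler_norm_sum _ _ _) _.
apply: (@le_trans _ _ (\sum_(t <- s) e)).
  by apply: ler_sum => t _; apply: h; rewrite opprD addrACA subrr addr0.
by rewrite big_const_seq count_predT iter_addr addr0 -[leLHS]mulr_natl.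
Qed.

Lemma unif_cont_bounded f : unif_cont f -> exists2 B, 0 <= B & forall x, `|f x| <= B.
Proof.
have [_ _ _ cov] := chainW.
move=> /(_ 1 ltr01)[n h]; have [s hs] := cov n.
exists (1 + \sum_(t <- s) `|f t|); first by rewrite addr_ge0// sumr_ge0.
move=> x; have [t ts Wt] := hs x; rewrite -[f x](subrK (f t)).
apply: le_trans (ler_normD _ _) _; apply: lerD; first exact: h.
by rewrite (big_rem t)//= lerDl sumr_ge0.
Qed.

Lemma avg_ge s f x a : (0 < size s)%N -> (forall t, a <= f t) -> a <= avg s f x.
Proof.
move=> s0 h; rewrite -subr_ge0 avgE// mulr_ge0 ?invr_ge0// sumr_ge0// => t _.
by rewrite subr_ge0.
Qed.

Lemma avg_le s f x a : (0 < size s)%N -> (forall t, f t <= a) -> avg s f x <= a.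
Proof.
move=> s0 h; rewrite -subr_le0 avgE// mulr_ge0_le0 ?invr_ge0// sumr_le0// => t _.
by rewrite subr_le0.
Qed.

(* One averaging over a finite [W n]-net pulls either the upper or the lower bound of [f]
   towards the middle. *)
Lemma avg_contract f n e s lo hi : (0 < size s)%N ->
  (forall x, exists2 t, t \in s & W n (x - t)) ->
  (forall x y, W n (x - y) -> `|f x - f y| <= e) -> 4 * e < hi - lo -> 0 < e ->
  (forall x, lo <= f x <= hi) ->
  exists lo' hi', (forall x, lo' <= avg s f x <= hi') /\
    hi' - lo' <= hi - lo - e / (size s)%:R.
Proof.
move=> s0 cov hf osc e0 bf; have k1 : 1 <= (size s)%:R :> R by rewrite ler1n.
have k0 : 0 < (size s)%:R :> R by apply: lt_le_trans k1.
have ek : e / (size s)%:R <= e by rewrite ler_pdivrMr// ler_peMr// ltW.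
have lof x : lo <= avg s f x by apply: avg_ge => // t; have /andP[] := bf t.
have hif x : avg s f x <= hi by apply: avg_le => // t; have /andP[] := bf t.
(* If all values exceed the midpoint, it is the new lower bound. Otherwise some translate in the net
   brings [x] to within [W n] of a low point [x0]; that term lies at least [e] below [hi] and lowers
   the average by [e / size s]. *)
have [[x0 hx0]|hmid] := pselect (exists x0, f x0 <= (lo + hi) / 2); last first.
  exists ((lo + hi) / 2), hi; split; last lra.
  move=> x; rewrite hif andbT avg_ge// => t; rewrite leNgt; apply/negP => /ltW h.
  by apply: hmid; exists t.
exists lo, (hi - e / (size s)%:R); split; last lra.
move=> x; rewrite lof/=; have [t ts Wt] := cov (x0 - x).
rewrite -[leLHS](subrK hi) (avgE _ _ _ s0) addrC lerD2l -lerN2 opprK -mulrN -sumrN mulrC.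
rewrite ler_pM2l ?invr_gt0//.
rewrite (big_rem t)//= ler_wpDr ?sumr_ge0// => [y _|].
  by rewrite opprB subr_ge0; have /andP[] := bf (x + y).
have := hf x0 (x + t); rewrite opprD addrA => /(_ Wt); rewrite ler_norml => /andP[]; lra.
Qed.

(** Each contraction shortens the range by the fixed amount [e / 4 / k], so finitely many suffice.
    Averages keep the modulus of continuity of [f], hence the same net serves every time. *)
Lemma mean_approx f e : unif_cont f -> 0 < e ->
  exists s a, (0 < size s)%N /\ forall x, `|avg s f x - a| <= e.
Proof.
have [_ _ _ cov] := chainW.
move=> uf e0; have e40 : 0 < e / 4 by lra.
have [n hn] := uf _ e40; have [s0' cov0] := cov n.
have s0 : (0 < size s0')%N by have [t] := cov0 0; case: (s0').
have [B B0 hB] := unif_cont_bounded uf.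
set k : R := (size s0')%:R; have k0 : 0 < k by rewrite ltr0n.
suff step m : forall s lo hi, (0 < size s)%N -> (forall x, lo <= avg s f x <= hi) ->
    hi - lo <= e + m%:R * (e / 4 / k) ->
    exists s a, (0 < size s)%N /\ forall x, `|avg s f x - a| <= e.
  pose m := Num.truncn (2 * B / (e / 4 / k)).
  apply: (step m.+1 [:: 0] (- B) B) => //.
    by move=> x; rewrite /avg big_seq1 /= invr1 mul1r addr0; rewrite -ler_norml.
  have ek0 : 0 < e / 4 / k by rewrite divr_gt0.
  have : 2 * B / (e / 4 / k) < m.+1%:R by rewrite truncnS_gt.
  rewrite ltr_pdivrMr//; lra.
elim: m => [|m IH] s lo hi ss h osc.
  exists s, lo; split=> // x; have /andP[h1 h2] := h x.
  rewrite ger0_norm ?subr_ge0//; lra.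
have [small|big] := leP (hi - lo) e.
  exists s, lo; split=> // x; have /andP[h1 h2] := h x.
  rewrite ger0_norm ?subr_ge0//; lra.
have [|lo' [hi' [h' osc']]] := avg_contract s0 cov0 (avg_unif ss hn) _ e40 h; first lra.
apply: (IH [seq t + t' | t <- s0', t' <- s] lo' hi') => [|x|].
- by rewrite size_allpairs muln_gt0 s0.
- by rewrite -avgA.
- apply: le_trans osc' _; move: osc; rewrite -natr1 mulrDl mul1r -/k; lra.
Qed.

(** Averaging over both families, in either order, gives one function that is close to [m] and to
    [m']. *)
Lemma mean_uniq f m m' : is_mean f m -> is_mean f m' -> m = m'.
Proof.
move=> h h'; apply/eqP; rewrite -subr_eq0 -normr_le0; apply/ler_addgt0Pr => e e0; rewrite add0r.
have [|s s0 hs] := h (e / 2); first lra.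
have [|s' s0' hs'] := h' (e / 2); first lra.
have h1 := avg_dist 0 s0' hs; have h2 := avg_dist 0 s0 hs'.
rewrite avgC in h2; rewrite distrC in h1.
rewrite -[m](subrK (avg s' (avg s f) 0)) -addrA; apply: le_trans (ler_normD _ _) _; lra.
Qed.

(** The mean is the infimum of the upper bounds of averages. A nearly constant average has its value
    near this infimum, because averaging a competitor once more over the same translates changes
    neither bound. *)
Lemma mean_exists f : unif_cont f -> exists m, is_mean f m.
Proof.
move=> uf; have [B B0 hB] := unif_cont_bounded uf.
pose A := [set a | exists2 s, (0 < size s)%N & forall x, avg s f x <= a].
have lbA s e a : (0 < size s)%N -> (forall x, `|avg s f x - a| <= e) -> lbound A (a - e).
  move=> s0 hs a' [s' s0' hs'].
  have h1 : avg s' (avg s f) 0 <= a'.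
    by rewrite avgC; apply: avg_le.
  apply: le_trans h1; apply: avg_ge => // t.
  by have := hs t; rewrite ler_norml => /andP[]; lra.
have inA s e a : (0 < size s)%N -> (forall x, `|avg s f x - a| <= e) -> A (a + e).
  move=> s0 hs; exists s => // x; have := hs x; rewrite ler_norml => /andP[]; lra.
exists (inf A) => e e0; have e20 : 0 < e / 2 by lra.
have [s [a [s0 hs]]] := mean_approx uf e20; exists s => // x.
have h1 : inf A <= a + e / 2 by apply: ge_inf; [exists (a - e / 2); exact: lbA hs|exact: inA hs].
have h2 : a - e / 2 <= inf A by apply: lb_le_inf; [exists (a + e / 2); exact: inA hs|exact: lbA hs].
have h3 : `|a - inf A| <= e / 2 by rewrite ler_norml; apply/andP; split; lra.
rewrite -[avg s f x](subrK a) -addrA; apply: le_trans (ler_normD _ _) _.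
have := hs x; lra.
Qed.

Definition mean f : R := xget 0 [set m | is_mean f m].

Lemma meanP f : unif_cont f -> is_mean f (mean f).
Proof. by move=> /mean_exists[m hm]; rewrite /mean; case: xgetP => [//|/(_ m)]. Qed.

Lemma meanE f m : is_mean f m -> mean f = m.
Proof.
move=> hm; rewrite /mean; case: xgetP => [m' _ hm'|/(_ m)//]; exact: mean_uniq hm' hm.
Qed.

Lemma eq_mean f g : f =1 g -> mean f = mean g.
Proof. by move=> /funext ->. Qed.

Lemma unif_contD f g : unif_cont f -> unif_cont g -> unif_cont (fun x => f x + g x).
Proof.
move=> uf ug e e0; have e20 : 0 < e / 2 by lra.
have [n hn] := uf _ e20; have [m hm] := ug _ e20; exists (maxn n m) => x y xy.
have := hn x y (chain_antitone (leq_maxl _ _) xy).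
have := hm x y (chain_antitone (leq_maxr _ _) xy).
by rewrite opprD addrACA => h1 h2; apply: le_trans (ler_normD _ _) _; lra.
Qed.

Lemma unif_contM f g : unif_cont f -> unif_cont g -> unif_cont (fun x => f x * g x).
Proof.
move=> uf ug e e0; have [A A0 hA] := unif_cont_bounded uf.
have [B B0 hB] := unif_cont_bounded ug.
pose d := e / (A + B + 1); have d0 : 0 < d by rewrite divr_gt0//; lra.
have hd : d * (A + B + 1) = e by rewrite divfK//; lra.
have [n hn] := uf _ d0; have [m hm] := ug _ d0; exists (maxn n m) => x y xy.
have h1 := hn x y (chain_antitone (leq_maxl _ _) xy).
have h2 := hm x y (chain_antitone (leq_maxr _ _) xy).
have -> : f x * g x - f y * g y = f x * (g x - g y) + (f x - f y) * g y by ring.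
apply: le_trans (ler_normD _ _) _; rewrite !normrM.
have := ler_pM (normr_ge0 _) (normr_ge0 _) (hA x) h2.
have := ler_pM (normr_ge0 _) (normr_ge0 _) h1 (hB y); nra.
Qed.

Lemma unif_cont_cst a : unif_cont (fun=> a).
Proof. by move=> e e0; exists 0%N => x y _; rewrite subrr normr0 ltW. Qed.

Lemma unif_contZ a f : unif_cont f -> unif_cont (fun x => a * f x).
Proof. by move=> uf; apply: unif_contM => //; exact: unif_cont_cst. Qed.

Lemma unif_contN f : unif_cont f -> unif_cont (fun x => - f x).
Proof. by move=> /(unif_contZ (-1)) h; under eq_fun do rewrite -mulN1r. Qed.

Lemma unif_cont_sum (I : Type) (r : seq I) (F : I -> H -> R) :
  (forall i, unif_cont (F i)) -> unif_cont (fun x => \sum_(i <- r) F i x).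
Proof.
move=> uF; elim: r => [|i r IH].
  by under eq_fun do rewrite big_nil; exact: unif_cont_cst.
by under eq_fun do rewrite big_cons; exact: unif_contD.
Qed.

Lemma unif_cont_shift z f : unif_cont f -> unif_cont (fun x => f (x + z)).
Proof.
move=> uf e /uf[n hn]; exists n => x y xy; apply: hn.
by rewrite opprD addrACA subrr addr0.
Qed.

Lemma unif_cont_refl z f : unif_cont f -> unif_cont (fun x => f (z - x)).
Proof.
have [_ WN _ _] := chainW.
move=> uf e /uf[n hn]; exists n => x y xy; apply: hn.
by rewrite opprB addrC addrA subrK -opprB; exact: WN.
Qed.

Lemma is_mean_cst a : is_mean (fun=> a) a.
Proof.
move=> e e0; exists [:: 0] => // x.
by rewrite /avg big_seq1 invr1 mul1r subrr normr0 ltW.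
Qed.

Lemma mean_cst a : mean (fun=> a) = a.
Proof. exact/meanE/is_mean_cst. Qed.

Lemma meanD f g : unif_cont f -> unif_cont g ->
  mean (fun x => f x + g x) = mean f + mean g.
Proof.
move=> /meanP hf /meanP hg; apply: meanE => e e0.
have [|s s0 hs] := hf (e / 2); first lra.
have [|s' s0' hs'] := hg (e / 2); first lra.
exists [seq t + t' | t <- s, t' <- s'] => [|x]; first by rewrite size_allpairs muln_gt0 s0.
rewrite avgD -!avgA (avgC s s' f) opprD addrACA.
have h1 := avg_dist x s0' hs; have h2 := avg_dist x s0 hs'.
apply: le_trans (ler_normD _ _) _; lra.
Qed.

Lemma meanZ a f : unif_cont f -> mean (fun x => a * f x) = a * mean f.
Proof.
move=> /meanP hf; apply: meanE => e e0.
have [|s s0 hs] := hf (e / (`|a| + 1)); first by rewrite divr_gt0// ltr_wpDl.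
exists s => // x; rewrite avgZ -mulrBr normrM.
have a1 : 0 < `|a| + 1 by rewrite ltr_wpDl.
have := hs x; rewrite ler_pdivlMr// => h; apply: le_trans h.
by rewrite mulrC ler_wpM2l// lerDl.
Qed.

Lemma meanN f : unif_cont f -> mean (fun x => - f x) = - mean f.
Proof.
by move=> uf; rewrite -mulN1r -meanZ//; apply: eq_mean => x; rewrite mulN1r.
Qed.

Lemma mean_sum (I : Type) (r : seq I) (F : I -> H -> R) : (forall i, unif_cont (F i)) ->
  mean (fun x => \sum_(i <- r) F i x) = \sum_(i <- r) mean (F i).
Proof.
move=> uF; elim: r => [|i r IH].
  by rewrite big_nil; under eq_mean do rewrite big_nil; exact: mean_cst.
rewrite big_cons -IH -meanD//; last exact: unif_cont_sum.
by apply: eq_mean => x; rewrite big_cons.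
Qed.

Lemma mean_shift z f : unif_cont f -> mean (fun x => f (x + z)) = mean f.
Proof.
move=> /meanP hf; apply: meanE => e /hf[s s0 hs]; exists s => // x.
have -> : avg s (fun t => f (t + z)) x = avg s f (x + z); last exact: hs.
by rewrite /avg; congr (_ * _); apply: eq_bigr => t _; rewrite addrAC.
Qed.

Lemma mean_ge0 f : unif_cont f -> (forall x, 0 <= f x) -> 0 <= mean f.
Proof.
move=> /meanP hf f0; rewrite leNgt; apply/negP => m0.
have [|s s0 hs] := hf (- mean f / 2); first lra.
have := hs 0; have := avg_ge0 s 0 f0; rewrite ler_norml => h /andP[]; lra.
Qed.

Lemma mean_le f g : unif_cont f -> unif_cont g -> (forall x, f x <= g x) ->
  mean f <= mean g.
Proof.
move=> uf ug fg; rewrite -subr_ge0 -meanN// -meanD//; last exact: unif_contN.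
apply: mean_ge0 => [|x]; last by rewrite subr_ge0.
by apply: unif_contD => //; exact: unif_contN.
Qed.

Lemma mean_norm_le f B : unif_cont f -> (forall x, `|f x| <= B) -> `|mean f| <= B.
Proof.
move=> uf h; rewrite ler_norml; apply/andP; split.
  rewrite -[leLHS]mean_cst; apply: mean_le => // [|x]; first exact: unif_cont_cst.
  by have := h x; rewrite ler_norml => /andP[].
rewrite -[leRHS]mean_cst; apply: mean_le => // [|x]; first exact: unif_cont_cst.
by have := h x; rewrite ler_norml => /andP[].
Qed.

(** By precompactness finitely many translates of [f] add up to at least [f x0 / 2] everywhere, and
    they all have the same mean. *)
Lemma mean_gt0 f x0 : unif_cont f -> (forall x, 0 <= f x) -> 0 < f x0 -> 0 < mean f.
Proof.
have [_ _ _ cov] := chainW.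
move=> uf f0 fx0; have fx20 : 0 < f x0 / 2 by lra.
have [n hn] := uf _ fx20; have [s hs] := cov n.
pose F x := \sum_(t <- s) f (x + t).
have uF : unif_cont F by apply: unif_cont_sum => t; exact: unif_cont_shift.
have hF x : f x0 / 2 <= F x.
  have [t ts Wt] := hs (x0 - x); rewrite /F (big_rem t)//=.
  rewrite ler_wpDr ?sumr_ge0//; have := hn x0 (x + t).
  rewrite opprD addrA => /(_ Wt); rewrite ler_norml => /andP[]; lra.
have mF : mean F = (size s)%:R * mean f.
  rewrite mean_sum; last by move=> t; exact: unif_cont_shift.
  under eq_bigr do rewrite mean_shift//.
  by rewrite big_const_seq count_predT iter_addr addr0 mulr_natl.
have : f x0 / 2 <= mean F.
  by rewrite -[leLHS]mean_cst; apply: mean_le => //; exact: unif_cont_cst.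
rewrite mF => h; have := mean_ge0 uf f0; rewrite le_eqVlt => /orP[/eqP m0|//].
by move: h; rewrite -m0 mulr0; lra.
Qed.

End Mean.

(** * The Birkhoff-Kakutani pseudo-norm of a chain *)

Section PseudoNorm.
Variables (R : realType) (H : zmodType) (W : nat -> set H).
Hypothesis chainW : precompact_chain W.

Fixpoint in_sum (s : seq nat) (x : H) : Prop :=
  if s is n :: s' then exists2 w, W n w & in_sum s' (x - w) else x = 0.

Definition weight (s : seq nat) : R := \sum_(n <- s) 2^-1 ^+ n.

Lemma weight_ge0 s : 0 <= weight s.
Proof. by apply: sumr_ge0 => n _; rewrite exprn_ge0// invr_ge0. Qed.

Lemma in_sum_cat s1 s2 x : in_sum (s1 ++ s2) x ->
  exists2 x1, in_sum s1 x1 & in_sum s2 (x - x1).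
Proof.
elim: s1 x => [|n s1 IH] x /=; first by exists 0; rewrite ?subr0.
move=> [w Ww /IH[x1 h1 h2]]; exists (w + x1); last by rewrite opprD addrA.
by exists w; rewrite // addrAC subrr add0r.
Qed.

Lemma weight_split s (a b : R) : s != [::] -> 0 < a -> 0 < b -> weight s < a + b ->
  exists s1 n s2, [/\ s = s1 ++ n :: s2, weight s1 < a & weight s2 < b].
Proof.
elim: s a => [//|n s IH] a _ a0 b0; rewrite /weight big_cons -/(weight s) => h.
have [hb|hb] := ltP (weight s) b.
  by exists [::], n, s; split; rewrite // /weight big_nil.
have [|||s1 [m [s2 [-> h1 h2]]]] := IH (a - 2^-1 ^+ n) _ _ b0; try lra.
  by apply/eqP => s0; move: hb; rewrite s0 /weight big_nil leNgt b0.
by exists (n :: s1), m, s2; split=> //; rewrite /weight big_cons -/(weight s1); lra.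
Qed.

(** Cut the list where its weight reaches half of [2^-k]. Both outer pieces lie in [W k.+1] by
    induction on the length, and so does the middle term, whose index exceeds [k] because its own
    weight is below [2^-k]; the three-term axiom concludes. *)
Lemma in_sum_small s k x : weight s < 2^-1 ^+ k -> in_sum s x -> W k x.
Proof.
have [W0 WN W3 _] := chainW.
elim: {s}(size s) {-2}s (leqnn (size s)) k x => [|N IH] s.
  by rewrite leqn0 => /eqP/size0nil -> k x _ /= ->.
have [->|s0 sN] := eqVneq s [::]; first by move=> _ k x _ /= ->.
move=> k x hs; have k0 : 0 < (2^-1 : R) ^+ k.+1 by rewrite exprn_gt0// invr_gt0.
have hk : (2^-1 : R) ^+ k = 2^-1 ^+ k.+1 + 2^-1 ^+ k.+1 by rewrite exprS; lra.
have [|s1 [m [s2 [es h1 h2]]]] := weight_split s0 k0 k0; first by rewrite -hk.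
move: hs sN; rewrite es => hs sN /in_sum_cat[x1 ix1 [w Ww ix2]].
have mk : (k < m)%N.
  rewrite ltnNge; apply/negP => mk; move: hs; apply/negP; rewrite -leNgt.
  apply: (@le_trans _ _ (2^-1 ^+ m)).
    by apply: ler_wiXn2l; rewrite ?invr_ge0// invf_le1 ?ler1n.
  rewrite /weight big_cat big_cons /= addrCA lerDl addr_ge0//; exact: weight_ge0.
rewrite -[x](subrK x1) -[x - x1](subrK w) addrAC; apply: W3.
- apply: IH h2 ix2; move: sN; rewrite size_cat /=; lia.
- apply: IH h1 ix1; move: sN; rewrite size_cat /=; lia.
- exact: chain_antitone chainW _ _ mk _ Ww.
Qed.

(** The function is the pseudo-norm truncated at 1, the infimum of the weights of all decompositions
    of [x]. A decomposition of [x1] of weight below 1 would put [x1] in [W 0]. *)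
Lemma exists_unif_cont x1 : ~ W 0 x1 -> exists f : H -> R,
  [/\ unif_cont W f, f 0 = 0 & f x1 = 1].
Proof.
have [W0 WN W3 _] := chainW.
move=> Wx1; pose A x := [set r : R | r = 1 \/ exists2 s, in_sum s x & r = weight s].
have A0 x : lbound (A x) 0 by move=> r [->//|[s _ ->]]; exact: weight_ge0.
have Ale x r : A x r -> inf (A x) <= r by move=> h; apply: ge_inf => //; exists 0.
have Ane x : A x !=set0 by exists 1; left.
exists (fun x => inf (A x)); split.
- move=> e e0; have [n hn] : exists n, (2^-1 : R) ^+ n <= e.
    have /cvgrPdist_le/(_ _ e0)[n _ hn] :
      ((fun n => (2^-1 : R) ^+ n) @ \oo --> (0 : R)).
      by apply: cvg_expr; rewrite ger0_norm ?invr_ge0// invf_lt1 ?ltr1n.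
    exists n; have := hn n (leqnn n); rewrite sub0r normrN ger0_norm//.
  suff step x y : W n (x - y) -> inf (A x) <= inf (A y) + e.
    exists n => x y xy; rewrite ler_norml; have := step _ _ xy.
    have := step y x; rewrite -opprB => /(_ (WN _ _ xy)); lra.
  move=> xy; rewrite -lerBlDr; apply: lb_le_inf => // r hr; rewrite lerBlDr.
  case: hr => [->|[s hs ->]]; first by apply: (@le_trans _ _ 1); [apply: Ale; left|lra].
  apply: (@le_trans _ _ (weight (n :: s))).
    apply: Ale; right; exists (n :: s) => //=; exists (x - y) => //.
    by rewrite opprB addrCA subrr addr0.
  by rewrite /weight big_cons addrC lerD2l.
- apply/eqP; rewrite eq_le lb_le_inf// andbT; apply: Ale; right; exists [::] => //.
  by rewrite /weight big_nil.
- apply/eqP; rewrite eq_le Ale/=; last by left.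
  apply: lb_le_inf => // r [->//|[s hs ->]]; rewrite leNgt; apply/negP => h.
  by apply: Wx1; apply: (@in_sum_small s) hs; rewrite expr0.
Qed.

End PseudoNorm.

(** * Characters of precompact groups *)

Lemma filter_all_seq (T : Type) (F : set_system T) {FF : Filter F} (I : eqType) (s : seq I)
  (A : I -> set T) :
  (forall i, F (A i)) -> F [set n | forall i, i \in s -> A i n].
Proof.
move=> h; elim: s => [|i s IH]; first exact: filterE.
apply: filterS2 (h i) IH => n hi hs j; rewrite inE => /orP[/eqP -> //|]; exact: hs.
Qed.

(** * Limits of bounded families along an ultrafilter *)

Section UltraLimit.
Variables (R : realType) (T : Type) (F : set_system T).
Hypothesis ultraF : UltraFilter F.

Lemma ultra_cvg (a : T -> R) B : (forall n, `|a n| <= B) ->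
  exists l, forall e, 0 < e -> F [set n | `|a n - l| <= e].
Proof.
move=> hB; pose A := [set t | F [set n | t <= a n]].
have BA : A (- B).
  by apply: filterE => n; have := hB n; rewrite ler_norml => /andP[].
have ubA : ubound A (B + 1).
  move=> t At; have [n /= hn] := filter_ex At; have := hB n.
  by rewrite ler_norml => /andP[_]; lra.
have supA : has_sup A by split; [exists (- B)|exists (B + 1)].
exists (sup A) => e e0.
have [t At ht] := sup_adherent e0 supA.
have nA : F (~` [set n | sup A + e <= a n]).
  have [h|//] := in_ultra_setVsetC [set n | sup A + e <= a n] ultraF.
  have : sup A + e <= sup A by apply: sup_ubound => //; exists (B + 1).
  lra.
apply: filterS2 At nA => n /= h1 /negP; rewrite -ltNge => h2.
by rewrite ler_norml; lra.
Qed.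

Lemma ultra_ccvg (a : T -> R[i]) B : (forall n, cabs (a n) <= B) ->
  exists l, forall e, 0 < e -> F [set n | cabs (a n - l) <= e].
Proof.
move=> hB.
have [l hl] := @ultra_cvg (fun n => complex.Re (a n)) B (fun n => le_trans (cabs_Re _) (hB n)).
have [m hm] := @ultra_cvg (fun n => complex.Im (a n)) B (fun n => le_trans (cabs_Im _) (hB n)).
exists (Complex l m) => e e0; have e20 : 0 < e / 2 by lra.
apply: filterS2 (hl _ e20) (hm _ e20) => n /= h1 h2.
apply: le_trans (cabs_le _) _; rewrite ReD ImD ReN ImN /=; lra.
Qed.

End UltraLimit.

(** * Positive definite functions and an extremal problem *)

Section Extremal.
Variables (R : realType) (H : zmodType) (W : nat -> set H).
Hypothesis chainW : precompact_chain W.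
Local Notation C := R[i].
Local Notation Re := complex.Re.
Local Notation Im := complex.Im.
Implicit Types (psi U : H -> C).

Definition cunif_cont U := unif_cont W (fun x => Re (U x)) /\ unif_cont W (fun x => Im (U x)).

(** Hermitian symmetry is a separate clause because only the real part of the form is asked to be
    nonnegative; with it the form is real. *)
Definition posdef psi :=
  (forall x, psi (- x) = (psi x)^*%C) /\
  forall s : seq (C * H), 0 <= Re (\sum_(p <- s) \sum_(q <- s) p.1 * q.1^*%C * psi (p.2 - q.2)).

(** On the spectral side this multiplies the measure of [psi] by [1 + Re (c * chi z)], which is
    nonnegative when [c] is unimodular. *)
Definition kick (c : C) z psi x : C :=
  psi x + 2^-1%:C%C * (c * psi (x + z) + c^*%C * psi (x - z)).

(** The form is tested on 0 and [z] with coefficients 1 and a unimodular [a] such that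
    [a * psi z = - |psi z|]; its real part is then twice [Re (psi 0) - |psi z|]. *)
Lemma posdef_bound psi z : posdef psi -> cabs (psi z) <= Re (psi 0).
Proof.
move=> [herm pos]; have i0 : Im (psi 0) = 0.
  suff : Im (psi 0) = - Im (psi 0) by lra.
  by rewrite -{1}oppr0 herm ImJ.
have [->|z0] := eqVneq (psi z) 0.
  have := pos [:: (1, 0)]; rewrite !big_cons !big_nil; cbn [fst snd].
  rewrite subr0 !addr0 conjc1 !mul1r.
  by rewrite cabs0.
have a0 : cabs (psi z) != 0 by apply: contra_neq z0; exact: cabs_eq0.
pose a : C := - (psi z)^*%C * (cabs (psi z))^-1%:C%C.
have ha : a * a^*%C = 1.
  rewrite unimodular_conj// cabsM cabsN cabs_conj cabs_real ger0_norm ?mulfV//.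
  by rewrite invr_ge0 cabs_ge0.
have h : a * psi z = (- cabs (psi z))%:C%C.
  rewrite /a mulrAC mulNr [_^*%C * _]mulrC mulC_conj rmorphN rmorphXn /= mulNr -!rmorphXn -rmorphM/=.
  by rewrite expr2 mulfK.
have := pos [:: (1, 0); (a, z)]; rewrite !big_cons !big_nil; cbn [fst snd].
rewrite !addr0 !subrr !subr0 sub0r conjc1 herm ha !mul1r mulr1 h.
have -> : a^*%C * (psi z)^*%C = (- cabs (psi z))%:C%C by rewrite -conjcM h conjcR.
rewrite !(@ReD R); cbn [complex.Re real_complex_def]; lra.
Qed.

(** The new form is half the form of [psi] on the doubled family in which each [(a, x)] is joined by
    [(c a, x + z)]. *)
Lemma posdef_kick c z psi : cabs c = 1 -> posdef psi -> posdef (kick c z psi).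
Proof.
move=> c1 [herm pos]; split=> [x|s].
  rewrite /kick conjcD conjcM conjcD !conjcM conjcR conjcK herm.
  rewrite -opprD -[z in - x + z]opprK -opprD !herm; congr (_ + _ * _); exact: addrC.
have := pos (s ++ [seq (c * p.1, p.2 + z) | p <- s]).
set S := \sum_(p <- s) _ => /=; suff -> : S = 2^-1%:C%C * \sum_(p <- s ++ [seq (c * p.1, p.2 + z) | p <- s])
   \sum_(q <- s ++ [seq (c * p.1, p.2 + z) | p <- s]) p.1 * q.1^*%C * psi (p.2 - q.2).
  by rewrite Re_scale => h; rewrite mulr_ge0// invr_ge0.
rewrite big_cat big_map /= -big_split /= mulr_sumr; apply: eq_bigr => p _.
rewrite !big_cat !big_map /= addrACA -!big_split /= mulr_sumr; apply: eq_bigr => q _.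
rewrite /kick conjcM.
have -> : p.2 + z - (q.2 + z) = p.2 - q.2 by rewrite opprD addrACA subrr addr0.
have -> : p.2 - (q.2 + z) = p.2 - q.2 - z by rewrite opprD addrA.
have -> : p.2 + z - q.2 = p.2 - q.2 + z by rewrite addrAC.
have -> : c * p.1 * (c^*%C * q.1^*%C) = p.1 * q.1^*%C.
  by rewrite mulrACA unimodular_conj// mul1r.
set u := psi (p.2 - q.2); set v := psi _; set w := psi _.
have h2 : (2^-1%:C%C : C) = 2^-1 by rewrite fmorphV rmorph_nat.
by rewrite h2; field.
Qed.

Lemma cunif_contD U U' : cunif_cont U -> cunif_cont U' -> cunif_cont (fun x => U x + U' x).
Proof.
move=> [h1 h2] [h3 h4]; split.
  by under eq_fun do rewrite ReD; exact: unif_contD.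
by under eq_fun do rewrite ImD; exact: unif_contD.
Qed.

Lemma cunif_contZ a U : cunif_cont U -> cunif_cont (fun x => a * U x).
Proof.
move=> [h1 h2]; split.
  by under eq_fun do rewrite ReM -mulNr; apply: unif_contD => //; exact: unif_contZ.
by under eq_fun do rewrite ImM; apply: unif_contD => //; exact: unif_contZ.
Qed.

Lemma cunif_cont_shift z U : cunif_cont U -> cunif_cont (fun x => U (x + z)).
Proof. by move=> [h1 h2]; split; [exact: (unif_cont_shift z h1)|exact: (unif_cont_shift z h2)]. Qed.

Lemma cunif_cont_kick c z U : cunif_cont U -> cunif_cont (kick c z U).
Proof.
move=> uU; apply: cunif_contD => //; apply/cunif_contZ/cunif_contD; apply: cunif_contZ;
  exact: cunif_cont_shift.
Qed.

Lemma cunif_contP U : (forall e, 0 < e -> exists n, forall x y, W n (x - y) -> cabs (U x - U y) <= e) ->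
  cunif_cont U.
Proof.
move=> h; split=> e /h[n hn]; exists n => x y /hn; apply: le_trans.
  by rewrite -ReN -ReD; exact: cabs_Re.
by rewrite -ImN -ImD; exact: cabs_Im.
Qed.

Lemma unif_cont_sqr U : cunif_cont U -> unif_cont W (fun x => cabs (U x) ^+ 2).
Proof.
by move=> [h1 h2]; under eq_fun do rewrite sqr_cabs !expr2; apply: unif_contD => //; exact: unif_contM.
Qed.

Section Conv.
Variable phi : H -> R.
Hypothesis uphi : unif_cont W phi.
Hypothesis phi_even : forall x, phi (- x) = phi x.

Let uM x f : unif_cont W f -> unif_cont W (fun y => phi (x - y) * f y).
Proof. by move=> uf; apply: unif_contM => //; exact: unif_cont_refl. Qed.

Definition rconv f x : R := mean (fun y => phi (x - y) * f y).
Definition conv psi x : C := Complex (rconv (fun y => Re (psi y)) x) (rconv (fun y => Im (psi y)) x).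

Lemma rconvD f f' x : unif_cont W f -> unif_cont W f' ->
  rconv (fun y => f y + f' y) x = rconv f x + rconv f' x.
Proof.
move=> uf uf'; rewrite /rconv; under eq_mean do rewrite mulrDr.
by rewrite (meanD chainW)//; exact: uM.
Qed.

Lemma rconvZ a f x : unif_cont W f -> rconv (fun y => a * f y) x = a * rconv f x.
Proof.
move=> uf; rewrite /rconv; under eq_mean do rewrite mulrCA.
by rewrite (meanZ chainW)//; exact: uM.
Qed.

Lemma rconv_shift z f x : unif_cont W f -> rconv (fun y => f (y + z)) x = rconv f (x + z).
Proof.
move=> uf; rewrite /rconv -[RHS](mean_shift chainW z); last exact: uM.
by apply: eq_mean => y; have -> : x + z - (y + z) = x - y by rewrite opprD addrACA subrr addr0.
Qed.

Lemma rconv_bound f B B' x : unif_cont W f -> (forall y, `|phi y| <= B) -> (forall y, `|f y| <= B') ->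
  `|rconv f x| <= B * B'.
Proof.
move=> uf hB hB'; apply: (mean_norm_le chainW) => [|y]; first exact: uM.
by rewrite normrM ler_pM.
Qed.

Lemma rconv_dist f B x y e : unif_cont W f -> (forall y, `|f y| <= B) ->
  (forall u, `|phi (x - u) - phi (y - u)| <= e) -> `|rconv f x - rconv f y| <= e * B.
Proof.
move=> uf hB he; rewrite /rconv -(meanN chainW); last exact: uM.
rewrite -(meanD chainW); [|exact: uM|by apply: (unif_contN chainW); exact: uM].
apply: (mean_norm_le chainW) => [|u].
  by apply: (unif_contD chainW); [|apply: (unif_contN chainW)]; exact: uM.
by rewrite -mulrBl normrM ler_pM.
Qed.

Lemma convD psi psi' x : cunif_cont psi -> cunif_cont psi' ->
  conv (fun y => psi y + psi' y) x = conv psi x + conv psi' x.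
Proof.
move=> [h1 h2] [h3 h4]; apply: complexP; rewrite ?ReD ?ImD /= -rconvD//.
  by congr rconv; apply/funext => y; rewrite ReD.
by congr rconv; apply/funext => y; rewrite ImD.
Qed.

Lemma convZ a psi x : cunif_cont psi -> conv (fun y => a * psi y) x = a * conv psi x.
Proof.
move=> [h1 h2]; apply: complexP; rewrite ?ReM ?ImM /= -?mulNr -!rconvZ// -rconvD//;
  try exact: (unif_contZ chainW).
  by congr rconv; apply/funext => y; rewrite ReM mulNr.
by congr rconv; apply/funext => y; rewrite ImM.
Qed.

Lemma conv_shift z psi x : cunif_cont psi -> conv (fun y => psi (y + z)) x = conv psi (x + z).
Proof. by move=> [h1 h2]; apply: complexP; exact: rconv_shift. Qed.

Lemma conv_kick c z psi x : cunif_cont psi -> conv (kick c z psi) x = kick c z (conv psi) x.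
Proof.
move=> u; have us := cunif_cont_shift _ u; have uZ a z' := cunif_contZ a (us z').
rewrite /kick convD//; last exact/cunif_contZ/cunif_contD.
by rewrite convZ ?convD ?convZ ?conv_shift//; exact: cunif_contD.
Qed.

(** The modulus of continuity comes from [phi] alone, so convolution turns a bounded family into an
    equicontinuous one. *)
Lemma conv_dist psi B x y e : cunif_cont psi -> (forall y, cabs (psi y) <= B) ->
  (forall u, `|phi (x - u) - phi (y - u)| <= e) -> cabs (conv psi x - conv psi y) <= 2 * e * B.
Proof.
move=> [h1 h2] hB he; apply: le_trans (cabs_le _) _; rewrite ReD ImD ReN ImN /=.
have := rconv_dist h1 (fun y => le_trans (cabs_Re _) (hB y)) he.
have := rconv_dist h2 (fun y => le_trans (cabs_Im _) (hB y)) he; lra.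
Qed.

(** Averaging a convolution amounts to averaging [phi], so mean zero passes from [phi] to its
    convolutions, uniformly over bounded [f]. *)
Lemma rconv_avg s f B x e : (0 < size s)%N -> unif_cont W f -> (forall y, `|f y| <= B) ->
  (forall y, `|avg s phi y| <= e) -> `|avg s (rconv f) x| <= e * B.
Proof.
move=> s0 uf hB he.
have uF y : unif_cont W (fun u => avg s phi (y - u) * f u).
  apply: (unif_contM chainW) => //; apply: (@unif_cont_refl _ _ W chainW y (avg s phi)).
  apply: (unif_contZ chainW); apply: (unif_cont_sum chainW) => t; exact: unif_cont_shift.
have -> : avg s (rconv f) x = mean (fun u => avg s phi (x - u) * f u).
  rewrite /avg /rconv -(mean_sum chainW); last by move=> t; exact: uM.
  rewrite -(meanZ chainW); last by apply: (unif_cont_sum chainW) => t; exact: uM.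
  apply: eq_mean => u; rewrite -mulrA mulr_suml; congr (_ * _).
  by apply: eq_bigr => t _; rewrite addrAC.
by apply: (mean_norm_le chainW) => // u; rewrite normrM ler_pM.
Qed.

Lemma conv_bound psi B B' x : cunif_cont psi -> (forall y, `|phi y| <= B) ->
  (forall y, cabs (psi y) <= B') -> cabs (conv psi x) <= 2 * B * B'.
Proof.
move=> [h1 h2] hB hB'; apply: le_trans (cabs_le _) _ => /=.
have := rconv_bound x h1 hB (fun y => le_trans (cabs_Re _) (hB' y)).
have := rconv_bound x h2 hB (fun y => le_trans (cabs_Im _) (hB' y)); lra.
Qed.

Lemma cunif_cont_conv psi B : cunif_cont psi -> 0 <= B -> (forall y, cabs (psi y) <= B) ->
  cunif_cont (conv psi).
Proof.
move=> u B0 hB; apply: cunif_contP => e e0.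
have d0 : 0 < e / (2 * B + 1) by rewrite divr_gt0//; lra.
have [n hn] := uphi d0; exists n => x y xy.
have h v : `|phi (x - v) - phi (y - v)| <= e / (2 * B + 1).
  by apply: hn; rewrite opprB addrA subrK.
apply: le_trans (conv_dist u hB h) _.
rewrite [2 * _]mulrC -mulrA mulrAC ler_pdivrMr; nra.
Qed.

End Conv.

Lemma Re_unimodular (c w : C) : cabs c = 1 -> `|Re (c * w)| <= cabs w.
Proof. by move=> c1; apply: le_trans (cabs_Re _) _; rewrite cabsM c1 mul1r. Qed.

Lemma sqr_cabsD U U' x : cabs (U x + U' x) ^+ 2 =
  cabs (U x) ^+ 2 + 2 * (Re (U x) * Re (U' x) + Im (U x) * Im (U' x)) + cabs (U' x) ^+ 2.
Proof. by rewrite !sqr_cabs ReD ImD; ring. Qed.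

Lemma mean_sqr_cabsD U U' : cunif_cont U -> cunif_cont U' ->
  mean (fun x => cabs (U x + U' x) ^+ 2) =
  mean (fun x => cabs (U x) ^+ 2) +
  2 * mean (fun x => Re (U x) * Re (U' x) + Im (U x) * Im (U' x)) +
  mean (fun x => cabs (U' x) ^+ 2).
Proof.
move=> uU uU'; have u1 : unif_cont W (fun x => Re (U x) * Re (U' x) + Im (U x) * Im (U' x)).
  by case: uU uU' => [? ?] [? ?]; apply: (unif_contD chainW); exact: (unif_contM chainW).
have u2 := unif_cont_sqr uU; have u3 := unif_cont_sqr uU'.
rewrite -(meanZ chainW)// -(meanD chainW)//; last exact: (unif_contZ chainW).
rewrite -(meanD chainW)//; last by apply: (unif_contD chainW) => //; exact: (unif_contZ chainW).
by apply: eq_mean => x; exact: sqr_cabsD.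
Qed.

Lemma mean_sqr_cabsZ (a : R) U : cunif_cont U ->
  mean (fun x => cabs (a%:C%C * U x) ^+ 2) = a ^+ 2 * mean (fun x => cabs (U x) ^+ 2).
Proof.
move=> uU; rewrite -(meanZ chainW); last exact: unif_cont_sqr.
by apply: eq_mean => x; rewrite cabsM cabs_real exprMn real_normK ?num_real.
Qed.

(** With [a], [b], [t] the values of [theta] at [x + z], [x - z], [x], the hypotheses say that the
    limit of the defect in [near_maximizer] vanishes for [c = 'i] and for [c = 1]; combining them
    eliminates [b]. *)
Lemma complex_pencil (a b t w : C) :
  2^-1%:C%C * ('i%C * a + - 'i%C * b) - - (Im w)%:C%C * t = 0 ->
  2^-1%:C%C * (a + b) - (Re w)%:C%C * t = 0 -> a = w * t.
Proof.
have h2 : (2^-1%:C%C : C) = 2^-1 by rewrite fmorphV rmorph_nat.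
rewrite h2 => e1 e2; rewrite [w in RHS]complexE.
have i2 : ('i%C : C) * 'i%C = -1 by rewrite -expr2 sqr_i.
set u : C := (Re w)%:C%C in e2 *; set v : C := (Im w)%:C%C in e1 *.
have e1' : 'i%C * (2^-1 * ('i%C * a + - 'i%C * b) - - v * t) = 0 by rewrite e1 mulr0.
have e3 : 'i%C * (2^-1 * ('i%C * a + - 'i%C * b) - - v * t) = 2^-1 * (b - a) + 'i%C * v * t.
  transitivity (2^-1 * (('i%C * 'i%C) * (a - b)) + 'i%C * v * t); first by ring.
  by rewrite i2 mulN1r opprB.
rewrite e3 in e1'.
have -> : a = (2^-1 * (a + b) - u * t) - (2^-1 * (b - a) + 'i%C * v * t) + (u + 'i%C * v) * t by field.
by rewrite e1' e2 subr0 add0r.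
Qed.

(* The two bounds and the parallelogram-type identity
   (1 - r) |U + K|^2 + (1 + r) |U - K|^2 = 2 |U|^2 + 2 |K|^2 - 4 r <U, K>. *)
Lemma convexity_gap U K (r s : R) : cunif_cont U -> cunif_cont K -> `|r| <= 1 ->
  mean (fun x => cabs (U x) ^+ 2) <= s ->
  mean (fun x => cabs (U x + K x) ^+ 2) <= s * (1 + r) ^+ 2 ->
  mean (fun x => cabs (U x + (-1)%:C%C * K x) ^+ 2) <= s * (1 - r) ^+ 2 ->
  mean (fun x => cabs (K x + (- r)%:C%C * U x) ^+ 2) <= s - mean (fun x => cabs (U x) ^+ 2).
Proof.
move=> uU uK r1 As.
have uZ a : cunif_cont (fun x => a%:C%C * U x) by exact: cunif_contZ.
have uZK a : cunif_cont (fun x => a%:C%C * K x) by exact: cunif_contZ.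
rewrite !mean_sqr_cabsD// !mean_sqr_cabsZ//.
set A := mean (fun x => cabs (U x) ^+ 2) in As *; set D := mean (fun x => cabs (K x) ^+ 2).
set B := mean (fun x => Re (U x) * Re (K x) + _).
have uB : unif_cont W (fun x => Re (U x) * Re (K x) + Im (U x) * Im (K x)).
  by case: uU uK => [? ?] [? ?]; apply: (unif_contD chainW); exact: (unif_contM chainW).
have -> : mean (fun x => Re (U x) * Re ((-1)%:C%C * K x) + Im (U x) * Im ((-1)%:C%C * K x)) = - B.
  by rewrite -(meanN chainW)//; apply: eq_mean => x; rewrite Re_scale Im_scale; ring.
have -> : mean (fun x => Re (K x) * Re ((- r)%:C%C * U x) + Im (K x) * Im ((- r)%:C%C * U x)) = - r * B.
  by rewrite -(meanZ chainW)//; apply: eq_mean => x; rewrite Re_scale Im_scale; ring.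
move: r1; rewrite ler_norml => /andP[r1 r2] e1 e2.
have h1 : (1 - r) * (A + 2 * B + D) <= (1 - r) * (s * (1 + r) ^+ 2) by rewrite ler_wpM2l//; lra.
have h2 : (1 + r) * (A + 2 * - B + (-1) ^+ 2 * D) <= (1 + r) * (s * (1 - r) ^+ 2) by rewrite ler_wpM2l//; lra.
have h3 : 0 <= r ^+ 2 * (s - A) by rewrite mulr_ge0 ?sqr_ge0//; lra.
lra.
Qed.

Section Maximizer.
Variable phi : H -> R.
Hypothesis uphi : unif_cont W phi.
Hypothesis phi_even : forall x, phi (- x) = phi x.
Hypothesis phi_pos : posdef (fun x => (phi x)%:C%C).
Hypothesis phi0 : 0 < phi 0.
Hypothesis phi_avg : forall e : R, 0 < e ->
  exists2 s, (0 < size s)%N & forall x, `|avg s phi x| <= e.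
Local Notation conv := (conv phi).

Definition energy psi := mean (fun x => cabs (conv psi x) ^+ 2).
Definition states psi := cunif_cont psi /\ posdef psi.

Lemma phi_le x : `|phi x| <= phi 0.
Proof. by have := posdef_bound x phi_pos; rewrite cabs_real. Qed.

Lemma states_conv psi : states psi -> cunif_cont (conv psi).
Proof.
move=> [u p]; apply: (cunif_cont_conv uphi u) (fun z => posdef_bound z p).
exact: le_trans (cabs_ge0 _) (posdef_bound 0 p).
Qed.

Lemma states_kick c z psi : cabs c = 1 -> states psi -> states (kick c z psi).
Proof. by move=> c1 [u p]; split; [exact: cunif_cont_kick|exact: posdef_kick]. Qed.

Lemma kick_at0 c z psi : states psi -> Re (kick c z psi 0) = Re (psi 0) + Re (c * psi z).
Proof.
move=> [_ [herm _]]; rewrite /kick add0r sub0r herm -conjcM ReD Re_scale ReD ReJ; lra.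
Qed.

Lemma states_scale (a : R) psi : 0 <= a -> states psi -> states (fun x => a%:C%C * psi x).
Proof.
move=> a0 [u [herm pos]]; split; first exact: cunif_contZ.
split=> [x|s]; first by rewrite conjcM conjcR herm.
have := pos s; set S := \sum_(p <- s) _ => h.
have -> : \sum_(p <- s) \sum_(q <- s) p.1 * q.1^*%C * (a%:C%C * psi (p.2 - q.2)) = a%:C%C * S.
  rewrite /S mulr_sumr; apply: eq_bigr => p _; rewrite mulr_sumr; apply: eq_bigr => q _.
  by rewrite mulrCA.
by rewrite Re_scale mulr_ge0.
Qed.

Lemma energy_scale (a : R) psi : states psi ->
  energy (fun x => a%:C%C * psi x) = a ^+ 2 * energy psi.
Proof.
move=> S; rewrite -mean_sqr_cabsZ; last exact: states_conv.
by apply: eq_mean => x; rewrite (convZ uphi) //; case: S.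
Qed.

Definition energies := [set r | exists psi, [/\ states psi, Re (psi 0) = 1 & r = energy psi]].

Lemma energy_ub : ubound energies ((2 * phi 0) ^+ 2).
Proof.
move=> _ [psi [S p1 ->]]; rewrite -[leRHS](mean_cst H).
apply: (mean_le chainW) => [||x]; [exact/unif_cont_sqr/states_conv|exact: unif_cont_cst|].
rewrite ler_sqr ?nnegrE ?cabs_ge0//; last by have := phi0; lra.
case: S => u p; have := conv_bound uphi x u phi_le (fun z => posdef_bound z p).
by rewrite p1 mulr1.
Qed.

Let sup_e := sup energies.

Lemma energy_le psi : states psi -> energy psi <= sup_e * Re (psi 0) ^+ 2.
Proof.
move=> S; have p0 : 0 <= Re (psi 0).
  by apply: le_trans (cabs_ge0 _) (posdef_bound 0 _); case: S.
move: p0; rewrite le_eqVlt => /orP[/eqP p0|p0].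
  have psi0 x : psi x = 0.
    by case: S => _ p; apply: cabs_eq0; apply/eqP; rewrite eq_le cabs_ge0 andbT p0 posdef_bound.
  rewrite -p0 expr0n mulr0 /energy.
  have -> : psi = (fun x => (0%:C%C : C) * psi x) by apply/funext => x; rewrite psi0 mulr0.
  by rewrite -/(energy _) energy_scale// expr0n mul0r.
set a := Re (psi 0); have ea : energy psi = a ^+ 2 * energy (fun x => a^-1%:C%C * psi x).
  by rewrite energy_scale// mulrA -exprMn mulfV ?gt_eqF// expr1n mul1r.
rewrite ea mulrC ler_pM2r ?exprn_gt0//; apply: sup_ubound.
  by exists ((2 * phi 0) ^+ 2); exact: energy_ub.
exists (fun x => a^-1%:C%C * psi x); split=> //.
  by apply: states_scale => //; rewrite invr_ge0 ltW.
by rewrite Re_scale mulVf// gt_eqF.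
Qed.

(* If [psi] nearly maximizes the energy, neither [kick c z psi] nor [kick (- c) z psi], whose
   average is [psi], can have a larger normalized energy; by strict convexity both are then
   nearly proportional to [psi] after convolution with [phi]. *)
Lemma near_maximizer c z psi (r := Re (c * psi z)) (U := conv psi) : states psi ->
  Re (psi 0) = 1 -> cabs c = 1 ->
  mean (fun x => cabs (2^-1%:C%C * (c * U (x + z) + c^*%C * U (x - z)) - r%:C%C * U x) ^+ 2)
    <= sup_e - energy psi.
Proof.
move=> S p1 c1; pose K x := 2^-1%:C%C * (c * U (x + z) + c^*%C * U (x - z)).
have uU : cunif_cont U by exact: states_conv.
have uK : cunif_cont K.
  by apply/cunif_contZ/cunif_contD; apply: cunif_contZ; exact: cunif_cont_shift.
have ecK a : cabs a = 1 -> a * a^*%C = 1 by exact: unimodular_conj.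
have e1 : mean (fun x => cabs (U x + K x) ^+ 2) <= sup_e * (1 + r) ^+ 2.
  have := energy_le (states_kick z c1 S); rewrite kick_at0// p1 /energy; apply: le_trans.
  by rewrite le_eqVlt; apply/orP; left; apply/eqP/eq_mean => x; rewrite (conv_kick uphi)//; case: S.
have c1' : cabs (- c) = 1 by rewrite cabsN.
have e2 : mean (fun x => cabs (U x + (-1)%:C%C * K x) ^+ 2) <= sup_e * (1 - r) ^+ 2.
  have := energy_le (states_kick z c1' S); rewrite kick_at0// p1 /energy mulNr ReN; apply: le_trans.
  rewrite le_eqVlt; apply/orP; left; apply/eqP/eq_mean => x; rewrite (conv_kick uphi)//; last by case: S.
  congr (cabs (_ + _) ^+ 2); rewrite /K rmorphN rmorph1 rmorphN /= /U.
  ring.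
have r1 : `|r| <= 1.
  by apply: le_trans (Re_unimodular _ c1) _; rewrite -p1 posdef_bound//; case: S.
have As : energy psi <= sup_e by have := energy_le S; rewrite p1 expr1n mulr1.
have := convexity_gap uU uK r1 As e1 e2; apply: le_trans.
by rewrite le_eqVlt; apply/orP; left; apply/eqP/eq_mean => x; rewrite rmorphN mulNr.
Qed.


(** [phi] itself competes, and its convolution with itself takes at 0 the value mean of
    [phi ^ 2]. *)
Lemma sup_energy_gt0 : 0 < sup_e.
Proof.
pose phiC x : C := (phi x)%:C%C.
have S : states phiC.
  split=> //; apply: cunif_contP => e /uphi[n hn]; exists n => x y /hn.
  by rewrite -rmorphB cabs_real.
suff e0 : 0 < energy phiC.
  have := lt_le_trans e0 (energy_le S).
  by rewrite pmulr_lgt0// exprn_gt0.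
apply: (mean_gt0 chainW (x0 := 0)) => [|x|]; [exact/unif_cont_sqr/states_conv|exact: sqr_ge0|].
rewrite exprn_gt0//; apply: lt_le_trans (cabs_Re _); rewrite normr_gt0 gt_eqF//=.
apply: (mean_gt0 chainW (x0 := 0)) => [|x|].
- by apply: (unif_contM chainW) => //; exact: unif_cont_refl.
- by rewrite /= sub0r phi_even -expr2 sqr_ge0.
- by rewrite /= subr0 mulr_gt0.
Qed.

Lemma states_approx e : 0 < e ->
  exists psi, [/\ states psi, Re (psi 0) = 1 & sup_e - energy psi <= e].
Proof.
move=> e0; have hs : has_sup energies.
  split; last by exists ((2 * phi 0) ^+ 2); exact: energy_ub.
  pose phiC x : C := (phi x)%:C%C.
  have S : states phiC.
    split=> //; apply: cunif_contP => d /uphi[n hn]; exists n => x y /hn.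
    by rewrite -rmorphB cabs_real.
  exists (energy (fun x => (phi 0)^-1%:C%C * phiC x)), (fun x => (phi 0)^-1%:C%C * phiC x).
  split=> //; first by apply: states_scale => //; rewrite invr_ge0 ltW.
  by rewrite Re_scale /= mulVf// gt_eqF.
have [_ [psi [S p1 ->]] h] := sup_adherent e0 hs.
by exists psi; split=> //; rewrite /sup_e; lra.
Qed.

(** [w] and [theta] are the limits of a maximizing sequence [psi n] and of its convolutions [U n].
    In the limit [near_maximizer] yields [theta (x + z) = w z * theta x]; cancelling a nonzero
    [theta x0] gives multiplicativity of [w], and continuity of [theta] gives that of [w]. *)
Lemma exists_character : exists chi : H -> C,
  [/\ forall x y, chi (x + y) = chi x * chi y, forall x, cabs (chi x) = 1,
      forall e, 0 < e -> exists n, forall x, W n x -> cabs (chi x - 1) <= e &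
      exists x, chi x <> 1].
Proof.
have [W0 WN _ cov] := chainW.
have s0 := sup_energy_gt0.
have hn0 n : 0 < n.+1%:R^-1 :> R by rewrite invr_gt0.
have [psi hpsi] := choice (fun n => states_approx (hn0 n)).
have S n : states (psi n) by have [] := hpsi n.
have psi1 n x : cabs (psi n x) <= 1.
  by have [[_ p] <- _] := hpsi n; exact: posdef_bound.
have [F [ultraF ooF]] := ultraFilterLemma (F := \oo) _.
have small e : 0 < e -> F [set n | sup_e - energy (psi n) <= e].
  move=> e0; apply: ooF; exists (Num.truncn e^-1) => // n /= hn.
  have [_ _ h] := hpsi n; apply: le_trans h _.
  rewrite invf_ple ?posrE//; apply: ltW; apply: lt_le_trans (truncnS_gt _) _.
  by rewrite ler_nat.
pose U n := conv (psi n).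
have uU n : cunif_cont (U n) by exact: states_conv.
have Uequi e : 0 < e -> exists N, forall x y, W N (x - y) -> forall n, cabs (U n x - U n y) <= e.
  move=> e0; have e20 : 0 < e / 2 by lra.
  have [N hN] := uphi e20; exists N => x y xy n.
  have h v : `|phi (x - v) - phi (y - v)| <= e / 2 by apply: hN; rewrite opprB addrA subrK.
  have [u _] := S n; have := conv_dist uphi u (psi1 n) h; lra.
have Ub n x : cabs (U n x) <= 2 * phi 0.
  by have [u _] := S n; have := conv_bound uphi x u phi_le (psi1 n); rewrite mulr1.
have [theta htheta] := choice (fun x => ultra_ccvg ultraF (Ub^~ x)).
have [w hw] := choice (fun z => ultra_ccvg ultraF (psi1^~ z)).
have theta_equi e : 0 < e -> exists N, forall x y, W N (x - y) -> cabs (theta x - theta y) <= e.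
  move=> e0; have e30 : 0 < e / 3 by lra.
  have [N hN] := Uequi _ e30; exists N => x y xy.
  have [n [h1 h2]] := filter_ex (filterI (htheta x _ e30) (htheta y _ e30)).
  have := hN x y xy n; move: h1 h2 => /= h1 h2 h3; rewrite cabsB in h1.
  apply: le_trans (cabs_sub_trans (U n x) _ _) _.
  have := cabs_sub_trans (U n y) (U n x) (theta y); lra.
have utheta : cunif_cont theta by exact: cunif_contP.
(* Equicontinuity reduces this to the finitely many points of a net. Uniformity is needed because
   the defect is controlled only through a mean over all of [H]. *)
have unifU e : 0 < e -> F [set n | forall x, cabs (U n x - theta x) <= e].
  move=> e0; have e30 : 0 < e / 3 by lra.
  have [N1 hN1] := Uequi _ e30; have [N2 hN2] := theta_equi _ e30.
  have [l hl] := cov (maxn N1 N2).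
  have Fl : F [set n | forall t, t \in l -> cabs (U n t - theta t) <= e / 3].
    by apply: filter_all_seq => t; exact: htheta.
  apply: filterS Fl => n h x.
  have [t tl Wt] := hl x; have /= h1 := h t tl.
  have h2 := hN1 x t (chain_antitone chainW (leq_maxl _ _) Wt) n.
  have h3 := hN2 x t (chain_antitone chainW (leq_maxr _ _) Wt); rewrite cabsB in h3.
  apply: le_trans (cabs_sub_trans (U n t) _ _) _.
  have := cabs_sub_trans (theta t) (U n t) (theta x); lra.
have [B hB] : exists B, forall x, cabs (theta x) <= B.
  have [n /= hn] := filter_ex (unifU _ ltr01); exists (1 + 2 * phi 0) => x.
  have := cabs_sub_ge (theta x) (U n x); rewrite cabsB; have := hn x; have := Ub n x; lra.
have B0 : 0 <= B := le_trans (cabs_ge0 _) (hB 0).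
pose D c z x := 2^-1%:C%C * (c * theta (x + z) + c^*%C * theta (x - z)) - (Re (c * w z))%:C%C * theta x.
have uD c z : unif_cont W (fun x => cabs (D c z x) ^+ 2).
  apply: unif_cont_sqr; apply: cunif_contD.
    by apply/cunif_contZ/cunif_contD; apply: cunif_contZ; exact: cunif_cont_shift.
  have -> : (fun x => - ((Re (c * w z))%:C%C * theta x)) = (fun x => (- (Re (c * w z))%:C%C) * theta x).
    by apply/funext => x; rewrite mulNr.
  exact: cunif_contZ.
(* [D] and the defect [Dn] of [psi n] differ by at most [e * (2 + B)]: [e] from the shifted terms,
   [e * B] from replacing [psi n z] by [w z], [e] from replacing [U n x] by [theta x]. The factors 2
   come from [(a + b)^2 <= 2 a^2 + 2 b^2]. *)
have Dbound c z e : cabs c = 1 -> 0 < e -> mean (fun x => cabs (D c z x) ^+ 2) <= 2 * e + 2 * (e * (2 + B)) ^+ 2.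
  move=> c1 e0.
  have [n [[/= h1 h2] h3]] := filter_ex (filterI (filterI (unifU _ e0) (hw z _ e0)) (small _ e0)).
  have [_ p1 _] := hpsi n; pose rn := Re (c * psi n z).
  pose Dn x := 2^-1%:C%C * (c * U n (x + z) + c^*%C * U n (x - z)) - rn%:C%C * U n x.
  have uDn : unif_cont W (fun x => cabs (Dn x) ^+ 2).
    apply: unif_cont_sqr; apply: cunif_contD.
      by apply/cunif_contZ/cunif_contD; apply: cunif_contZ; exact: cunif_cont_shift.
    have -> : (fun x => - (rn%:C%C * U n x)) = (fun x => (- rn%:C%C) * U n x).
      by apply/funext => x; rewrite mulNr.
    exact: cunif_contZ.
  have hDn : mean (fun x => cabs (Dn x) ^+ 2) <= e := le_trans (near_maximizer z (S n) p1 c1) h3.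
  have rn1 : `|rn| <= 1 := le_trans (Re_unimodular _ c1) (psi1 n z).
  have hr : `|rn - Re (c * w z)| <= e.
    by rewrite -ReN -ReD -mulrBr; exact: le_trans (Re_unimodular _ c1) h2.
  have dist x : cabs (D c z x - Dn x) <= e * (2 + B).
    have -> : D c z x - Dn x = 2^-1%:C%C * (c * (theta (x + z) - U n (x + z)) + c^*%C * (theta (x - z) - U n (x - z)))
        + ((rn - Re (c * w z))%:C%C * theta x + rn%:C%C * (U n x - theta x)).
      by rewrite /D /Dn rmorphB /=; ring.
    apply: le_trans (cabsD _ _) _; rewrite cabsM cabs_real ger0_norm ?invr_ge0//.
    have a1 := cabsD (c * (theta (x + z) - U n (x + z))) (c^*%C * (theta (x - z) - U n (x - z))).
    have a2 := cabsD ((rn - Re (c * w z))%:C%C * theta x) (rn%:C%C * (U n x - theta x)).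
    move: a1 a2; rewrite !cabsM !cabs_real cabs_conj c1 !mul1r.
    have b1 := h1 (x + z); have b2 := h1 (x - z); rewrite cabsB in b1; rewrite cabsB in b2.
    have b3 := ler_pM (normr_ge0 _) (cabs_ge0 _) hr (hB x).
    have b4 := ler_pM (normr_ge0 _) (cabs_ge0 _) rn1 (h1 x).
    lra.
  have -> : 2 * e + 2 * (e * (2 + B)) ^+ 2 = 2 * e + mean (fun _ : H => 2 * (e * (2 + B)) ^+ 2).
    by rewrite mean_cst.
  apply: (@le_trans _ _ (mean (fun x => 2 * cabs (Dn x) ^+ 2 + 2 * (e * (2 + B)) ^+ 2))).
    apply: (mean_le chainW) => // [|x].
      by apply: (unif_contD chainW); [exact: (unif_contZ chainW)|exact: unif_cont_cst].
    have := dist x; have := cabsD (D c z x - Dn x) (Dn x); rewrite subrK => a1 a2.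
    have a3 := cabs_ge0 (D c z x); have a4 := cabs_ge0 (Dn x); have a5 := cabs_ge0 (D c z x - Dn x).
    have a6 : cabs (D c z x) ^+ 2 <= (e * (2 + B) + cabs (Dn x)) ^+ 2.
      by rewrite ler_pXn2r// ?nnegrE//; lra.
    have := sqr_ge0 (e * (2 + B) - cabs (Dn x)); lra.
  rewrite (meanD chainW); [|exact: (unif_contZ chainW)|exact: unif_cont_cst].
  by rewrite (meanZ chainW)// lerD2r ler_wpM2l.
have D0 c z x : cabs c = 1 -> D c z x = 0.
  move=> c1; apply: contrapT => Dx.
  have m0 : 0 < mean (fun x => cabs (D c z x) ^+ 2).
    apply: (mean_gt0 chainW (x0 := x)) => // [y|]; first exact: sqr_ge0.
    by rewrite exprn_gt0// lt_neqAle cabs_ge0 andbT eq_sym; apply/eqP => /cabs_eq0.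
  set m := mean _ in m0; pose q := 2 + 2 * (2 + B) ^+ 2.
  have q0 : 0 < q by rewrite /q; have := sqr_ge0 (2 + B); lra.
  have mq0 : 0 < m + q by exact: addr_gt0.
  (* As [e <= 1], the bound of [Dbound] is at most [e * q], and this choice makes it [m - e * m],
     less than [m]. *)
  pose e := m / (m + q); have e0 : 0 < e by rewrite divr_gt0.
  have em : e * (m + q) = m by rewrite divfK// gt_eqF.
  have e1 : e <= 1 by rewrite (ler_pdivrMr _ _ mq0) mul1r lerDl ltW.
  have := Dbound c z _ c1 e0; rewrite -/m => h.
  have h1 : (e * (2 + B)) ^+ 2 <= e * (2 + B) ^+ 2.
    by rewrite exprMn ler_wpM2r ?sqr_ge0// expr2 ler_piMr// ltW.
  have := mulr_gt0 e0 m0; rewrite /q in em; lra.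
have mult x z : theta (x + z) = w z * theta x.
  have := D0 1 z x (cabs1 R); have ci : cabs ('i%C : C) = 1 by rewrite /cabs /= expr0n expr1n add0r sqrtr1.
  have := D0 _ z x ci; rewrite /D conjc1 !mul1r.
  have -> : ('i%C : C)^*%C = - 'i%C by apply: complexP; rewrite /= ?oppr0.
  have -> : (Re ('i%C * w z))%:C%C = - (Im (w z))%:C%C :> C.
    by rewrite -rmorphN; congr (_%:C%C); rewrite ReM /=; lra.
  exact: complex_pencil.
(* If [theta] vanished, uniform convergence would send the energies to 0, although they tend to
   [sup_e > 0]. *)
have [x0 tx0] : exists x0, theta x0 != 0.
  apply: contrapT => h; have t0 x : theta x = 0.
    by apply/eqP; apply/negPn/negP => hx; apply: h; exists x.
  pose e := sup_e / (sup_e + 2); have e0 : 0 < e by rewrite divr_gt0//; lra.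
  have e1 : e <= 1 by rewrite ler_pdivrMr; lra.
  have [n [/= h1 h2]] := filter_ex (filterI (unifU _ e0) (small _ e0)).
  have : energy (psi n) <= e ^+ 2.
    rewrite -[leRHS](mean_cst H); apply: (mean_le chainW) => [||x]; [exact: unif_cont_sqr (uU n)|exact: unif_cont_cst|].
    by have := h1 x; rewrite t0 subr0 => hx; rewrite ler_pXn2r// nnegrE ?cabs_ge0 ?ltW.
  have : e ^+ 2 <= e by rewrite expr2 ler_piMr// ltW.
  have : e * (sup_e + 2) = sup_e by rewrite /e divfK//; lra.
  have := mulr_gt0 e0 s0; lra.
have w_mul z z' : w (z + z') = w z * w z'.
  by apply: (mulIf tx0); rewrite -mult addrA mult mult mulrA [w z' * _]mulrC.
have w0 : w 0 = 1 by apply: (mulIf tx0); rewrite -mult addr0 mul1r.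
have w_le z : cabs (w z) <= 1.
  apply/ler_addgt0Pr => e e0; have [n /= hn] := filter_ex (hw z _ e0).
  have := cabs_sub_ge (w z) (psi n z); rewrite cabsB; have := psi1 n z; lra.
exists w; split=> // [x|e e0|].
- have := w_mul x (- x); rewrite subrr w0 => /(congr1 (@cabs R)); rewrite cabs1 cabsM.
  have := w_le x; have := w_le (- x); have := cabs_ge0 (w x); have := cabs_ge0 (w (- x)); nra.
- have c0 : 0 < cabs (theta x0).
    by rewrite lt_neqAle cabs_ge0 andbT eq_sym; apply/eqP => /cabs_eq0/eqP; exact/negP.
  have [N hN] := theta_equi _ (mulr_gt0 e0 c0); exists N => x Wx.
  have : cabs (theta (x0 + x) - theta x0) <= e * cabs (theta x0).
    by apply: hN; rewrite addrC addKr.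
  by rewrite mult -{2}[theta x0]mul1r -mulrBl cabsM ler_pM2r.
(* If [w] were trivial, [theta] would be constant. But suitable averages of all the [U n] are small,
   since [phi] has mean zero, so that constant would be 0. *)
- apply: contrapT => h; have w1 x : w x = 1 by apply: contrapT => hx; apply: h; exists x.
  have tc x : theta x = theta x0 by rewrite -[x](subrK x0) addrC mult w1 mul1r.
  have lim (P : C -> R) : (forall a b, `|P a - P b| <= cabs (a - b)) ->
      (forall n s x e, (0 < size s)%N -> (forall y, `|avg s phi y| <= e) -> `|avg s (fun x => P (U n x)) x| <= e) ->
      P (theta x0) = 0.
    move=> P1 P2; apply/eqP; rewrite -normr_le0; apply/ler_addgt0Pr => e e0; rewrite add0r.
    have e20 : 0 < e / 2 by lra.
    have [s ss hs] := phi_avg e20; have [n /= hn] := filter_ex (unifU _ e20).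
    have a1 := P2 n s x0 _ ss hs.
    have a2 : `|avg s (fun x => P (U n x)) x0 - P (theta x0)| <= e / 2.
      by apply: avg_dist => // t; apply: le_trans (P1 _ _) _; rewrite -(tc t).
    have := ler_normB (avg s (fun x => P (U n x)) x0) (avg s (fun x => P (U n x)) x0 - P (theta x0)).
    rewrite opprB addrC subrK; lra.
  have hRe : Re (theta x0) = 0.
    apply: lim => [a b|n s x e ss hs]; first by rewrite -ReN -ReD; exact: cabs_Re.
    have [[u _] _] := S n.
    have := rconv_avg uphi x ss u (fun y => le_trans (cabs_Re _) (psi1 n y)) hs; by rewrite mulr1.
  have hIm : Im (theta x0) = 0.
    apply: lim => [a b|n s x e ss hs]; first by rewrite -ImN -ImD; exact: cabs_Im.
    have [[_ u] _] := S n.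
    have := rconv_avg uphi x ss u (fun y => le_trans (cabs_Im _) (psi1 n y)) hs; by rewrite mulr1.
  by move/eqP: tx0; apply; apply: complexP.
Qed.

End Maximizer.
End Extremal.

Section PrecompactCharacter.
Variables (R : realType) (H : zmodType) (W : nat -> set H).
Hypothesis chainW : precompact_chain W.
Local Notation C := R[i].
Local Notation Re := complex.Re.
Local Notation Im := complex.Im.

Section Autocorrelation.
Variable g : H -> R.
Hypothesis ug : unif_cont W g.

Definition autocorr x : R := mean (fun u => g (x + u) * g u).

Let ugs z : unif_cont W (fun u => g (z + u)).
Proof. by under eq_fun do rewrite addrC; exact: unif_cont_shift. Qed.

Let ugg z z' : unif_cont W (fun u => g (z + u) * g (z' + u)).
Proof. exact: unif_contM. Qed.

Let ugg0 z : unif_cont W (fun u => g (z + u) * g u).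
Proof. exact: unif_contM. Qed.

Lemma autocorrB x y : autocorr (x - y) = mean (fun u => g (x + u) * g (y + u)).
Proof.
rewrite /autocorr -(mean_shift chainW (- y) (ugg x y)); apply: eq_mean => u.
congr (g _ * g _); last by rewrite addrC subrK.
by rewrite addrA addrAC.
Qed.

Lemma autocorr_even x : autocorr (- x) = autocorr x.
Proof.
rewrite -[in LHS]sub0r -[in RHS](subr0 x) !autocorrB; apply: eq_mean => u; exact: mulrC.
Qed.

Lemma unif_cont_autocorr : unif_cont W autocorr.
Proof.
have [B B0 hB] := unif_cont_bounded chainW ug.
move=> e e0; have d0 : 0 < e / (B + 1) by rewrite divr_gt0//; lra.
have [n hn] := ug d0; exists n => x y xy.
rewrite /autocorr -(meanN chainW)// -(meanD chainW)//; last exact: (unif_contN chainW).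
apply: (mean_norm_le chainW) => [|u].
  by apply: (unif_contD chainW) => //; exact: (unif_contN chainW).
rewrite -mulrBl normrM; have h : `|g (x + u) - g (y + u)| <= e / (B + 1).
  by apply: hn; rewrite opprD addrACA subrr addr0.
apply: le_trans (ler_pM (normr_ge0 _) (normr_ge0 _) h (hB u)) _.
rewrite mulrAC ler_pdivrMr; last lra.
by rewrite mulrDr mulr1 lerDl ltW.
Qed.

(** The form is the mean over [u] of the squared modulus of the sum of [p.1 * g (p.2 + u)], whose
    real and imaginary parts are [A] and [B]. *)
Lemma posdef_autocorr : posdef (fun x => (autocorr x)%:C%C : C).
Proof.
split=> [x|s]; first by rewrite autocorr_even conjcR.
pose A u := \sum_(p <- s) Re p.1 * g (p.2 + u).
pose B u := \sum_(p <- s) Im p.1 * g (p.2 + u).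
have uA : unif_cont W A by apply: (unif_cont_sum chainW) => p; exact: (unif_contZ chainW).
have uB : unif_cont W B by apply: (unif_cont_sum chainW) => p; exact: (unif_contZ chainW).
suff -> : Re (\sum_(p <- s) \sum_(q <- s) p.1 * q.1^*%C * (autocorr (p.2 - q.2))%:C%C) =
    mean (fun u => A u * A u + B u * B u).
  apply: (mean_ge0 chainW) => [|x]; last by rewrite -!expr2 addr_ge0 ?sqr_ge0.
  by apply: (unif_contD chainW); exact: (unif_contM chainW).
pose G (p q : C * H) u := Re (p.1 * q.1^*%C) * (g (p.2 + u) * g (q.2 + u)).
have uG p q : unif_cont W (G p q) by exact: (unif_contZ chainW).
transitivity (mean (fun u => \sum_(p <- s) \sum_(q <- s) G p q u)).
  rewrite (mean_sum chainW); last by move=> p; exact: (unif_cont_sum chainW).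
  rewrite Re_sum; apply: eq_bigr => p _; rewrite (mean_sum chainW)// Re_sum.
  apply: eq_bigr => q _; rewrite (meanZ chainW)// -autocorrB.
  by rewrite [LHS]ReM /= mulr0 subr0.
apply: eq_mean => u; rewrite /A /B !mulr_suml -big_split; apply: eq_bigr => p _.
rewrite !mulr_sumr -big_split; apply: eq_bigr => q _.
by rewrite /G ReM ReJ ImJ /=; ring.
Qed.

Lemma autocorr_avg e : mean g = 0 -> 0 < e ->
  exists2 s, (0 < size s)%N & forall x, `|avg s autocorr x| <= e.
Proof.
move=> g0 e0; have [B B0 hB] := unif_cont_bounded chainW ug.
have d0 : 0 < e / (B + 1) by rewrite divr_gt0//; lra.
have [s s0 hs] := meanP chainW ug d0; exists s => // x.
have -> : avg s autocorr x = mean (fun u => avg s g (x + u) * g u).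
  rewrite /avg /autocorr -(mean_sum chainW)// -(meanZ chainW); last exact: (unif_cont_sum chainW).
  apply: eq_mean => u; rewrite -mulrA mulr_suml; congr (_ * _).
  by apply: eq_bigr => t _; rewrite addrAC.
apply: (mean_norm_le chainW) => [|u].
  apply: (unif_contM chainW) => //; under eq_fun do rewrite addrC.
  apply: (unif_cont_shift x (f := avg s g)); apply: (unif_contZ chainW).
  by apply: (unif_cont_sum chainW) => t; exact: unif_cont_shift.
have h := hs (x + u); rewrite g0 subr0 in h.
rewrite normrM; apply: le_trans (ler_pM (normr_ge0 _) (normr_ge0 _) h (hB u)) _.
rewrite mulrAC ler_pdivrMr; last lra.
by rewrite mulrDr mulr1 lerDl ltW.
Qed.

End Autocorrelation.

(** A point outside [W 0] provides a nonconstant uniformly continuous function; the autocorrelation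
    of this function minus its mean meets all hypotheses of the extremal problem. *)
Theorem precompact_character x1 : ~ W 0 x1 -> exists chi : H -> C,
  [/\ forall x y, chi (x + y) = chi x * chi y, forall x, cabs (chi x) = 1,
      forall e : R, 0 < e -> exists n, forall x, W n x -> cabs (chi x - 1) <= e &
      exists x, chi x <> 1].
Proof.
move=> Wx1; have [f [uf f0 f1]] := exists_unif_cont R chainW Wx1.
pose g x := f x + - mean f.
have ug : unif_cont W g by apply: (unif_contD chainW) => //; exact: unif_cont_cst.
have mg : mean g = 0.
  by rewrite (meanD chainW)//; [rewrite mean_cst subrr|exact: unif_cont_cst].
apply: (@exists_character _ _ _ chainW (autocorr g)).
- exact: unif_cont_autocorr.
- exact: autocorr_even.
- exact: posdef_autocorr.
- have [x gx] : exists x, g x <> 0.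
    apply: contrapT => h; have g0 x : g x = 0 by apply: contrapT => hx; apply: h; exists x.
    have := g0 0; have := g0 x1; rewrite /g f0 f1; lra.
  apply: (mean_gt0 chainW (x0 := x)) => [|u|].
  + by under eq_fun do rewrite add0r; exact: unif_contM.
  + by rewrite add0r -expr2 sqr_ge0.
  + by rewrite add0r -expr2 lt_neqAle sqr_ge0 andbT eq_sym sqrf_eq0; apply/eqP.
- by move=> e e0; exact: autocorr_avg.
Qed.

End PrecompactCharacter.

(** * Reduction to precompact groups *)

Section TopologicalGroups.
Variable G : topologicalZmodType.
Implicit Types (A B U K L : set G) (s F : seq G).

Lemma compact_finite_cover (T : topologicalType) (A : set T) (U : T -> set T) : compact A ->
  (forall x, A x -> nbhs x (U x)) ->
  exists2 s : seq T, (forall x, x \in s -> A x) & forall x, A x -> exists2 t, t \in s & U t x.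
Proof.
move=> cA hU; apply: contrapT => hs.
pose F := [set B : set T | exists2 s : seq T, (forall x, x \in s -> A x) &
  forall x, A x -> (forall t, t \in s -> ~ U t x) -> B x].
have FF : Filter F.
  constructor; first by exists [::].
  - move=> B B' [s s1 s2] [s' s1' s2']; exists (s ++ s') => [x|x Ax h].
      by rewrite mem_cat => /orP[]; [exact: s1|exact: s1'].
    by split; [apply: s2|apply: s2'] => // t ts; apply: h; rewrite mem_cat ts ?orbT.
  - by move=> B B' BB' [s s1 s2]; exists s => // x Ax h; apply: BB'; exact: s2.
have PF : ProperFilter F.
  apply: Build_ProperFilter_ex => B [s s1 s2]; apply: contrapT => B0; apply: hs; exists s => // x Ax.
  apply: contrapT => h; apply: B0; exists x; apply: s2 => // t ts Utx.
  by apply: h; exists t.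
have [|a [Aa clFa]] := cA F PF; first by exists [::].
have FUa : F (~` U a).
  by exists [:: a] => [x|x Ax h]; [rewrite inE => /eqP ->|apply: h; rewrite inE].
by have [b []] := clFa _ _ FUa (hU a Aa).
Qed.

Lemma nbhs0_shift U x : nbhs 0 U -> nbhs x [set y | U (y - x)].
Proof.
move=> U0; have := @sub_continuous G (x, x); rewrite /continuous_at /= subrr => /(_ _ U0).
by move=> [[P Q] /= [hP hQ] PQ]; apply: filterS hP => y Py; apply: (PQ (y, x)); split=> //; exact: nbhs_singleton.
Qed.

Lemma nbhs_shift0 U x : nbhs x U -> nbhs 0 [set y | U (y + x)].
Proof.
move=> Ux; have := @add_continuous G (0, x); rewrite /continuous_at /= add0r => /(_ _ Ux).
by move=> [[P Q] /= [hP hQ] PQ]; apply: filterS hP => y Py; apply: (PQ (y, x)); split=> //; exact: nbhs_singleton.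
Qed.

Lemma nbhs0_sub U : nbhs 0 U -> exists2 U', nbhs 0 U' & forall x y, U' x -> U' y -> U (x - y).
Proof.
move=> U0; have := @sub_continuous G (0, 0); rewrite /continuous_at /= subr0 => /(_ _ U0).
move=> [[P Q] /= [hP hQ] PQ]; exists (P `&` Q); first exact: filterI.
by move=> x y [Px _] [_ Qy]; exact: (PQ (x, y)).
Qed.

Lemma nbhs0_chain U : nbhs 0 U -> exists U', [/\ nbhs 0 U', forall x, U' x -> U' (- x) &
  forall x y z, U' x -> U' y -> U' z -> U (x + y + z)].
Proof.
move=> /nbhs0_sub[U1 U1n h1]; have [U2 U2n h2] := nbhs0_sub U1n.
pose U3 := U1 `&` U2; have U3n : nbhs 0 U3 by exact: filterI.
have N3 : nbhs 0 [set x | U3 (- x)].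
  have := @opp_continuous G 0; rewrite /continuous_at oppr0 => /(_ _ U3n); exact: filterS.
exists (U3 `&` [set x | U3 (- x)]); split; first exact: filterI.
  by move=> x [h h']; split=> //=; rewrite opprK.
move=> x y z [[_ x2] _] [_ [_ y2]] [_ [z1 _]].
by rewrite -[y]opprK -[z]opprK; apply: h1 => //; exact: h2.
Qed.

Definition totally_bounded A :=
  forall U, nbhs 0 U -> exists s, forall x, A x -> exists2 t, t \in s & U (x - t).

Lemma compact_totally_bounded A : compact A -> totally_bounded A.
Proof.
move=> cA U U0; have [s _ hs] := compact_finite_cover cA (fun x _ => nbhs0_shift x U0).
by exists s.
Qed.

Lemma totally_boundedS A B : A `<=` B -> totally_bounded B -> totally_bounded A.
Proof. by move=> AB hB U /hB[s hs]; exists s => x /AB; exact: hs. Qed.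

Lemma totally_bounded_seq s : totally_bounded [set x | x \in s].
Proof. by move=> U /nbhs_singleton U0; exists s => x xs; exists x; rewrite // subrr. Qed.

Lemma totally_boundedB A B : totally_bounded A -> totally_bounded B ->
  totally_bounded [set x | exists a b, [/\ A a, B b & x = a - b]].
Proof.
move=> hA hB U /nbhs0_sub[U' U'0 h]; have [s hs] := hA _ U'0; have [s' hs'] := hB _ U'0.
exists [seq a - b | a <- s, b <- s'] => x [a [b [Aa Bb ->]]].
have [t ts Ut] := hs a Aa; have [t' ts' Ut'] := hs' b Bb; exists (t - t').
  by apply/allpairsP; exists (t, t').
by rewrite subrACA; exact: h.
Qed.

Lemma totally_boundedD A B : totally_bounded A -> totally_bounded B ->
  totally_bounded [set x | exists a b, [/\ A a, B b & x = a + b]].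
Proof.
move=> hA hB U /nbhs0_chain[U' [U'0 _ h]]; have [s hs] := hA _ U'0; have [s' hs'] := hB _ U'0.
exists [seq a + b | a <- s, b <- s'] => x [a [b [Aa Bb ->]]].
have [t ts Ut] := hs a Aa; have [t' ts' Ut'] := hs' b Bb; exists (t + t').
  by apply/allpairsP; exists (t, t').
by rewrite opprD addrACA -[_ + _]addr0; apply: h => //; exact: nbhs_singleton.
Qed.

Definition subgroup L := L 0 /\ forall x y, L x -> L y -> L (x - y).

Lemma subgroupN L x : subgroup L -> L x -> L (- x).
Proof. by move=> [L0 LB] Lx; rewrite -sub0r; exact: LB. Qed.

Lemma subgroupD L x y : subgroup L -> L x -> L y -> L (x + y).
Proof. by move=> sL Lx Ly; rewrite -[y]opprK; apply: (sL.2) => //; exact: subgroupN. Qed.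

Lemma subgroupMz L x (k : int) : subgroup L -> L x -> L (x *~ k).
Proof.
move=> sL Lx; have Ln n : L (x *+ n).
  by elim: n => [|n IH]; [rewrite mulr0n; exact: sL.1|rewrite mulrS; exact: subgroupD].
by case: k => n; [exact: Ln|rewrite NegzE mulrNz; apply: subgroupN => //; exact: Ln].
Qed.

Fixpoint zspan F : set G :=
  if F is f :: F' then [set x | exists k : int, zspan F' (x - f *~ k)] else [set 0].

Lemma subgroup_zspan F : subgroup (zspan F).
Proof.
elim: F => [|f F IH] /=; first by split=> [//|x y /= -> ->]; rewrite subr0.
split=> [|x y [k hk] [l hl]]; first by exists 0; rewrite mulr0z subr0; exact: IH.1.
exists (k - l); rewrite mulrzBr.
by rewrite subrACA; exact: IH.2.
Qed.

Lemma mem_zspan F f : f \in F -> zspan F f.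
Proof.
elim: F => [//|g F IH]; rewrite inE => /orP[/eqP ->|/IH h] /=.
  by exists 1; rewrite mulr1z subrr; have [] := subgroup_zspan F.
by exists 0; rewrite mulr0z subr0.
Qed.

(** * Cyclic subgroups that return to a totally bounded neighbourhood *)

Section Monothetic.
Variables (L U0 : set G) (f : G).
Hypotheses (sL : subgroup L) (U0n : nbhs 0 U0) (tbU0 : totally_bounded U0).
Hypothesis recurrent : forall N, exists2 n, (N <= n)%N & exists2 u, U0 u & L (f *+ n - u).

Lemma infinite_pigeonhole (T : eqType) (s : seq T) (P : T -> nat -> Prop) :
  (forall N, exists2 n, (N <= n)%N & exists2 t, t \in s & P t n) ->
  exists2 t, t \in s & forall N, exists2 n, (N <= n)%N & P t n.
Proof.
elim: s => [|t s IH] h; first by have [n _ [t]] := h 0%N.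
have [ht|/existsNP[N0 hN0]] := pselect (forall N, exists2 n, (N <= n)%N & P t n).
  by exists t; rewrite ?inE ?eqxx.
have [|t' t's ht'] := IH; last by exists t'; rewrite // inE t's orbT.
move=> N; have [n Nn [t']] := h (maxn N N0); rewrite inE => /orP[/eqP -> Pt|t's Pt'].
  by exfalso; apply: hN0; exists n => //; apply: leq_trans Nn; exact: leq_maxr.
by exists n; [apply: leq_trans Nn; exact: leq_maxl|exists t'].
Qed.

(** Infinitely many returns fall into one small piece of [U0], and the difference of two of them is
    a return to [U]. *)
Lemma recurrent_small U : nbhs 0 U ->
  forall N, exists2 n, (N <= n)%N & exists2 u, U u & L (f *+ n - u).
Proof.
move=> /nbhs0_sub[U1 U1n hU1] N; have [s hs] := tbU0 U1n.
have [|t ts ht] := @infinite_pigeonhole _ s (fun t n => exists2 u, U1 (u - t) & L (f *+ n - u)).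
  move=> M; have [n Mn [u Uu Lu]] := recurrent M; exists n => //.
  by have [t ts Ut] := hs u Uu; exists t => //; exists u.
have [n1 _ [u1 hu1 Lu1]] := ht 0%N; have [n2 n12 [u2 hu2 Lu2]] := ht (n1 + N)%N.
exists (n2 - n1)%N; first lia.
exists (u2 - u1).
  have -> : u2 - u1 = u2 - t - (u1 - t) by rewrite opprB addrA subrK.
  exact: hU1.
rewrite mulrnBr; last by apply: leq_trans n12; exact: leq_addr.
by rewrite subrACA; exact: sL.2.
Qed.

(* If the least [n >= 0] with [n f - k f] in [U0 + L] were at least [M], then subtracting a
   suitable [j f] with [0 < j <= M] would give a smaller one. *)
Lemma monothetic_bounded : exists M, forall k : int, exists2 n, (n < M)%N &
  exists2 u, U0 u & L (f *+ n - f *~ k - u).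
Proof.
have [U [Un UN U3]] := nbhs0_chain U0n.
have [s hs] := tbU0 Un.
(* [n t] is a positive number of steps back that keeps in [U0], modulo [L], every multiple of [f]
   lying in the cell of [t]; [M] exceeds all of these. For cells without such points the condition
   is vacuous. *)
pose near_multiple t n := forall x (k : int), U0 x -> L (x - f *~ k) -> U (x - t) ->
  (0 < n)%N /\ exists2 u, U0 u & L (x - f *+ n - u).
have /choice[n hn] t : exists n, near_multiple t n.
  have [[x0 [k0 [Ux0 Lx0 Utx0]]]|h] :=
      pselect (exists x (k : int), [/\ U0 x, L (x - f *~ k) & U (x - t)]); last first.
    by exists 0%N => x k Ux Lx Utx; exfalso; apply: h; exists x, k.
  have [m km [u Uu Lu]] := recurrent_small Un `|k0|.+1.
  pose n := absz (k0 + m%:Z).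
  have hn : f *+ n = f *~ k0 + f *+ m.
    by rewrite (pmulrn f n) (pmulrn f m) -mulrzDr; congr (_ *~ _); rewrite /n; lia.
  exists n => x k Ux Lx Utx; split; first by rewrite /n; lia.
  exists (x - t + - (x0 - t) + - u); first by apply: U3; rewrite ?UN//; exact: UN.
  have -> : x - f *+ n - (x - t - (x0 - t) - u) = x0 - f *~ k0 - (f *+ m - u).
    have -> : x - t - (x0 - t) - u = x - (x0 + u) by rewrite opprB addrA subrK opprD addrA.
    by rewrite addrAC subKr hn opprD opprB addrACA.
  exact: sL.2.
pose M := (\max_(t <- s) n t).+1%N.
exists M => k.
pose P i := `[< exists2 u, U0 u & L (f *+ i - f *~ k - u) >].
have exP : exists i, P i.
  have [m km [u Uu Lu]] := recurrent_small U0n `|k|.+1.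
  exists (absz (k + m%:Z)); apply/asboolP; exists u => //.
  have -> // : f *+ absz (k + m%:Z) - f *~ k = f *+ m.
  by rewrite pmulrn -mulrzBr (pmulrn f m); congr (_ *~ _); lia.
case: (ex_minnP exP) => i /asboolP[u Uu Lu] mini; exists i; last by exists u.
rewrite ltnNge; apply/negP => Mi.
have [t ts Ut] := hs u Uu.
have [|n0 [u' Uu' Lu']] := hn t u (i%:Z - k) Uu _ Ut.
  rewrite mulrzBr -opprB; apply: subgroupN => //; rewrite pmulrn; exact: Lu.
have nM : (n t < M)%N by rewrite ltnS; exact: leq_bigmax_seq.
suff : (i <= i - n t)%N by lia.
apply: mini; apply/asboolP; exists u' => //; rewrite mulrnBr; last lia.
have -> : f *+ i - f *+ n t - f *~ k - u' = (f *+ i - f *~ k - u) + (u - f *+ n t - u').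
  by rewrite [RHS]addrA addrA subrK; congr (_ - _); exact: addrAC.
exact: subgroupD.
Qed.

End Monothetic.

(* [L] plays the role of a cocompact lattice in the compactly generated group [Hs]. *)
Lemma exists_cobounded_subgroup (Hs : set G) (U0 : set G) : hausdorff_space G -> subgroup Hs ->
  (exists2 x, Hs x & x <> 0) -> nbhs 0 U0 -> totally_bounded U0 ->
  forall F K, (forall f, f \in F -> Hs f) -> totally_bounded K ->
  (forall x, Hs x -> exists2 k, K k & zspan F (x - k)) ->
  exists L K' U x, [/\ subgroup L, totally_bounded K' &
      forall y, Hs y -> exists2 k, K' k & L (y - k)] /\
    [/\ nbhs 0 U, Hs x & forall l, L l -> ~ U (x - l)].
Proof.
move=> hG sH [x0 Hx0 x0n] U0n tbU0; elim=> [|f F IH] K hF tbK hK.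
  (* Without generators [Hs] lies in [K] and is already totally bounded, so it is enough to separate
     [x0] from 0. *)
  have := hG; rewrite open_hausdorff => /(_ x0 0) []; first exact/eqP.
  move=> [A B] /= [/set_mem Ax /set_mem B0] [oA oB /eqP AB].
  exists [set 0], K, B, x0; split; split=> //.
  - exact: (subgroup_zspan [::]).
  - exact: open_nbhs_nbhs.
  - by move=> l /= ->; rewrite subr0 => Bx; have : (A `&` B) x0 by []; rewrite AB.
have Hf : Hs f by apply: hF; rewrite inE eqxx.
have sF := subgroup_zspan F.
(* Either [f] returns to [U0] arbitrarily late, its multiples are bounded modulo [zspan F], and [f]
   is absorbed into [K]; or from [N] on its multiples avoid [U0 + zspan F], and the induction
   stops. *)
have [rec|/existsNP[N hN]] := pselect (forall N, exists2 n, (N <= n)%N &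
    exists2 u, U0 u & zspan F (f *+ n - u)).
  have [M hM] := monothetic_bounded sF U0n tbU0 rec.
  pose KM := [set x | x \in [seq f *+ n | n <- iota 0 M]].
  pose K1 := [set x | exists a b, [/\ KM a, U0 b & x = a - b]].
  apply: (IH [set x | exists a b, [/\ K a, K1 b & x = a + b]]).
  - by move=> g gF; apply: hF; rewrite inE gF orbT.
  - by apply: totally_boundedD => //; apply: totally_boundedB => //; exact: totally_bounded_seq.
  move=> x /hK[k Kk /= [m hm]]; have [n nM [u Uu hu]] := hM m.
  exists (k + (f *+ n - u)).
    exists k, (f *+ n - u); split=> //; exists (f *+ n), u; split=> //=.
    by apply: map_f; rewrite mem_iota.
  have -> : x - (k + (f *+ n - u)) = x - k - f *~ m - (f *+ n - f *~ m - u).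
    by rewrite [f *+ n - _ - u]addrAC subrACA subrr subr0 opprD addrA.
  exact: sF.2.
have N0 : (0 < N)%N.
  rewrite lt0n; apply/eqP => N0; apply: hN; exists 0%N; first by rewrite N0.
  by exists 0; [exact: nbhs_singleton|rewrite mulr0n subr0; exact: sF.1].
have [U [Un UN U3]] := nbhs0_chain U0n.
have UU0 u : U u -> U0 u.
  by move=> Uu; rewrite -[u]addr0 -[u]addr0; apply: U3 => //; exact: nbhs_singleton.
(* With step [2 * N], the point [f *+ N] differs from elements of [L] by odd multiples of [f *+ N]
   modulo [zspan F]. These have index at least [N] in absolute value, so [hN] keeps them away from
   [U]. *)
pose L := [set x | exists q : int, zspan F (x - (f *+ (2 * N)) *~ q)].
pose KN := [set x | x \in [seq f *+ n | n <- iota 0 (2 * N)]].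
exists L, [set x | exists a b, [/\ K a, KN b & x = a + b]], U, (f *+ N).
split; split => //.
- exact: (subgroup_zspan (f *+ (2 * N) :: F)).
- by apply: totally_boundedD => //; exact: totally_bounded_seq.
- move=> x /hK[k Kk /= [m hm]].
  have N20 : (0 < 2 * N)%N by rewrite muln_gt0.
  exists (k + f *+ absz (m %% (2 * N)%:Z)%Z).
    exists k, (f *+ absz (m %% (2 * N)%:Z)%Z); split=> //=; apply: map_f.
    rewrite mem_iota /=; rewrite add0n.
    have := @ltz_mod m (2 * N)%:Z; have := @modz_ge0 m (2 * N)%:Z; lia.
  exists (m %/ (2 * N)%:Z)%Z; set A := f *+ _; set B := f *+ _ *~ _.
  have -> : x - (k + A) - B = x - k - (A + B) by rewrite !opprD !addrA.
  have -> // : A + B = f *~ m.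
  rewrite /A /B; have : f *+ absz (m %% (2 * N)%:Z)%Z + f *+ (2 * N) *~ (m %/ (2 * N)%:Z)%Z = f *~ m; last by [].
  rewrite !pmulrn -mulrzA -mulrzDr; congr (_ *~ _).
  rewrite [in RHS](divz_eq m (2 * N)%:Z).
  have := @modz_ge0 m (2 * N)%:Z; lia.
- by rewrite pmulrn; exact: subgroupMz.
move=> l [q hq] Ul; apply: hN.
have hs (c : int) u : U u -> zspan F (f *~ c - u) -> (N <= absz c)%N ->
    exists2 n, (N <= n)%N & exists2 u, U0 u & zspan F (f *+ n - u).
  case: c => n Uu h Nn; first by exists n => //; exists u => //; exact: UU0.
  exists n.+1; first by move: Nn; lia.
  exists (- u); first by apply: UU0; exact: UN.
  have := subgroupN sF h; rewrite NegzE mulrNz opprB opprK.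
  by rewrite addrC -pmulrn opprK.
apply: (hs (N%:Z - (2 * N)%:Z * q) _ Ul); last first.
  have -> : N%:Z - (2 * N)%:Z * q = N%:Z * (1 - 2 * q) by rewrite PoszM; ring.
  rewrite abszM /= leq_pmulr//; lia.
have -> : f *~ (N%:Z - (2 * N)%:Z * q) - (f *+ N - l) = l - f *+ (2 * N) *~ q.
  by rewrite mulrzBr subrACA -(pmulrn f N) subrr sub0r opprB mulrzA -(pmulrn f).
exact: hq.
Qed.

End TopologicalGroups.

(** * Subgroups as types, and characters of compactly generated subgroups *)

Record subgroup_of (G : topologicalZmodType) :=
  SubgroupOf { subgroup_set :> set G; subgroupP : subgroup subgroup_set }.

Definition subgroup_pred (G : topologicalZmodType) (A : subgroup_of G) : {pred G} :=
  fun x => `[< subgroup_set A x >].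

Lemma subgroup_pred_zmod (G : topologicalZmodType) (A : subgroup_of G) :
  zmod_closed (subgroup_pred A).
Proof.
split; first by apply/asboolP; exact: (subgroupP A).1.
by move=> x y /asboolP Ax /asboolP Ay; apply/asboolP; exact: (subgroupP A).2.
Qed.

HB.instance Definition _ (G : topologicalZmodType) (A : subgroup_of G) :=
  GRing.isZmodClosed.Build G (subgroup_pred A) (subgroup_pred_zmod A).

Record subgroup_type (G : topologicalZmodType) (A : subgroup_of G) :=
  SubgroupElt { subgroup_val :> G; _ : subgroup_val \in subgroup_pred A }.

HB.instance Definition _ (G : topologicalZmodType) (A : subgroup_of G) :=
  [isSub for @subgroup_val G A].
HB.instance Definition _ (G : topologicalZmodType) (A : subgroup_of G) :=
  [Choice of subgroup_type A by <:].
HB.instance Definition _ (G : topologicalZmodType) (A : subgroup_of G) :=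
  [SubChoice_isSubZmodule of subgroup_type A by <:].

Section SubgroupCharacter.
Variables (R : realType) (G : topologicalZmodType) (Hs : set G).
Hypothesis sH : subgroup Hs.
Local Notation C := R[i].

(** [W n] consists of the elements of the subgroup lying in [V n + L], so this chain describes the
    quotient by [L], precompact because of [K], without forming it. *)
Lemma subgroup_character (L K U : set G) (x0 : G) : subgroup L -> totally_bounded K ->
  (forall y, Hs y -> exists2 k, K k & L (y - k)) -> nbhs 0 U -> Hs x0 ->
  (forall l, L l -> ~ U (x0 - l)) ->
  exists chi : G -> C, [/\ forall x y, Hs x -> Hs y -> chi (x + y) = chi x * chi y,
    forall x, Hs x -> cabs (chi x) = 1,
    forall e : R, 0 < e -> exists2 U', nbhs 0 U' & forall x, Hs x -> U' x -> cabs (chi x - 1) <= e &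
    exists2 x, Hs x & chi x <> 1].
Proof.
move=> sL tbK hK Un Hx0 hx0.
have /choice[nx hnx] : forall A : set G, exists B, nbhs 0 A -> [/\ nbhs 0 B,
    forall x, B x -> B (- x) & forall x y z, B x -> B y -> B z -> A (x + y + z)].
  move=> A; have [/nbhs0_chain[A' hA']|nA] := pselect (nbhs 0 A); first by exists A'.
  by exists A.
pose V n := iter n.+1 nx U.
have V0 n : nbhs 0 (V n).
  by elim: n => [|n IH]; rewrite /V iterS; [case: (hnx _ Un)|case: (hnx _ IH)].
pose H := subgroup_type (SubgroupOf sH).
have valH (h : H) : Hs (val h) by have /asboolP := valP h.
have Vn n : [/\ forall x, V n x -> V n (- x) &
    forall x y z, V n.+1 x -> V n.+1 y -> V n.+1 z -> V n (x + y + z)].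
  split; last by have [] := hnx _ (V0 n).
  by case: n => [|n]; [have [] := hnx _ Un|have [] := hnx _ (V0 n)].
pose W n := [set h : H | exists2 l, L l & V n (val h - l)].
have chainW : precompact_chain W.
  split.
  - by move=> n; exists 0; [exact: sL.1|rewrite raddf0 subr0; exact: nbhs_singleton].
  - move=> n x [l Ll Vl]; exists (- l); first exact: subgroupN.
    by rewrite raddfN -opprD; exact: (Vn n).1.
  - move=> n x y z [lx Lx Vx] [ly Ly Vy] [lz Lz Vz]; exists (lx + ly + lz).
      by do 2?[apply: subgroupD => //].
    have -> : val (x + y + z) - (lx + ly + lz) = val x - lx + (val y - ly) + (val z - lz).
      by rewrite !opprD addrACA [_ + (_ - ly)]addrACA.
    exact: (Vn n).2.
  - move=> n; have [V' V'0 hV'] := nbhs0_sub (V0 n); have [s hs] := tbK _ V'0.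
    (* A point [t] of the net need not belong to [Hs]; it is replaced by an element of the subgroup
       close to it modulo [L] whenever there is one. *)
    have /choice[f hf] t : exists f : H, forall h : H,
        (exists2 l, L l & V' (val h - l - t)) -> exists2 l, L l & V' (val f - l - t).
      have [[h hh]|nh] := pselect (exists h : H, exists2 l, L l & V' (val h - l - t)); first by exists h.
      by exists 0 => h hh; exfalso; apply: nh; exists h.
    exists [seq f t | t <- s] => h; have [k Kk Lk] := hK _ (valH h).
    have [t ts Vt] := hs k Kk; exists (f t); first exact: map_f.
    have hh : exists2 l, L l & V' (val h - l - t) by exists (val h - k); rewrite // subKr.
    have [l Ll Vl] := hf t h hh; case: hh => l' Ll' Vl'.
    exists (l' - l); first exact: sL.2.
    rewrite raddfB; have -> : val h - val (f t) - (l' - l) = val h - l' - t - (val (f t) - l - t).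
      by rewrite [RHS]subrACA subrr subr0 subrACA.
    exact: hV'.
have Hx0' : x0 \in subgroup_pred (SubgroupOf sH) by apply/asboolP.
have Wx0 : ~ W 0%N (SubgroupElt Hx0').
  move=> [l Ll /= Vl]; apply: hx0 Ll _; rewrite -[x0 - l]addr0 -[x0 - l]addr0.
  have [V1 _ h] := hnx _ Un; apply: h => //; exact: nbhs_singleton.
have [chi [cM c1 cC [h ch]]] := precompact_character R chainW Wx0.
have subE x (Hx : Hs x) : val (insubd (0 : H) x) = x.
  by rewrite insubdK//; apply/asboolP.
exists (fun x => chi (insubd (0 : H) x)); split.
- move=> x y Hx Hy; rewrite -cM; congr chi; apply: val_inj.
  by rewrite raddfD /= !subE//; exact: subgroupD.
- by move=> x Hx; exact: c1.
- move=> e /cC[n hn]; exists (V n); first exact: V0.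
  move=> x Hx Vx; apply: hn; exists 0; first exact: sL.1.
  by rewrite subr0 subE.
- by exists (val h); [exact: valH|rewrite valKd].
Qed.

(* A compactly generated group is, up to a finitely generated subgroup, totally bounded. *)
Lemma open_subgroup_character (K : set G) : hausdorff_space G -> nbhs 0 K ->
  totally_bounded K -> (forall x, K x -> K (- x)) -> (exists2 x, K x & x <> 0) ->
  Hs = (fun x => forall A, subgroup A -> K `<=` A -> A x) ->
  exists chi : G -> C, [/\ forall x y, Hs x -> Hs y -> chi (x + y) = chi x * chi y,
    forall x, Hs x -> cabs (chi x) = 1,
    forall e : R, 0 < e -> exists2 U', nbhs 0 U' & forall x, Hs x -> U' x -> cabs (chi x - 1) <= e &
    exists2 x, Hs x & chi x <> 1].
Proof.
move=> hG K0 tbK KN [x Kx xn0] HsE.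
have KH : K `<=` Hs by move=> y Ky; rewrite HsE => A _; exact.
have [s hs] := totally_boundedD tbK tbK K0.
pose F := [seq t <- s | `[< Hs t >]].
have FH f : f \in F -> Hs f by rewrite mem_filter => /andP[/asboolP].
have hF y : Hs y -> exists2 k, K k & zspan F (y - k).
  (* [K + zspan F] is a subgroup: [k - k'] is within [K] of a net point [t] of [K + K], and this [t]
     then lies in [Hs], hence in [F]. *)
  rewrite HsE => /(_ [set a | exists2 k, K k & zspan F (a - k)]); apply.
    split; first by exists 0; [exact: nbhs_singleton|rewrite subr0; exact: (subgroup_zspan F).1].
    move=> a b [k Kk Fk] [k' Kk' Fk'].
    have [|t ts Kt] := hs (k - k'); first by exists k, (- k'); split=> //; exact: KN.
    exists (k - k' - t) => //.
    have -> : a - b - (k - k' - t) = (a - k) - (b - k') + t by rewrite opprB addrCA addrC subrACA.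
    apply: (subgroupD (subgroup_zspan F)); first exact: (subgroup_zspan F).2.
    apply: mem_zspan; rewrite mem_filter ts andbT; apply/asboolP.
    rewrite -[t](subKr (k - k')); by apply: sH.2; [apply: sH.2|]; exact: KH.
  by move=> a Ka; exists a; rewrite // subrr; exact: (subgroup_zspan F).1.
have [|L [K' [U [x0 [[sL tbK' hK'] [Un Hx0 hx0]]]]]] :=
  exists_cobounded_subgroup hG sH _ K0 tbK FH tbK hF; first by exists x => //; exact: KH.
exact: subgroup_character hK' Un Hx0 hx0.
Qed.

End SubgroupCharacter.

(** * Extension of circle-valued homomorphisms *)

Section CharacterExtension.
Variables (R : realType) (G : topologicalZmodType).
Local Notation C := R[i].

Lemma unimodular_neq0 (a : C) : cabs a = 1 -> a != 0.
Proof. by move=> a1; apply: contra_eq_neq a1 => ->; rewrite cabs0 eq_sym oner_neq0. Qed.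

Lemma cabsV (a : C) : cabs a = 1 -> cabs a^-1 = 1.
Proof.
move=> a1; have := congr1 (@cabs R) (mulfV (unimodular_neq0 a1)).
by rewrite cabsM a1 mul1r cabs1.
Qed.

Lemma cabsXz (a : C) (m : int) : cabs a = 1 -> cabs (a ^ m) = 1.
Proof.
move=> a1; case: m => n; first by rewrite -exprnP cabsX a1 expr1n.
by rewrite NegzE -exprnN cabsV// cabsX a1 expr1n.
Qed.

Lemma unimodular_root (a : C) n : cabs a = 1 -> (0 < n)%N -> exists2 b, cabs b = 1 & b ^+ n = a.
Proof.
move=> a1 n0; exists (n.-root a); last exact: rootCK.
have := congr1 (@cabs R) (rootCK n0 a); rewrite cabsX a1 => /eqP.
by rewrite pexpr_eq1 ?cabs_ge0// => /eqP.
Qed.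

(* The graph of a homomorphism from a subgroup of [G] to the unit circle. *)
Definition circle_hom (g : set (G * C)) :=
  [/\ g (0, 1), forall x y a b, g (x, a) -> g (y, b) -> g (x - y, a * b^-1),
      forall x a, g (x, a) -> cabs a = 1 & forall a, g (0, a) -> a = 1].

Section CircleHom.
Variable g : set (G * C).
Hypothesis hg : circle_hom g.

Lemma circle_homN x a : g (x, a) -> g (- x, a^-1).
Proof.
by case: hg => g0 gB _ _ ga; rewrite -sub0r -[a^-1]mul1r; exact: gB.
Qed.

Lemma circle_homD x y a b : g (x, a) -> g (y, b) -> g (x + y, a * b).
Proof.
by case: hg => g0 gB _ _ ga /circle_homN gb; rewrite -[y]opprK -[b]invrK; exact: gB.
Qed.

Lemma circle_homMz x a (m : int) : g (x, a) -> g (x *~ m, a ^ m).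
Proof.
move=> ga; have gn n : g (x *+ n, a ^+ n).
  elim: n => [|n IH]; first by rewrite mulr0n expr0; case: hg.
  by rewrite mulrS exprS; exact: circle_homD.
case: m => n; first by rewrite -pmulrn -exprnP.
by rewrite NegzE mulrNz -exprnN -pmulrn; exact: circle_homN.
Qed.

Lemma circle_hom_fun x a b : g (x, a) -> g (x, b) -> a = b.
Proof.
case: hg => g0 gB g1 gu ga gb; have := gB _ _ _ _ ga gb; rewrite subrr => /gu.
by move=> /(congr1 ( *%R^~ b)); rewrite mulfVK ?mul1r// (unimodular_neq0 (g1 _ _ gb)).
Qed.

(** [b] is the value to be given to [x]. If some positive multiple of [x] is in the domain, the
    least one, [n], divides all others, and an [n]-th root of its value works; otherwise any
    unimodular [b] does. *)
Lemma circle_hom_power x : exists2 b, cabs b = 1 & forall (m : int) c, g (x *~ m, c) -> c = b ^ m.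
Proof.
case: (hg) => g0 gB g1 gu.
pose P n := `[< (0 < n)%N /\ exists a, g (x *+ n, a) >].
have [exP|nP] := pselect (exists n, P n); last first.
  exists 1 => [|m c gc]; first exact: cabs1.
  have m0 : m = 0.
    apply: contrapT => m0; apply: nP; exists (absz m); apply/asboolP; split; first by lia.
    case: m gc m0 => n gc m0; first by exists c.
    by exists c^-1; have := circle_homN gc; rewrite NegzE mulrNz opprK -pmulrn.
  by rewrite m0 expr0z; apply: gu; rewrite -(mulr0z x) -m0.
case: (ex_minnP exP) => n /asboolP[n0 [a ga]] minn.
have [b b1 ba] := unimodular_root (g1 _ _ ga) n0; exists b => // m c gc.
pose q := (m %/ n)%Z; pose r := absz (m %% n)%Z.
have mE : m = q * n + r by rewrite [LHS](divz_eq m n) /r gez0_abs// modz_ge0//; lia.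
have gr : g (x *+ r, c * (a ^ q)^-1).
  have -> : x *+ r = x *~ m - x *+ n *~ q.
    by rewrite mE mulrzDr mulrC mulrzA -!pmulrn addrC addKr.
  by apply: gB => //; exact: circle_homMz.
have r0 : r = 0%N.
  apply/eqP; rewrite -leqn0 leqNgt; apply/negP => r0.
  have : (n <= r)%N by apply: minn; apply/asboolP; split=> //; eexists; exact: gr.
  have := @ltz_pmod m n; rewrite /r; lia.
move: gr; rewrite r0 mulr0n => /gu/(congr1 ( *%R^~ (a ^ q))).
rewrite mulfVK ?mul1r; last exact/unimodular_neq0/cabsXz/g1/ga.
by move=> ->; rewrite mE r0 addr0 -ba exprnP exprz_exp mulrC.
Qed.

Lemma circle_hom_adjoin x : exists g', [/\ circle_hom g', g `<=` g' & exists a, g' (x, a)].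
Proof.
case: (hg) => g0 gB g1 gu; have [b b1 hb] := circle_hom_power x.
have bn0 := unimodular_neq0 b1.
exists [set z | exists y c (m : int), g (y, c) /\ z = (y + x *~ m, c * b ^ m)]; split.
- split.
  + by exists 0, 1, 0; rewrite mulr0z addr0 expr0z mulr1.
  + move=> _ _ _ _ [y [c [m [gc [-> ->]]]]] [y' [c' [m' [gc' [-> ->]]]]].
    exists (y - y'), (c * c'^-1), (m - m'); split; first exact: gB.
    congr (_, _); first by rewrite mulrzBr opprD addrACA.
    by rewrite invfM mulrACA expfzDr// invr_expz.
  + move=> z d [y [c [m [gc [_ ->]]]]]; rewrite cabsM (g1 _ _ gc) mul1r; exact: cabsXz.
  + move=> _ [y [c [m [gc [/esym/eqP y0 ->]]]]].
    move: y0; rewrite addr_eq0 => /eqP y0; have := hb (- m) c; rewrite mulrNz -y0 => /(_ gc) ->.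
    by rewrite -expfzDr// addNr expr0z.
- by move=> [y c] gc; exists y, c, 0; rewrite mulr0z addr0 expr0z mulr1.
- by exists (b ^ (1 : int)), 0, 1, 1; rewrite mulr1z add0r mul1r.
Qed.

End CircleHom.

Lemma circle_hom_extend (g : set (G * C)) : circle_hom g -> exists chi : G -> C,
  [/\ forall x y, chi (x + y) = chi x * chi y, forall x, cabs (chi x) = 1 &
      forall x a, g (x, a) -> chi x = a].
Proof.
move=> hg; pose T := {h : set (G * C) | circle_hom h /\ g `<=` h}.
pose le (h k : T) : bool := `[< sval h `<=` sval k >].
have [||||h hmax] := @Zorn T le.
- by move=> t; exact/asboolP.
- by move=> r s t /asboolP rs /asboolP st; apply/asboolP; exact: subset_trans rs st.
- by move=> [s ps] [t pt] /asboolP/= st /asboolP/= ts; apply: eq_exist; apply/seteqP.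
- move=> A totA; have [[t0 At0]|nA] := pselect (A !=set0); last first.
    by exists (exist _ g (conj hg (@subset_refl _ g))) => s As; exfalso; apply: nA; exists s.
  pose U := [set z | exists2 t : T, A t & sval t z].
  have common (t t' : T) : A t -> A t' -> exists k : T, [/\ A k, sval t `<=` sval k & sval t' `<=` sval k].
    by move=> At At'; have [/asboolP h|/asboolP h] := totA _ _ At At'; [exists t'|exists t]; split=> //;
       exact: subset_refl.
  have hU : circle_hom U.
    split.
    + by exists t0 => //; case: (svalP t0) => -[].
    + move=> x y a b [t At ta] [t' At' tb]; have [k [Ak tk t'k]] := common _ _ At At'.
      by exists k => //; case: (svalP k) => -[_ kB _ _] _; apply: kB; [exact: tk|exact: t'k].
    + by move=> x a [t At ta]; case: (svalP t) => -[_ _ t1 _] _; exact: t1 ta.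
    + by move=> a [t At ta]; case: (svalP t) => -[_ _ _ tu] _; exact: tu.
  have gU : g `<=` U by move=> z gz; exists t0 => //; case: (svalP t0) => _; exact.
  by exists (exist _ U (conj hU gU)) => s As; apply/asboolP => z sz; exists s.
have [hh gh] := svalP h.
have /choice[chi hchi] x : exists a, sval h (x, a).
  have [h' [hh' hsub [a ha]]] := circle_hom_adjoin hh x; exists a.
  pose t : T := exist _ h' (conj hh' (subset_trans gh hsub)).
  by rewrite -(hmax t)//; exact/asboolP.
exists chi; split=> [x y|x|x a gxa].
- exact: circle_hom_fun hh _ _ _ (hchi _) (circle_homD hh (hchi x) (hchi y)).
- by case: hh => _ _ h1 _; exact: h1 (hchi x).
- exact: circle_hom_fun hh _ _ _ (hchi x) (gh _ gxa).
Qed.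

End CharacterExtension.

(** * The dual of a non-discrete group is not compact *)

Section UnitCircle.
Variable R : realType.
Local Notation C := R[i].

(* [1 - Re (z ^+ 2) = 2 (1 - Re z) (1 + Re z)], so [1 - Re z] at least doubles at each squaring. *)
Lemma Re_powers_ge0 (z : C) : cabs z = 1 -> (forall n, 0 <= complex.Re (z ^+ n)) -> z = 1.
Proof.
move=> z1 hz; pose c n := complex.Re (z ^+ (2 ^ n)).
have cS n : c n.+1 = 2 * c n ^+ 2 - 1.
  rewrite /c expnSr exprM expr2; set w := z ^+ _.
  have := sqr_cabs w; rewrite cabsX z1 expr1n expr1n ReM; lra.
have c1 n : 0 <= c n <= 1.
  rewrite hz /=; apply: le_trans (ler_norm _) _; apply: le_trans (cabs_Re _) _.
  by rewrite cabsX z1 expr1n.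
have grow n : n%:R * (1 - c 0%N) <= 1 - c n.
  elim: n => [|n IH]; first by rewrite mul0r; have := c1 0%N; lra.
  rewrite cS -natr1 mulrDl mul1r.
  have [->|n0] := eqVneq n 0%N; first by rewrite mul0r; have := c1 0%N; nra.
  have n1 : 1 <= n%:R :> R by rewrite ler1n lt0n.
  have := c1 n; have := c1 0%N; nra.
have c0 : c 0%N = 1.
  apply/eqP; rewrite eq_le; have /andP[_ ->] := c1 0%N; rewrite /= leNgt; apply/negP => h.
  have d0 : 0 < 1 - c 0%N by lra.
  have := grow (Num.truncn (1 - c 0%N)^-1).+1; have := truncnS_gt (1 - c 0%N)^-1.
  set m := _.+1%:R; rewrite -(ltr_pM2r d0) mulVf ?gt_eqF//; have := c1 (Num.truncn (1 - c 0%N)^-1).+1; lra.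
move: c0; rewrite /c expn0 expr1 => c0; apply: complexP => //=.
have := sqr_cabs z; rewrite z1 c0 expr1n => h.
by apply/eqP; rewrite -sqrf_eq0; apply/eqP; lra.
Qed.

End UnitCircle.

Section DualNoncompact.
Variables (R : realType) (G Γ : topologicalZmodType) (pair : G -> Γ -> R[i]).
Local Notation C := R[i].
Hypothesis dualP : dual_pairing pair.

Lemma pairD x y γ : pair (x + y) γ = pair x γ * pair y γ.
Proof. by have [h _ _ _ _] := dualP; have [/(_ x y)] := h γ. Qed.

Lemma pairDr x γ δ : pair x (γ + δ) = pair x γ * pair x δ.
Proof. by have [_ h _ _ _] := dualP. Qed.

Lemma cabs_pair x γ : cabs (pair x γ) = 1.
Proof. by have [h _ _ _ _] := dualP; have [_ /(_ x)] := h γ. Qed.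

Lemma pair_neq0 x γ : pair x γ != 0.
Proof. exact/unimodular_neq0/cabs_pair. Qed.

Lemma pair0 γ : pair 0 γ = 1.
Proof. by apply: (mulfI (pair_neq0 0 γ)); rewrite -pairD addr0 mulr1. Qed.

Lemma pair0r x : pair x 0 = 1.
Proof. by apply: (mulfI (pair_neq0 x 0)); rewrite -pairDr addr0 mulr1. Qed.

Lemma pairMnr x γ n : pair x (γ *+ n) = pair x γ ^+ n.
Proof. by elim: n => [|n IH]; rewrite ?pair0r ?expr0// mulrS exprS pairDr IH. Qed.

Lemma pairMn x γ n : pair (x *+ n) γ = pair x γ ^+ n.
Proof. by elim: n => [|n IH]; rewrite ?pair0 ?expr0// mulrS exprS pairD IH. Qed.

Lemma pairB x y γ : pair (x - y) γ = pair x γ / pair y γ.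
Proof. by apply: (mulIf (pair_neq0 y γ)); rewrite -pairD subrK mulfVK// pair_neq0. Qed.

Lemma pairBr x γ δ : pair x (γ - δ) = pair x γ / pair x δ.
Proof. by apply: (mulIf (pair_neq0 x δ)); rewrite -pairDr subrK mulfVK// pair_neq0. Qed.

Lemma dual_noncompact : LCA G -> non_discrete G -> ~ compact [set: Γ].
Proof.
have [hchar _ hsurj _ htop] := dualP.
move=> [hG lcG] nd cΓ.
have [K0 K0n' [cK0 _]] := lcG 0 I.
have K0n : nbhs 0 K0 by move: K0n'; rewrite /within /=; apply: filterS => x; exact.
pose U γ : set Γ := [set δ | forall x, K0 x -> cabs (pair x δ - pair x γ) < 2^-1].
have [s _ hs] : exists2 s : seq Γ, (forall γ, γ \in s -> [set: Γ] γ) &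
    forall γ, [set: Γ] γ -> exists2 t, t \in s & U t γ.
  apply: compact_finite_cover => // γ _; apply/htop; exists K0, 2^-1; split=> //.
pose N := [set x | K0 x /\ forall γ, γ \in s -> cabs (pair x γ - 1) < 2^-1].
have Nn : nbhs 0 N.
  apply: filterI => //; apply: filter_all_seq => γ; have [_ _ hc] := hchar γ.
  by have := hc 0 2^-1; rewrite pair0 invr_gt0 ltr0n => /(_ isT).
have Nker x γ : N x -> pair x γ = 1.
  (* The tolerances 1/2 of the net and of [N] add up to less than 1. The bound holds for every
     multiple of [γ], so all powers of [pair x γ] have nonnegative real part. *)
  move=> [Kx hx]; have near1 δ : cabs (pair x δ - 1) < 1.
    have [t ts /(_ _ Kx) h] := hs δ I; have := hx t ts.
    have := cabs_sub_trans (pair x t) (pair x δ) 1; lra.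
  apply: Re_powers_ge0; first exact: cabs_pair.
  move=> n; rewrite -pairMnr; have := near1 (γ *+ n); have := cabs_Re (pair x (γ *+ n) - 1).
  by rewrite ler_norml ReD ReN /= => /andP[]; lra.
pose K := [set x | N x /\ N (- x)].
have Kn : nbhs 0 K.
  by apply: filterI => //; have := @opp_continuous G 0; rewrite /continuous_at oppr0 => /(_ _ Nn).
have KN x : K x -> K (- x) by move=> [h h']; split; rewrite ?opprK.
have tbK : totally_bounded K.
  by apply: totally_boundedS (compact_totally_bounded cK0) => x [[]].
have Kx : exists2 x, K x & x <> 0.
  apply: contrapT => h; apply: nd => x; rewrite openE => y /= ->.
  apply: filterS (nbhs0_shift x Kn) => z /= Kz; apply/eqP; rewrite -subr_eq0.
  by apply/eqP; apply: contrapT => zx; apply: h; exists (z - x).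
pose Hs : set G := fun x => forall A, subgroup A -> K `<=` A -> A x.
have sH : subgroup Hs.
  split; first by move=> A [].
  by move=> x y hx hy A sA KA; apply: (sA.2); [exact: hx|exact: hy].
have KH : K `<=` Hs by move=> x Kx' A _; exact.
have [chi [cM c1 cC [x Hx cx]]] := open_subgroup_character R sH hG Kn tbK KN Kx (erefl _).
pose g : set (G * C) := [set z | Hs z.1 /\ z.2 = chi z.1].
have chi0 : chi 0 = 1.
  have H0 := sH.1; apply: (mulfI (unimodular_neq0 (c1 _ H0))).
  by rewrite -cM// addr0 mulr1.
have hg : circle_hom g.
  split.
  - by split; [exact: sH.1|rewrite /= chi0].
  - move=> y z a b [/= Hy ->] [/= Hz ->]; split; first exact: sH.2.
    have Hyz := sH.2 _ _ Hy Hz; apply: (mulIf (unimodular_neq0 (c1 _ Hz))).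
    by rewrite mulfVK ?unimodular_neq0 ?c1//= -cM// subrK.
  - by move=> y a [/= Hy ->]; exact: c1.
  - by move=> a [/= _ ->].
have [ext [eM e1 eE]] := circle_hom_extend hg.
have ext0 : ext 0 = 1.
  by apply: (mulfI (unimodular_neq0 (e1 0))); rewrite -eM addr0 mulr1.
have hext : is_character ext.
  split=> // t e e0; have e20 : 0 < e / 2 by lra.
  have [U' U'n hU'] := cC _ e20.
  apply: filterS (nbhs0_shift t (filterI U'n Kn)) => y [U'y Ky].
  have -> : ext y - ext t = (ext (y - t) - 1) * ext t by rewrite mulrBl mul1r -eM subrK.
  rewrite cabsM e1 mulr1 (eE (y - t) (chi (y - t))); last by split=> //; exact: KH.
  by apply: le_lt_trans (hU' _ (KH _ Ky) U'y) _; lra.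
have [γ hγ] := hsurj _ hext.
(* [ext] is a character of [G], so it is 1 on [K] and on the subgroup [Hs] generated by [K]; yet it
   extends [chi], which is not 1 at [x]. *)
apply: cx; rewrite -(eE x (chi x)) ?hγ; last by [].
apply: (Hx [set y | pair y γ = 1]).
  by split=> [|y z /= hy hz]; rewrite /= ?pair0// pairB hy hz divr1.
by move=> y [Ny _]; exact: Nker.
Qed.

End DualNoncompact.

(** * The local BSE norms *)

Section BseLe.
Variables (R : realType) (G Γ : topologicalZmodType) (pair : G -> Γ -> R[i]) (V : set Γ).
Local Notation C := R[i].
Hypothesis dualP : dual_pairing pair.
Hypothesis V0 : V 0.
Implicit Types (phi psi : Γ -> C) (γ δ : Γ) (s : seq Γ) (c : Γ -> C) (B : R).
Local Notation Vs := (Vbar_shift V).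
Local Notation eval := (trig_eval pair).

(** The bound [bse_loc phi γ <= B] with the extended supremum unfolded ([bse_locP]). Estimates are
    made in this form, one [γ] at a time, so that they can exploit locality ([bse_le_local]). *)
Definition bse_le phi γ B := forall s c, trig_poly_in (Vs γ) s ->
  (forall x, cabs (eval s c x) <= 1) -> cabs (\sum_(g <- s) c g * phi g) <= B.

Lemma Vs_refl γ : Vs γ γ.
Proof. by exists 0; [exact: subset_closure|rewrite add0r]. Qed.

Lemma VsP γ δ : Vs γ δ <-> closure V (δ - γ).
Proof.
by split=> [[v Vv <-]|h]; [rewrite addrK|exists (δ - γ); rewrite // subrK].
Qed.

Lemma bse_locP phi γ B : (bse_loc pair V phi γ <= B%:E)%E <-> bse_le phi γ B.
Proof.
split=> [h s c ps h1|h].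
  by rewrite -lee_fin; apply: le_trans h; apply: ereal_sup_ubound; exists s, c.
by apply: ge_ereal_sup => _ [s [c [ps h1 ->]]]; rewrite lee_fin; exact: h.
Qed.

Lemma bse_loc_ge0 phi γ : (0 <= bse_loc pair V phi γ)%E.
Proof.
apply: ereal_sup_ubound; exists [::], (fun=> 0); split=> //.
  by move=> x; rewrite /trig_eval big_nil cabs0 ler01.
by rewrite big_nil cabs0.
Qed.

Lemma bse_loc_fine phi γ : (bse_loc pair V phi γ < +oo)%E ->
  bse_le phi γ (fine (bse_loc pair V phi γ)).
Proof.
move=> h; apply/bse_locP; rewrite fineK// ge0_fin_numE//; exact: bse_loc_ge0.
Qed.

Lemma bse_normP phi B : (bse_norm pair V phi <= B%:E)%E <-> forall γ, bse_le phi γ B.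
Proof.
split=> [h γ|h].
  by apply/bse_locP; apply: le_trans h; apply: ereal_sup_ubound; exists γ.
by apply: ge_ereal_sup => _ [γ _ <-]; exact/bse_locP.
Qed.

Lemma bse_norm_ge0 phi : (0 <= bse_norm pair V phi)%E.
Proof.
apply: le_trans (bse_loc_ge0 phi 0) _; apply: ereal_sup_ubound; by exists 0.
Qed.

Lemma bse_norm_fine phi : (bse_norm pair V phi < +oo)%E ->
  forall γ, bse_le phi γ (fine (bse_norm pair V phi)).
Proof.
move=> h; apply/bse_normP; rewrite fineK// ge0_fin_numE//; exact: bse_norm_ge0.
Qed.

Lemma bse_norm_lty phi B : (forall γ, bse_le phi γ B) -> (bse_norm pair V phi < +oo)%E.
Proof. by move=> /bse_normP h; exact: le_lt_trans h (ltry B). Qed.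

Lemma bse_le_ge0 phi γ B : bse_le phi γ B -> 0 <= B.
Proof.
move=> h; have := h [::] (fun=> 0); rewrite big_nil cabs0; apply=> // x.
by rewrite /trig_eval big_nil cabs0 ler01.
Qed.

Lemma bse_leW phi γ B B' : B <= B' -> bse_le phi γ B -> bse_le phi γ B'.
Proof. by move=> BB' h s c ps h1; apply: le_trans BB'; exact: h. Qed.

Lemma bse_le_scaled phi γ B s c (M : R) : bse_le phi γ B -> trig_poly_in (Vs γ) s -> 0 <= M ->
  (forall x, cabs (eval s c x) <= M) -> cabs (\sum_(g <- s) c g * phi g) <= B * M.
Proof.
move=> h ps M0 hM; have B0 := bse_le_ge0 h.
(* [M] may be 0, so the rescaling divides by a slightly larger [M']. *)
suff gt M' : 0 < M' -> M <= M' -> cabs (\sum_(g <- s) c g * phi g) <= B * M'.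
  apply/ler_addgt0Pr => e e0.
  have d0 : 0 < e / (B + 1) by rewrite divr_gt0//; lra.
  have := gt (M + e / (B + 1)); rewrite lerDl ltr_wpDl// (ltW d0) => /(_ isT isT) h'.
  apply: le_trans h' _; rewrite mulrDr lerD2l; exact: ler_mul_div1.
move=> M'0 MM'; have Mn0 : M' != 0 by rewrite gt_eqF.
have E (F : Γ -> C) : \sum_(g <- s) M'^-1%:C%C * c g * F g = M'^-1%:C%C * \sum_(g <- s) c g * F g.
  by rewrite mulr_sumr; apply: eq_bigr => g _; rewrite mulrA.
have i0 : 0 <= M'^-1 by rewrite invr_ge0 ltW.
have h2 x : cabs (eval s (fun g => M'^-1%:C%C * c g) x) <= 1.
  rewrite /trig_eval E cabsM cabs_real ger0_norm// ler_pdivrMl// mulr1.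
  exact: le_trans (hM x) MM'.
have := h s _ ps h2.
by rewrite E cabsM cabs_real ger0_norm// ler_pdivrMl// mulrC.
Qed.

Lemma bse_le_pt phi γ B : bse_le phi γ B -> cabs (phi γ) <= B.
Proof.
move=> /(_ [:: γ] (fun=> 1)); rewrite big_seq1 mul1r; apply.
  by split=> // g; rewrite inE => /eqP ->; exact: Vs_refl.
by move=> x; rewrite /trig_eval big_seq1 mul1r (cabs_pair dualP).
Qed.

Lemma bse_le_local phi psi γ B : (forall g, Vs γ g -> phi g = psi g) ->
  bse_le phi γ B -> bse_le psi γ B.
Proof.
move=> e h s c [us ps] h1; have := h s c (conj us ps) h1; congr (cabs _ <= _).
by rewrite !big_seq; apply: eq_bigr => g gs; rewrite e//; exact: ps.
Qed.

Lemma bse_le0 phi γ B : 0 <= B -> (forall g, Vs γ g -> phi g = 0) -> bse_le phi γ B.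
Proof.
move=> B0 h; apply: (@bse_le_local (fun=> 0)) => [g Vg|s c _ _]; first by rewrite h.
by rewrite big1 ?cabs0// => g _; rewrite mulr0.
Qed.

Lemma bse_leD phi psi γ B B' : bse_le phi γ B -> bse_le psi γ B' ->
  bse_le (fun g => phi g + psi g) γ (B + B').
Proof.
move=> h h' s c ps h1; under eq_bigr do rewrite mulrDr.
by rewrite big_split; apply: le_trans (cabsD _ _) _; rewrite lerD// ?h ?h'.
Qed.

Lemma bse_leZ (a : C) phi γ B : bse_le phi γ B -> bse_le (fun g => a * phi g) γ (cabs a * B).
Proof.
move=> h s c ps h1; under eq_bigr do rewrite mulrCA.
by rewrite -mulr_sumr cabsM ler_wpM2l ?cabs_ge0// h.
Qed.

Lemma bse_leN phi γ B : bse_le phi γ B -> bse_le (fun g => - phi g) γ B.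
Proof.
move=> /(bse_leZ (-1)); rewrite cabsN cabs1 mul1r; apply: bse_le_local => g _.
by rewrite mulN1r.
Qed.

Lemma bse_leB phi psi γ B B' : bse_le phi γ B -> bse_le psi γ B' ->
  bse_le (fun g => phi g - psi g) γ (B + B').
Proof. by move=> h /bse_leN h'; exact: bse_leD. Qed.

(* Translating [p] by [x] shows that [q] with coefficients [c g * phi g] has sup norm at most
   [B]. *)
Lemma bse_leM phi psi γ B B' : bse_le phi γ B -> bse_le psi γ B' ->
  bse_le (fun g => phi g * psi g) γ (B * B').
Proof.
move=> h h' s c ps h1; under eq_bigr do rewrite mulrA.
rewrite mulrC; apply: (bse_le_scaled h') => //; first exact: bse_le_ge0 h.
move=> x; rewrite /trig_eval; under eq_bigr do rewrite mulrAC.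
apply: h => // y; rewrite /trig_eval; under eq_bigr do rewrite -mulrA -(pairD dualP).
exact: h1.
Qed.

Lemma bse_le1 γ : bse_le (fun=> 1) γ 1.
Proof.
move=> s c ps /(_ 0); rewrite /trig_eval.
by under eq_bigr do rewrite (pair0 dualP).
Qed.

Lemma bse_le_pair x γ : bse_le (pair x) γ 1.
Proof. by move=> s c ps /(_ x). Qed.

(** Shifting the frequencies by [δ] multiplies the trigonometric polynomial by a unimodular
    function. *)
Lemma bse_le_translate phi γ δ B : bse_le phi (γ - δ) B -> bse_le (fun g => phi (g - δ)) γ B.
Proof.
move=> h s c [us ps] h1.
have := h [seq g - δ | g <- s] (fun g => c (g + δ)).
rewrite big_map; under eq_bigr do rewrite subrK.
apply.
  split; first by rewrite map_inj_uniq// => a b /addIr.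
  move=> g /mapP[g' gs ->]; have /VsP h' := ps g' gs; apply/VsP.
  by rewrite opprB addrA subrK.
move=> x; rewrite /trig_eval big_map; under eq_bigr do rewrite subrK (pairBr dualP) mulrA.
rewrite -mulr_suml cabsM cabsV ?(cabs_pair dualP)// mulr1; exact: h1.
Qed.

(** A test polynomial involves finitely many frequencies, so pointwise convergence suffices. *)
Lemma bse_le_lim (phi_ : nat -> Γ -> C) phi γ B :
  (forall g e, 0 < e -> \forall n \near \oo, cabs (phi_ n g - phi g) <= e) ->
  (\forall n \near \oo, bse_le (phi_ n) γ B) -> bse_le phi γ B.
Proof.
move=> lim h s c ps h1; apply/ler_addgt0Pr => e e0.
pose M := \sum_(g <- s) cabs (c g); have M0 : 0 <= M by apply: sumr_ge0 => g _; exact: cabs_ge0.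
have d0 : 0 < e / (M + 1) by rewrite divr_gt0//; lra.
have near_s : \forall n \near \oo, forall g, g \in s -> cabs (phi_ n g - phi g) <= e / (M + 1).
  by apply: filter_all_seq => g; exact: lim.
have [n [hn1 hn2]] := filter_ex (filterI near_s h).
have -> : \sum_(g <- s) c g * phi g = \sum_(g <- s) c g * phi_ n g -
    \sum_(g <- s) c g * (phi_ n g - phi g).
  by rewrite -sumrB; apply: eq_bigr => g _; rewrite -mulrBr subKr.
apply: le_trans (cabsD _ _) _; rewrite cabsN lerD//; first exact: hn2.
apply: le_trans (cabs_sum _ _ _) _; apply: (@le_trans _ _ (\sum_(g <- s) cabs (c g) * (e / (M + 1)))).
  rewrite !big_seq; apply: ler_sum => g gs; rewrite cabsM ler_wpM2l ?cabs_ge0//; exact: hn1.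
rewrite -mulr_suml -/M; exact: ler_mul_div1.
Qed.

End BseLe.

(** * Bump functions *)

Section SquareRootIteration.
Variable R : realType.

(** The limit solves [q = (y + q^2) / 2], that is [(1 - q)^2 = 1 - y]. A step is half the sum of [y]
    and a square, so local norms at most 1 are preserved. *)
Fixpoint sqrt_iter (y : R) n : R := if n is n'.+1 then (y + sqrt_iter y n' ^+ 2) / 2 else 0.

(* The error satisfies [e_(n+1) <= e_n - e_n ^ 2 / 2]. *)
Lemma sqrt_iter_bound (y : R) n : 0 <= y <= 1 ->
  0 <= 1 - Num.sqrt (1 - y) - sqrt_iter y n <= 2 / (n.+2)%:R.
Proof.
move=> /andP[y0 y1]; set q := Num.sqrt (1 - y).
have q2 : q ^+ 2 = 1 - y by rewrite sqr_sqrtr// subr_ge0.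
have q0 : 0 <= q by exact: sqrtr_ge0.
have q1 : q <= 1 by nra.
suff h : 0 <= sqrt_iter y n /\ 0 <= 1 - q - sqrt_iter y n <= 2 / (n.+2)%:R by case: h.
elim: n => [|n [IH0 /andP[IH1 IH2]]]; first by rewrite /=; lra.
set a := sqrt_iter y n in IH0 IH1 IH2; set e := 1 - q - a in IH1 IH2.
have -> : sqrt_iter y n.+1 = (y + a ^+ 2) / 2 by [].
have eE : 1 - q - (y + a ^+ 2) / 2 = e * (1 - q + a) / 2 by rewrite /e; nra.
have n0 : 0 < n.+2%:R :> R by rewrite ltr0n.
have n3 : n.+3%:R = n.+2%:R + 1 :> R by rewrite -[n.+3]addn1 natrD.
have n2 : 2 <= n.+2%:R :> R by rewrite ler_nat.
split; first by have := sqr_ge0 a; lra.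
rewrite eE; apply/andP; split; first by rewrite divr_ge0// mulr_ge0//; lra.
have h1 : e * (1 - q + a) / 2 <= e - e ^+ 2 / 2.
  have -> : 1 - q + a = 2 * (1 - q) - e by rewrite /e; lra.
  by have := mulr_ge0 IH1 q0; nra.
apply: le_trans h1 _; set m := n.+2%:R in IH2 n0 n3 n2 *; rewrite n3.
set d := 2 / m in IH2; have dm : d * m = 2 by rewrite divfK// gt_eqF.
have d1 : d <= 1 by rewrite /d ler_pdivrMr//; lra.
have d0 : 0 < d by rewrite divr_gt0.
apply: (@le_trans _ _ (d - d ^+ 2 / 2)); first by nra.
rewrite ler_pdivlMr; last lra.
have -> : (d - d ^+ 2 / 2) * (m + 1) = d * m + d - (d * m) * d / 2 - d ^+ 2 / 2 by ring.
by rewrite dm; have := sqr_ge0 d; lra.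
Qed.

Lemma sqrt_iter_cvg (y e : R) : 0 <= y <= 1 -> 0 < e ->
  \forall n \near \oo, `|sqrt_iter y n - (1 - Num.sqrt (1 - y))| <= e.
Proof.
move=> y01 e0; exists (Num.truncn (2 / e)) => // n /= hn.
have /andP[h1 h2] := sqrt_iter_bound n y01.
rewrite distrC ger0_norm//; apply: le_trans h2 _.
have n2 : (0 : R) < n.+2%:R by rewrite ltr0n.
rewrite ler_pdivrMr// mulrC -ler_pdivrMr//; apply: ltW; apply: lt_le_trans (truncnS_gt _) _.
by rewrite ler_nat ltnS; exact: leqW.
Qed.

End SquareRootIteration.

Section Bumps.
Variables (R : realType) (G Γ : topologicalZmodType) (pair : G -> Γ -> R[i]) (V : set Γ).
Local Notation C := R[i].
Local Notation Re := complex.Re.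
Local Notation Im := complex.Im.
Hypothesis dualP : dual_pairing pair.
Hypothesis V0 : V 0.
Local Notation bse_le := (bse_le pair V).

Let bse1 γ : bse_le (fun=> 1) γ 1.
Proof. exact: bse_le1. Qed.

Lemma bse_le_sqrt (y : Γ -> R) γ : (forall g, 0 <= y g <= 1) ->
  bse_le (fun g => (y g)%:C%C) γ 1 -> bse_le (fun g => (Num.sqrt (1 - y g))%:C%C) γ 2.
Proof.
move=> y01 hy.
have hn n : bse_le (fun g => (sqrt_iter (y g) n)%:C%C) γ 1.
  elim: n => [|n IH]; first by apply: bse_le0.
  have := bse_leZ (2^-1%:C%C) (bse_leD hy (bse_leM dualP IH IH)).
  rewrite cabs_real ger0_norm ?invr_ge0// mul1r mulVf//.
  apply: bse_le_local => g _ /=; rewrite -!rmorphM -rmorphD -rmorphM /=; congr (_%:C%C).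
  by rewrite mulrC expr2.
have lim : bse_le (fun g => (1 - Num.sqrt (1 - y g))%:C%C) γ 1.
  apply: (bse_le_lim (phi_ := fun n g => (sqrt_iter (y g) n)%:C%C)); last exact: nearW.
  move=> g e e0; near do rewrite -rmorphB cabs_real.
  exact: sqrt_iter_cvg.
have := bse_leB (@bse1 γ) lim; apply: bse_le_local => g _.
by rewrite -[1](rmorph1 (real_complex R)) -rmorphB /= subKr.
Unshelve. all: by end_near.
Qed.

Lemma Re_pair_conj x γ (z : C) : (Re (pair x γ * z^*%C))%:C%C =
  2^-1%:C%C * (z^*%C * pair x γ + z * pair (- x) γ).
Proof.
have -> : pair (- x) γ = (pair x γ)^*%C.
  have u := unimodular_conj (cabs_pair dualP x γ).
  apply: (mulfI (pair_neq0 dualP x γ)).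
  by rewrite u -(pairD dualP) subrr (pair0 dualP).
by apply: complexP; rewrite ?Re_scale ?Im_scale !(ReD, ImD) !(ReM, ImM) !(ReJ, ImJ) /=; field.
Qed.

(** For unimodular [u] and [z], [(|u - z| / 2)^2 = 1 - y] with [y = (1 + Re (u / z)) / 2]. This [y]
    is an average of 1 and two unimodular multiples of characters, so its local norms are at most
    1. *)
Lemma bse_le_chord x (z : C) γ : cabs z = 1 ->
  bse_le (fun g => (cabs (pair x g - z) / 2)%:C%C) γ 2.
Proof.
move=> z1; pose y g := (1 + Re (pair x g * z^*%C)) / 2.
have y01 g : 0 <= y g <= 1.
  have := cabs_Re (pair x g * z^*%C); rewrite cabsM cabs_conj (cabs_pair dualP) z1 mulr1.
  by rewrite ler_norml /y => /andP[]; lra.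
have hy : bse_le (fun g => (y g)%:C%C) γ 1.
  have h1 := bse_leZ (z^*%C) (bse_le_pair (pair := pair) (V := V) x (γ := γ)).
  have h2 := bse_leZ z (bse_le_pair (pair := pair) (V := V) (- x) (γ := γ)).
  have h3 := bse_leZ (2^-1%:C%C) (bse_leD h1 h2).
  have := bse_leZ (2^-1%:C%C) (bse_leD (@bse1 γ) h3).
  rewrite !cabs_real !ger0_norm ?invr_ge0// cabs_conj z1.
  have -> : 2^-1 * (1 + 2^-1 * (1 * 1 + 1 * 1)) = 1 :> R by field.
  apply: bse_le_local => g _; rewrite -Re_pair_conj /y mulrC.
  by rewrite -[1](rmorph1 (real_complex R)) -rmorphD -rmorphM.
have := bse_le_sqrt y01 hy; apply: bse_le_local => g _; congr (_%:C%C).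
apply/eqP; rewrite -(@eqrXn2 _ 2)// ?sqrtr_ge0 ?divr_ge0 ?cabs_ge0//.
have /andP[_ y1] := y01 g; rewrite sqr_sqrtr ?subr_ge0//.
have p1 := sqr_cabs (pair x g); have p2 := sqr_cabs z.
rewrite (cabs_pair dualP) expr1n in p1; rewrite z1 expr1n in p2.
rewrite exprMn sqr_cabs !(ReD, ImD, ReN, ImN) /y ReM ReJ ImJ.
by apply/eqP; lra.
Qed.

(** If [z] is the point of the circle with real part [a] and imaginary part [b], the product of the
    distances of a unimodular [u] to [z] and to its conjugate is [2 |Re u - a|]. So the function is
    twice a product of two half-chords, whence [2 * 2 * 2]. *)
Lemma bse_le_Re_dist x (a : R) γ : -1 <= a <= 1 ->
  bse_le (fun g => `|Re (pair x g) - a|%:C%C) γ 8.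
Proof.
move=> /andP[a0 a1]; pose b := Num.sqrt (1 - a ^+ 2).
have b2 : b ^+ 2 = 1 - a ^+ 2 by rewrite sqr_sqrtr//; nra.
have z1 (t : R) : t ^+ 2 = b ^+ 2 -> cabs (Complex a t) = 1.
  by move=> tb; rewrite /cabs /= tb b2 addrC subrK sqrtr1.
have h1 := bse_le_chord x (γ := γ) (z1 b (erefl _)).
have h2 := bse_le_chord x (γ := γ) (z1 (- b) (sqrrN b)).
have := bse_leZ (2%:C%C) (bse_leM dualP h1 h2).
rewrite cabs_real ger0_norm//.
have -> : 2 * (2 * 2) = 8 :> R by ring.
apply: bse_le_local => g _; rewrite -!rmorphM /=; congr (_%:C%C).
apply/eqP; rewrite -(@eqrXn2 _ 2)// ?mulr_ge0 ?divr_ge0 ?cabs_ge0//.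
rewrite real_normK ?num_real// !exprMn !sqr_cabs !(ReD, ImD, ReN, ImN) /=.
have := sqr_cabs (pair x g); rewrite (cabs_pair dualP) expr1n.
set u := Re _; set v := Im _ => uv.
have -> : (u - a) ^+ 2 + (v - b) ^+ 2 = 2 - 2 * (u * a + v * b) by nra.
have -> : (u - a) ^+ 2 + (v - - b) ^+ 2 = 2 - 2 * (u * a - v * b) by nra.
have -> : 2 ^+ 2 * ((2 - 2 * (u * a + v * b)) * 2^-1 ^+ 2 * ((2 - 2 * (u * a - v * b)) * 2^-1 ^+ 2)) =
  (1 - u * a) ^+ 2 - v ^+ 2 * b ^+ 2 by field.
have -> : v ^+ 2 = 1 - u ^+ 2 by lra.
by rewrite b2; apply/eqP; ring.
Qed.

(** Linear from 0 at [w = 0] to 1 at [w = 1/2] and constant elsewhere, written with the absolute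
    values that [bse_le_Re_dist] controls. *)
Definition plateau (w : R) : R := `|w| - `|w - 2^-1| + 2^-1.

Lemma plateau1 w : 2^-1 <= w -> plateau w = 1.
Proof. by move=> h; rewrite /plateau !ger0_norm; lra. Qed.

Lemma plateau0 w : w <= 0 -> plateau w = 0.
Proof. by move=> h; rewrite /plateau !ler0_norm; lra. Qed.

Lemma plateau01 w : 0 <= plateau w <= 1.
Proof.
have [h|h] := leP w 0; first by rewrite plateau0 ?ler01 ?lexx.
have [h'|h'] := leP 2^-1 w; first by rewrite plateau1 ?ler01 ?lexx.
by rewrite /plateau ger0_norm ?ler0_norm; lra.
Qed.

Lemma plateau_lipschitz u w : `|plateau u - plateau w| <= 2 * `|u - w|.
Proof.
have -> : plateau u - plateau w = (`|u| - `|w|) - (`|u - 2^-1| - `|w - 2^-1|).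
  by rewrite /plateau; lra.
apply: le_trans (ler_normB _ _) _.
have h1 := ler_dist_dist u w; have := ler_dist_dist (u - 2^-1) (w - 2^-1).
by rewrite opprB addrA subrK; lra.
Qed.

(** 17 is [8 + 8 + 1/2] rounded up. *)
Lemma bse_le_plateau x γ : bse_le (fun g => (plateau (Re (pair x g)))%:C%C) γ 17.
Proof.
have h1 := @bse_le_Re_dist x 0 γ; have h2 := @bse_le_Re_dist x 2^-1 γ.
have := bse_leD (bse_leB (h1 _) (h2 _)) (bse_leZ (2^-1%:C%C) (@bse1 γ)).
rewrite cabs_real ger0_norm ?invr_ge0// => h.
apply: bse_leW (bse_le_local _ (h _ _)); try lra.
by move=> g _; rewrite mulr1 -rmorphB -rmorphD /= subr0.
Qed.

Definition bohr_bump (xs : seq G) g : R := \prod_(x <- xs) plateau (Re (pair x g)).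

Lemma bohr_bump01 xs g : 0 <= bohr_bump xs g <= 1.
Proof.
rewrite /bohr_bump; elim/big_rec: _ => [|x r _ /andP[r0 r1]]; first by rewrite ler01 lexx.
by have /andP[h0 h1] := plateau01 (Re (pair x g)); rewrite mulr_ge0//= mulr_ile1.
Qed.

Lemma bse_le_bohr_bump xs : exists B, forall γ, bse_le (fun g => (bohr_bump xs g)%:C%C) γ B.
Proof.
exists (17 ^+ size xs) => γ; elim: xs => [|x xs IH].
  rewrite expr0; have := @bse1 γ.
  by apply: bse_le_local => g _; rewrite /bohr_bump big_nil rmorph1.
rewrite /= exprS; have := bse_leM dualP (bse_le_plateau x (γ := γ)) IH.
by apply: bse_le_local => g _; rewrite /bohr_bump big_cons rmorphM.
Qed.

Lemma bohr_bump1 xs g : (forall x, x \in xs -> 2^-1 <= Re (pair x g)) -> bohr_bump xs g = 1.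
Proof. by move=> h; rewrite /bohr_bump big_seq big1// => x xx; rewrite plateau1// h. Qed.

Lemma bohr_bump0 xs g x : x \in xs -> Re (pair x g) <= 0 -> bohr_bump xs g = 0.
Proof. by move=> xx h; rewrite /bohr_bump (big_rem x)//= plateau0// mul0r. Qed.

Lemma pair_cont x : ccontinuous (pair x).
Proof.
have [_ _ _ _ htop] := dualP.
move=> γ e e0; apply/htop; exists [set x], e; split=> //; first exact: compact_set1.
by move=> δ /(_ x (erefl _)).
Qed.

Lemma bohr_bump_cont xs γ (e : R) : 0 < e ->
  \forall δ \near γ, `|bohr_bump xs δ - bohr_bump xs γ| < e.
Proof.
elim: xs e => [|x xs IH] e e0.
  by apply: nearW => δ; rewrite /bohr_bump !big_nil subrr normr0.
have e20 : 0 < e / 4 by lra.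
near=> δ; rewrite /bohr_bump !big_cons -!/(bohr_bump _ _).
have h1 : `|bohr_bump xs δ - bohr_bump xs γ| < e / 4 by near: δ; exact: IH.
have h2 : cabs (pair x δ - pair x γ) < e / 4 by near: δ; exact: pair_cont.
have h3 := plateau_lipschitz (Re (pair x δ)) (Re (pair x γ)).
have h4 := cabs_Re (pair x δ - pair x γ); rewrite ReD ReN in h4.
set a := plateau _ in h3 *; set b := bohr_bump _ _ in h1 *; set a' := plateau _ in h3 *.
set b' := bohr_bump _ _ in h1 *.
have -> : a * b - a' * b' = (a - a') * b + a' * (b - b') by ring.
apply: le_lt_trans (ler_normD _ _) _; rewrite !normrM.
have /andP[b0 b1] := bohr_bump01 xs δ; have /andP[a0 a1] := plateau01 (Re (pair x γ)).
rewrite (ger0_norm b0) (ger0_norm a0).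
have := ler_piMr (normr_ge0 (a - a')) b1; have := ler_piMl (normr_ge0 (b - b')) a1; lra.
Unshelve. all: by end_near.
Qed.

Lemma dual_hausdorff : hausdorff_space Γ.
Proof.
have [_ _ _ hinj _] := dualP.
move=> γ δ cl; apply: hinj => x; apply: contrapT => hne.
have e0 : 0 < cabs (pair x γ - pair x δ) / 2.
  rewrite divr_gt0// lt_neqAle cabs_ge0 andbT eq_sym; apply/eqP => /cabs_eq0/eqP.
  by rewrite subr_eq0 => /eqP.
have [η [/= h1 h2]] := cl _ _ (pair_cont x γ e0) (pair_cont x δ e0).
have := cabs_sub_trans (pair x η) (pair x γ) (pair x δ); rewrite cabsB in h1; lra.
Qed.

(* On a compact set the topology of [Γ] is generated by the sets [Re (pair x g) > 0]. *)
Lemma exists_bohr_bump (K W : set Γ) : compact K -> open W -> W 0 -> exists xs,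
  (forall g, K g -> ~ W g -> bohr_bump xs g = 0) /\
  nbhs 0 [set g | bohr_bump xs g = 1].
Proof.
have [_ _ _ hinj _] := dualP.
move=> cK oW W0.
have cKW : compact (K `&` ~` W).
  have cl : closed (K `&` ~` W).
    by apply: closedI; [exact: compact_closed dual_hausdorff cK|exact: open_closedC].
  exact: subclosed_compact cl cK (@subIsetl _ _ _).
have hx γ : (K `&` ~` W) γ -> exists x, Re (pair x γ) < 0.
  move=> [_ Wγ]; apply: contrapT => h; apply: Wγ.
  suff -> : γ = 0 by [].
  (* Powers of [pair x γ] are values at multiples of [x]; if none has negative real part,
     [pair x γ = 1] for every [x]. *)
  apply: hinj => x; rewrite (pair0r dualP); apply: Re_powers_ge0; first exact: cabs_pair.
  move=> n; rewrite -(pairMn dualP) leNgt; apply/negP => hn; apply: h; by exists (x *+ n).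
have /choice[f hf] γ : exists x, (K `&` ~` W) γ -> Re (pair x γ) < 0.
  have [h|h] := pselect ((K `&` ~` W) γ); last by exists 0.
  by have [x hx'] := hx γ h; exists x.
have [|s _ hs] := @compact_finite_cover _ _ (fun γ => [set δ | Re (pair (f γ) δ) < 0]) cKW.
  move=> γ /hf hγ; have e0 : 0 < - Re (pair (f γ) γ) by lra.
  apply: filterS (pair_cont (f γ) γ e0) => δ /= h.
  have := cabs_Re (pair (f γ) δ - pair (f γ) γ); rewrite ReD ReN ler_norml => /andP[]; lra.
exists [seq f t | t <- s]; split.
  move=> g Kg Wg; have [t ts ht] := hs g (conj Kg Wg).
  by apply: (@bohr_bump0 _ _ (f t)); [exact: map_f|exact: ltW].
have : nbhs (0 : Γ) [set g | forall x, x \in [seq f t | t <- s] -> 2^-1 <= Re (pair x g)].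
  apply: filter_all_seq => x; have e0 : 0 < 2^-1 :> R by rewrite invr_gt0.
  apply: filterS (pair_cont x 0 e0) => g; rewrite (pair0r dualP) => h.
  have := cabs_Re (pair x g - 1); rewrite ReD ReN /= ler_norml => /andP[]; lra.
by apply: filterS => g; exact: bohr_bump1.
Qed.

End Bumps.

(** * Sums of compact sets, packings and nets *)

Section CompactSums.
Variable G : topologicalZmodType.
Implicit Types A B : set G.

Lemma compact_add A B : compact A -> compact B ->
  compact [set x | exists a b, [/\ A a, B b & x = a + b]].
Proof.
move=> cA cB; have -> : [set x | exists a b, [/\ A a, B b & x = a + b]] =
    [set z.1 + z.2 | z in A `*` B].
  apply/seteqP; split=> x; first by move=> [a [b [Aa Bb ->]]]; exists (a, b).
  by move=> [[a b] [/= Aa Bb] <-]; exists a, b.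
apply: continuous_compact; last exact: compact_setX.
by apply: continuous_subspaceT; exact: add_continuous.
Qed.

Lemma compact_sub A B : compact A -> compact B ->
  compact [set x | exists a b, [/\ A a, B b & x = a - b]].
Proof.
move=> cA cB; have -> : [set x | exists a b, [/\ A a, B b & x = a - b]] =
    [set z.1 - z.2 | z in A `*` B].
  apply/seteqP; split=> x; first by move=> [a [b [Aa Bb ->]]]; exists (a, b).
  by move=> [[a b] [/= Aa Bb] <-]; exists a, b.
apply: continuous_compact; last exact: compact_setX.
by apply: continuous_subspaceT; exact: sub_continuous.
Qed.

Definition separated (U : set G) (s : seq G) :=
  uniq s /\ forall x y, x \in s -> y \in s -> U (x - y) -> x = y.

(** Cover [D] by finitely many translates of some [U'] with [U' - U'] inside [U]: distinct points of
    a separated set fall into distinct translates, for every shift [γ]. *)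
Lemma separated_packing (U D : set G) : nbhs 0 U -> compact D -> exists N, forall γ s,
  separated U s -> (forall x, x \in s -> D (x - γ)) -> (size s <= N)%N.
Proof.
move=> /nbhs0_sub[U' U'0 hU'] cD.
have [T _ hT] := compact_finite_cover cD (fun x _ => nbhs0_shift x U'0).
exists (size T) => γ s [us sep] hD.
have /choice[f hf] x : exists t, x \in s -> t \in T /\ U' (x - γ - t).
  have [xs|xs] := boolP (x \in s); last by exists 0.
  by have [t tT Ut] := hT _ (hD x xs); exists t.
rewrite -(size_map f); apply: uniq_leq_size.
  rewrite map_inj_in_uniq// => x y xs ys fxy; apply: sep => //.
  have [_ hx] := hf x xs; have [_ hy] := hf y ys; rewrite fxy in hx.
  by have := hU' _ _ hx hy; rewrite opprB addrA subrK opprB addrA subrK.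
by move=> _ /mapP[x xs ->]; have [] := hf x xs.
Qed.

(** A separated subset of maximal size is a net; the packing bound makes the maximum exist. *)
Lemma exists_separated_net (U K : set G) : nbhs 0 U -> (forall x, U x -> U (- x)) -> compact K ->
  exists s, [/\ separated U s, forall x, x \in s -> K x &
    forall x, K x -> exists2 t, t \in s & U (x - t)].
Proof.
move=> U0 UN cK; have [N hN] := separated_packing U0 cK.
pose P n := `[< exists s, [/\ separated U s, forall x, x \in s -> K x & size s = n] >].
have exP : exists n, P n by exists 0%N; apply/asboolP; exists [::].
have bP n : P n -> (n <= N)%N.
  move=> /asboolP[s [ss sK <-]]; apply: (hN 0) ss _ => x xs; rewrite subr0; exact: sK.
case: (ex_maxnP exP bP) => n /asboolP[s [[us sep] sK sn]] maxn.
exists s; split=> // x Kx; apply: contrapT => h.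
have hx t : t \in s -> ~ U (x - t) by move=> ts Ut; apply: h; exists t.
have xs : x \notin s.
  by apply/negP => xs; apply: (hx x xs); rewrite subrr; exact: nbhs_singleton.
suff : (n.+1 <= n)%N by rewrite ltnn.
apply: maxn; apply/asboolP; exists (x :: s); split; last by rewrite /= sn.
  split=> [|y z]; first by rewrite /= xs.
  rewrite !inE => /orP[/eqP ->|ys] /orP[/eqP ->|zs] //; last exact: sep.
    by move=> /(hx z zs).
  by move=> /UN; rewrite opprB => /(hx y ys).
by move=> y; rewrite inE => /orP[/eqP ->//|]; exact: sK.
Qed.

End CompactSums.

(** * Continuity of complex-valued functions *)

Section ComplexContinuity.
Variables (R : realType) (T : topologicalType).
Local Notation C := R[i].
Implicit Types f g : T -> C.

Lemma ccontinuous_cst (a : C) : ccontinuous (fun _ : T => a).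
Proof. by move=> t e e0; apply: nearW => s; rewrite subrr cabs0. Qed.

Lemma ccontinuousD f g : ccontinuous f -> ccontinuous g -> ccontinuous (fun t => f t + g t).
Proof.
move=> cf cg t e e0; have e20 : 0 < e / 2 by lra.
apply: filterS2 (cf t _ e20) (cg t _ e20) => s h1 h2.
by rewrite opprD addrACA; apply: le_lt_trans (cabsD _ _) _; lra.
Qed.

Lemma ccontinuousM f g : ccontinuous f -> ccontinuous g -> ccontinuous (fun t => f t * g t).
Proof.
move=> cf cg t e e0; set a := cabs (f t); set b := cabs (g t).
have a0 : 0 <= a by exact: cabs_ge0.
have b0 : 0 <= b by exact: cabs_ge0.
pose d := Num.min 1 (e / (a + b + 1 + 1)).
have q0 : 0 < a + b + 1 + 1 by lra.
have d0 : 0 < d by rewrite lt_min ltr01 divr_gt0.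
have d1 : d <= 1 by rewrite ge_min lexx.
have dq : d * (a + b + 1 + 1) <= e by rewrite -ler_pdivlMr// ge_min lexx orbT.
apply: filterS2 (cf t _ d0) (cg t _ d0) => s h1 h2.
have -> : f s * g s - f t * g t = (f s - f t) * (g s - g t) + ((f s - f t) * g t + f t * (g s - g t)).
  by ring.
apply: le_lt_trans (cabsD _ _) _.
apply: (@le_lt_trans _ _ (d * 1 + (d * b + a * d))); last by nra.
have k1 : cabs (f s - f t) <= d by exact: ltW.
have k2 : cabs (g s - g t) <= d by exact: ltW.
apply: lerD; first by rewrite cabsM ler_pM ?cabs_ge0// (le_trans k2).
by apply: le_trans (cabsD _ _) _; rewrite !cabsM lerD// ler_pM ?cabs_ge0.
Qed.

Lemma ccontinuousZ (a : C) f : ccontinuous f -> ccontinuous (fun t => a * f t).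
Proof. by move=> cf; apply: ccontinuousM => //; exact: ccontinuous_cst. Qed.

Lemma ccontinuousB f g : ccontinuous f -> ccontinuous g -> ccontinuous (fun t => f t - g t).
Proof.
move=> cf /(ccontinuousZ (-1)) cg; under eq_fun do rewrite -mulN1r.
exact: ccontinuousD.
Qed.

Lemma ccontinuous_prod (I : Type) (s : seq I) (F : I -> T -> C) : (forall i, ccontinuous (F i)) ->
  ccontinuous (fun t => \prod_(i <- s) F i t).
Proof.
move=> cF; elim: s => [|i s IH].
  by under eq_fun do rewrite big_nil; exact: ccontinuous_cst.
by under eq_fun do rewrite big_cons; exact: ccontinuousM.
Qed.

Lemma ccontinuous_local f g t : (\forall s \near t, f s = g s) -> ccontinuous g ->
  forall e : R, 0 < e -> \forall s \near t, cabs (f s - f t) < e.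
Proof.
move=> fg cg e e0; have ft := nbhs_singleton fg.
by apply: filterS2 fg (cg t _ e0) => s -> h; rewrite ft.
Qed.

Lemma continuous_cabs f : ccontinuous f -> continuous (fun t => cabs (f t)).
Proof.
move=> cf t; apply/cvgrPdist_lt => e e0; apply: filterS (cf t _ e0) => s.
apply: le_lt_trans; rewrite ler_norml; have := cabs_sub_ge (f s) (f t).
by have := cabs_sub_ge (f t) (f s); rewrite cabsB; lra.
Qed.

End ComplexContinuity.

Lemma ccontinuous_translate (R : realType) (Γ : topologicalZmodType) (f : Γ -> R[i]) δ :
  ccontinuous f -> ccontinuous (fun g => f (g - δ)).
Proof.
move=> cf γ e e0; have := nbhs_shift0 (cf (γ - δ) e e0) => h.
apply: filterS (nbhs0_shift γ h) => g /=.
by rewrite addrA subrK.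
Qed.

Section LocallyCompactDual.
Variables (R : realType) (G Γ : topologicalZmodType) (pair : G -> Γ -> R[i]) (V : set Γ).
Local Notation C := R[i].
Hypothesis dualP : dual_pairing pair.
Hypothesis oV : open V.
Hypothesis V0 : V 0.
Hypothesis cV : compact (closure V).
Local Notation bse_le := (bse_le pair V).
Local Notation Vs := (Vbar_shift V).

Lemma nbhs_V : nbhs 0 V.
Proof. exact: open_nbhs_nbhs. Qed.

Lemma closure_V0 : closure V 0.
Proof. exact: subset_closure. Qed.

(* The two choices of [γ]: either [Vs γ] misses [V], or it lies in the compact set
   [closure V - closure V + closure V], on which the cut-off function is a Bohr bump. *)
Lemma exists_bump : exists h : Γ -> R,
  [/\ forall g, 0 <= h g <= 1, ccontinuous (fun g => (h g)%:C%C : C),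
      forall g, ~ V g -> h g = 0, nbhs 0 [set g | h g = 1] &
      exists B, forall γ, bse_le (fun g => (h g)%:C%C) γ B].
Proof.
have cD := compact_add (compact_sub cV cV) cV.
set D := [set x | _] in cD.
have [xs [hxs1 hxs2]] := exists_bohr_bump dualP cD oV V0.
pose b := bohr_bump pair xs.
pose h g := if pselect (V g) then b g else 0.
have hb g : D g -> h g = b g.
  by move=> Dg; rewrite /h; case: pselect => // Vg; rewrite [b g]hxs1.
have h0 g : ~ V g -> h g = 0 by rewrite /h; case: pselect.
have VD g v : closure V g -> V v -> D (g + v).
  move=> Vg Vv; exists g, v; split=> //; last exact: subset_closure.
  by exists g, 0; rewrite subr0; split=> //; exact: closure_V0.
exists h; split=> //.
- by move=> g; rewrite /h; case: pselect => ?; [exact: bohr_bump01|rewrite lexx ler01].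
- have cb : ccontinuous (fun g => (b g)%:C%C : C).
    move=> γ e e0; apply: filterS (bohr_bump_cont dualP xs γ e0) => δ.
    by rewrite -rmorphB cabs_real.
  move=> γ e e0; have [Vγ|Vγ] := pselect (closure V γ).
    apply: (ccontinuous_local _ cb e0).
    apply: filterS (nbhs0_shift γ nbhs_V) => δ /= Vδ; congr (_%:C%C); apply: hb.
    by rewrite -[δ](subrK γ) addrC; exact: VD.
  apply: (ccontinuous_local _ (@ccontinuous_cst _ _ 0) e0).
  have : open (~` closure V) by apply: closed_openC; exact: closed_closure.
  rewrite openE => /(_ γ Vγ); apply: filterS => δ Vδ.
  by rewrite h0// => /subset_closure.
- apply: filterS2 nbhs_V hxs2 => g Vg /= hg.
  by rewrite /h; case: pselect.
- have [B hB] := bse_le_bohr_bump V dualP xs; exists B => γ.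
  have [[g0 [Vsg0 Vg0]]|hγ] := pselect (exists g, Vs γ g /\ V g).
    apply: bse_le_local (hB γ) => g Vsg; rewrite hb//.
    have /VsP h1 := Vsg0; have /VsP h2 := Vsg.
    exists (g0 - (g0 - γ)), (g - γ); split=> //.
      exists g0, (g0 - γ); split=> //; exact: subset_closure.
    by rewrite subKr addrC subrK.
  apply: bse_le0 (bse_le_ge0 (hB γ)) _ => g Vsg.
  by rewrite h0// => Vg; apply: hγ; exists g.
Qed.

(** The closure of the open set [K0 + V] works; 0 is adjoined to [K] so that the interior is
    nonempty even when [K] is empty. *)
Lemma Kset_superset (K : set Γ) : compact K -> exists2 O, Kset O & K `<=` O.
Proof.
move=> cK; have hΓ := dual_hausdorff dualP.
pose K0 := K `|` [set 0]; have cK0 : compact K0 by apply: compactU => //; exact: compact_set1.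
pose W := [set x | exists a b, [/\ K0 a, V b & x = a + b]].
have oW : open W.
  rewrite openE => _ [a [b [Ka Vb ->]]]; have : nbhs b V by exact: open_nbhs_nbhs.
  move=> /nbhs_shift0 h; apply: filterS (nbhs0_shift (a + b) h) => y /= hy.
  exists a, (y - (a + b) + b); split=> //.
  by rewrite addrCA subrK.
have KW : K0 `<=` W by move=> x Kx; exists x, 0; rewrite addr0.
have cW : compact (closure W).
  apply: (@subclosed_compact _ _ [set x | exists a b, [/\ K0 a, closure V b & x = a + b]]).
  - exact: closed_closure.
  - exact: compact_add.
  - have cl : closed [set x | exists a b, [/\ K0 a, closure V b & x = a + b]].
      exact: compact_closed hΓ (compact_add cK0 cV).
    rewrite [X in _ `<=` X](closure_id _).1//; apply: closureS => _ [a [b [Ka Vb ->]]]; exists a, b; split=> //; exact: subset_closure.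
have Wi : W `<=` interior (closure W).
  by rewrite -open_subsetE//; exact: subset_closure.
exists (closure W); last by move=> x Kx; apply/subset_closure/KW; left.
split=> //.
  by exists 0; apply: Wi; apply: KW; right.
apply/seteqP; split; last exact: closureS.
move=> x /(closureS (@interior_subset _ _)).
by rewrite -(closure_id (closure W)).1//; exact: closed_closure.
Qed.

End LocallyCompactDual.

(** * Cut-off functions *)

Section Cutoffs.
Variables (R : realType) (G Γ : topologicalZmodType) (pair : G -> Γ -> R[i]) (V : set Γ).
Local Notation C := R[i].
Hypothesis dualP : dual_pairing pair.
Hypothesis oV : open V.
Hypothesis V0 : V 0.
Hypothesis cV : compact (closure V).
Local Notation bse_le := (bse_le pair V).
Local Notation Vs := (Vbar_shift V).
Local Notation A := (Aalg pair V).

(* [1 - \prod_(t <- s) (1 - h (g - t))] for a separated net [s] of [K]: on each [Vs γ] only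
   boundedly many factors differ from 1. *)
Lemma exists_cutoff : exists2 B, 0 <= B & forall K, compact K -> exists u : Γ -> R,
  [/\ forall g, 0 <= u g <= 1, ccontinuous (fun g => (u g)%:C%C : C),
      forall g, K g -> u g = 1,
      exists2 K', compact K' & forall g, ~ K' g -> u g = 0 &
      forall γ, bse_le (fun g => (u g)%:C%C) γ B].
Proof.
have [h [h01 hc hV h1 [Bh hB]]] := exists_bump dualP oV V0 cV.
have Bh0 : 0 <= Bh := bse_le_ge0 (hB 0).
have [U [U0 UN U3]] := nbhs0_chain h1.
have hUh g : U g -> h g = 1.
  move=> Ug; have U00 : U 0 by exact: nbhs_singleton.
  by have /= := U3 g 0 0 Ug U00 U00; rewrite !addr0.
(* A factor indexed by [t] differs from 1 somewhere on [Vs γ] only if [t - γ] lies in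
   [closure V - closure V]; so [N], chosen before [K], bounds the number of such factors. *)
have [N hN] := separated_packing U0 (compact_sub cV cV).
exists (1 + (1 + Bh) ^+ N); first by rewrite addr_ge0// exprn_ge0// addr_ge0.
move=> K cK; have [s [ss sK hs]] := exists_separated_net U0 UN cK.
pose P (r : seq Γ) g := \prod_(t <- r) (1 - h (g - t)).
have P01 r g : 0 <= P r g <= 1.
  rewrite /P; elim/big_rec: _ => [|t y _ /andP[y0 y1]]; first by rewrite ler01 lexx.
  have /andP[a0 a1] := h01 (g - t); rewrite mulr_ge0 ?subr_ge0//= mulr_ile1// ?subr_ge0//.
  by rewrite lerBlDr lerDl.
have bP r γ : bse_le (fun g => (P r g)%:C%C) γ ((1 + Bh) ^+ size r).
  elim: r => [|t r IH].
    apply: bse_le_local (@bse_le1 _ _ _ _ V dualP γ) => g _.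
    by rewrite /P big_nil rmorph1.
  rewrite /= exprS.
  have h2 := bse_leB (@bse_le1 _ _ _ _ V dualP γ) (bse_le_translate dualP (hB (γ - t))).
  apply: bse_le_local (bse_leM dualP h2 IH) => g _.
  by rewrite /P big_cons rmorphM rmorphB rmorph1.
exists (fun g => 1 - P s g); split.
- by move=> g; have := P01 s g; lra.
- have -> : (fun g => (1 - P s g)%:C%C : C) = (fun g => 1 - \prod_(t <- s) (1 - (h (g - t))%:C%C)).
    apply/funext => g; rewrite rmorphB rmorph1 rmorph_prod /=; congr (_ - _).
    by apply: eq_bigr => t _; rewrite rmorphB rmorph1.
  apply: ccontinuousB; first exact: ccontinuous_cst.
  apply: ccontinuous_prod => t; apply: ccontinuousB; first exact: ccontinuous_cst.
  exact: (@ccontinuous_translate _ _ (fun g => (h g)%:C%C)).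
- move=> g /hs[t ts Ut]; rewrite /P (big_rem t)//= hUh// subrr mul0r; exact: subr0.
- exists [set x | exists a b, [/\ K a, closure V b & x = a + b]]; first exact: compact_add.
  move=> g Kg; rewrite /P big_seq big1 ?subrr// => t ts; rewrite hV ?subr0// => Vg.
  apply: Kg; exists t, (g - t); split; [exact: sK|exact: subset_closure|].
  by rewrite addrC subrK.
move=> γ; pose p t := `[< exists2 g, Vs γ g & V (g - t) >].
have Pp g : Vs γ g -> P s g = P [seq t <- s | p t] g.
  move=> Vg; rewrite /P big_filter [LHS](bigID p)/= [X in _ * X]big1 ?mulr1// => t /asboolP pt.
  by rewrite hV ?subr0// => Vgt; apply: pt; exists g.
have size_le : (size [seq t <- s | p t] <= N)%N.
  apply: (hN γ).
    split; first by rewrite filter_uniq//; case: ss.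
    by move=> x y; rewrite !mem_filter => /andP[_ xs] /andP[_ ys]; exact: ss.2.
  move=> t; rewrite mem_filter => /andP[/asboolP[g /VsP Vg Vgt] _].
  exists (g - γ), (g - t); split=> //; first exact: subset_closure.
  by rewrite subrACA subrr sub0r opprB.
have := bse_leB (@bse_le1 _ _ _ _ V dualP γ) (bP [seq t <- s | p t] γ).
move=> h2; apply: bse_leW (bse_le_local _ h2).
  by rewrite lerD2l ler_weXn2l// lerDl.
by move=> g Vg; rewrite rmorphB rmorph1 Pp.
Qed.

(** Smallness along the directed family becomes smallness off one compact set, by [Kset_superset];
    boundedness of [psi] is contained in the bound on the local norms. *)
Lemma AalgP psi : A psi <-> [/\ ccontinuous psi, exists B, forall γ, bse_le psi γ B &
  forall e : R, 0 < e -> exists2 K, compact K & forall γ, ~ K γ -> bse_le psi γ e].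
Proof.
split=> [[[[cpsi bpsi] npsi] h]|[cpsi [B hB] h]].
  split=> //; first by exists (fine (bse_norm pair V psi)); exact: bse_norm_fine.
  move=> e /h[Q [KQ hQ]]; exists Q; first by case: KQ.
  move=> γ Qγ; apply/bse_locP; apply: le_trans (hQ Q KQ (@subset_refl _ _)).
  by apply: ereal_sup_ubound; exists γ.
split.
  split; last exact: bse_norm_lty hB.
  by split=> //; exists B => γ; apply: bse_le_pt (hB γ).
move=> e /h[K cK hK]; have [Q KQ sKQ] := Kset_superset dualP oV V0 cV cK; exists Q; split=> // Q' _ QQ'.
apply: ge_ereal_sup => _ [γ Qγ <-]; apply/bse_locP/hK => Kγ.
by apply/Qγ/QQ'/sKQ.
Qed.

Lemma Aalg_bse_le psi : A psi -> forall γ, bse_le psi γ (fine (bse_norm pair V psi)).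
Proof. by move=> [[_ h] _]; exact: bse_norm_fine. Qed.

Lemma Aalg_lin (a : C) phi psi : A phi -> A psi -> A (fun g => a * phi g + psi g).
Proof.
move=> /AalgP[c1 [B1 h1] t1] /AalgP[c2 [B2 h2] t2]; apply/AalgP; split.
- by apply: ccontinuousD => //; exact: ccontinuousZ.
- by exists (cabs a * B1 + B2) => γ; apply: bse_leD => //; exact: bse_leZ.
- move=> e e0; have a0 := cabs_ge0 a.
  have d0 : 0 < e / 2 / (cabs a + 1) by rewrite !divr_gt0//; lra.
  have [K1 cK1 hK1] := t1 _ d0; have [|K2 cK2 hK2] := t2 (e / 2); first lra.
  exists (K1 `|` K2); first exact: compactU.
  move=> γ Kγ; have {}hK1 := hK1 γ (fun h => Kγ (or_introl h)).
  have {}hK2 := hK2 γ (fun h => Kγ (or_intror h)).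
  apply: bse_leW (bse_leD (bse_leZ a hK1) hK2).
  have := @ler_mul_div1 _ (cabs a) (e / 2) a0; lra.
Qed.

Lemma Aalg0 : A (fun=> 0).
Proof.
apply/AalgP; split; first exact: ccontinuous_cst.
  by exists 0 => γ; apply: bse_le0.
move=> e e0; exists set0; first exact: compact0.
by move=> γ _; apply: bse_le0 => //; exact: ltW.
Qed.

Lemma AalgM phi psi : A phi -> A psi -> A (fun g => phi g * psi g).
Proof.
move=> /AalgP[c1 [B1 h1] t1] /AalgP[c2 [B2 h2] t2]; apply/AalgP; split.
- exact: ccontinuousM.
- by exists (B1 * B2) => γ; exact: bse_leM.
- move=> e e0; have B0 := bse_le_ge0 (h2 0).
  have d0 : 0 < e / (B2 + 1) by rewrite divr_gt0//; lra.
  have [K cK hK] := t1 _ d0; exists K => // γ /hK hγ.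
  apply: bse_leW (bse_leM dualP hγ (h2 γ)).
  by rewrite mulrC; exact: ler_mul_div1.
Qed.

Lemma bse_norm_translate psi δ : bse_norm pair V (fun g => psi (g - δ)) = bse_norm pair V psi.
Proof.
have loc (f : Γ -> C) (γ η : Γ) : (bse_loc pair V (fun g => f (g - η)%R) γ <= bse_loc pair V f (γ - η)%R)%E.
  have [h|h] := ltP (bse_loc pair V f (γ - η)) +oo%E; last first.
    by move: h; rewrite leye_eq => /eqP ->; rewrite leey.
  have h' := bse_loc_fine h.
  rewrite -[leRHS]fineK; last by rewrite ge0_fin_numE// bse_loc_ge0.
  by apply/bse_locP; exact: bse_le_translate.
have le (f : Γ -> C) (η : Γ) : (bse_norm pair V (fun g => f (g - η)%R) <= bse_norm pair V f)%E.
  apply: ge_ereal_sup => _ [γ _ <-]; apply: le_trans (loc _ _ _) _.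
  by apply: ereal_sup_ubound; exists (γ - η).
apply/eqP; rewrite eq_le le/=; have := le (fun g => psi (g - δ)) (- δ).
by under eq_fun do rewrite opprK addrK.
Qed.

Lemma Aalg_translate psi δ : A psi -> A (fun g => psi (g - δ)).
Proof.
move=> /AalgP[c [B hB] t]; apply/AalgP; split.
- exact: ccontinuous_translate.
- by exists B => γ; exact: bse_le_translate.
- move=> e /t[K cK hK].
  exists [set x | exists a b, [/\ K a, [set δ] b & x = a + b]].
    by apply: compact_add => //; exact: compact_set1.
  move=> γ Kγ; apply: bse_le_translate => //; apply: hK => Kγδ; apply: Kγ.
  by exists (γ - δ), δ; rewrite subrK.
Qed.

Lemma Aalg_compact_support (u : Γ -> C) B K : ccontinuous u -> (forall γ, bse_le u γ B) ->
  compact K -> (forall g, ~ K g -> u g = 0) -> A u.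
Proof.
move=> cu hB cK hK; apply/AalgP; split=> //; first by exists B.
move=> e e0; exists [set x | exists a b, [/\ K a, closure V b & x = a - b]].
  exact: compact_sub.
move=> γ Kγ; apply: bse_le0 (ltW e0) _ => g /VsP Vg.
apply: hK => Kg; apply: Kγ; exists g, (g - γ); split=> //.
by rewrite subKr.
Qed.

(** For [γ] in the original compact set, [u] is 1 on all of [Vs γ], which is why [closure V] is
    added; for other [γ] the local norm of [psi] is already at most [e]. *)
Lemma Aalg_cutoff psi e : A psi -> 0 < e -> exists2 K, compact K &
  forall (u : Γ -> R) B, 0 <= B -> (forall γ, bse_le (fun g => (u g)%:C%C) γ B) ->
    (forall g, K g -> u g = 1) ->
    forall γ, bse_le (fun g => psi g - (u g)%:C%C * psi g) γ ((1 + B) * e).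
Proof.
move=> /AalgP[_ _ t] /[dup] e0 /t[K cK hK].
exists [set x | exists a b, [/\ K a, closure V b & x = a + b]]; first exact: compact_add.
move=> u B B0 hu u1 γ; have [Kγ|Kγ] := pselect (K γ).
  apply: bse_le0; first by rewrite mulr_ge0//; [lra|exact: ltW].
  move=> g /VsP Vg; rewrite u1 ?rmorph1 ?mul1r ?subrr//.
  by exists γ, (g - γ); split=> //; rewrite addrC subrK.
have := bse_leM dualP (bse_leB (@bse_le1 _ _ _ _ V dualP γ) (hu γ)) (hK γ Kγ).
by apply: bse_le_local => g _; rewrite mulrBl mul1r.
Qed.

Lemma Aalg_vanish psi e : A psi -> 0 < e -> exists2 K, compact K &
  forall g, ~ K g -> cabs (psi g) <= e.
Proof.
by move=> /AalgP[_ _ t] /t[K cK hK]; exists K => // g /hK; exact: bse_le_pt.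
Qed.

End Cutoffs.

(** * Lebesgue norms *)

Section PowerLimits.
Variable R : realType.

Lemma cvg_powR (a_ : nat -> R) (a p : R) : 0 < p -> (forall n, 0 <= a_ n) ->
  a_ @ \oo --> a -> (fun n => a_ n `^ p) @ \oo --> a `^ p.
Proof.
move=> p0 a_0 cva; have a0 : 0 <= a.
  rewrite leNgt; apply/negP => a0; have na0 : 0 < - a by lra.
  move/cvgrPdist_lt : cva => /(_ _ na0) [n _ /(_ n (leqnn n))].
  by rewrite ltr_norml => /andP[h _]; have := a_0 n; lra.
move: a0; rewrite le_eqVlt => /orP[/eqP a0|a0].
  rewrite -a0 powR0 ?gt_eqF//; apply/cvgrPdist_le => e e0.
  have d0 : 0 < e `^ p^-1 by exact: powR_gt0.
  move/cvgrPdist_le : cva => /(_ _ d0); apply: filterS => n.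
  rewrite -a0 !sub0r !normrN (ger0_norm (a_0 n)) ger0_norm ?powR_ge0// => h.
  apply: (@le_trans _ _ ((e `^ p^-1) `^ p)).
    by apply: ge0_ler_powR; rewrite ?nnegrE// ltW.
  by rewrite -powRrM mulVf ?gt_eqF// powRr1// ltW.
have cp : {for a, continuous (fun x : R => x `^ p)}.
  apply: differentiable_continuous; apply/derivable1_diffP.
  by apply: derivable_powR; rewrite in_itv/= a0.
exact: (cvg_comp _ _ cva cp).
Qed.

End PowerLimits.

Section LpSpaces.
Variables (R : realType) (Γ : topologicalZmodType).
Variable mu : {measure set (Borel Γ) -> \bar R}.
Local Notation C := R[i].
Implicit Types f : Γ -> C.

Lemma open_measurable_borel (U : set Γ) : open U -> measurable (U : set (Borel Γ)).
Proof. exact: sub_sigma_algebra. Qed.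

Lemma continuous_measurable (F : Γ -> R) : continuous F ->
  measurable_fun [set: Borel Γ] (F : Borel Γ -> R).
Proof.
move=> cF; apply: (measurability _ (measurable_realfun.RGenOInfty.measurableE R)).
move=> _ [_ [x ->] <-]; rewrite setTI; apply: open_measurable_borel.
apply: open_comp => [y _|]; [exact: cF|exact: interval_open].
Qed.

Lemma measurable_cabs f : ccontinuous f ->
  measurable_fun [set: Borel Γ] (fun g : Borel Γ => cabs (f g)).
Proof. by move=> cf; apply: continuous_measurable; exact: continuous_cabs. Qed.

Definition Lp_int (p : R) f : \bar R := (\int[mu]_g ((cabs (f g)) `^ p)%:E)%E.

Lemma measurable_cabs_powR p f : ccontinuous f ->
  measurable_fun [set: Borel Γ] (EFin \o (fun g : Borel Γ => (cabs (f g)) `^ p)).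
Proof.
move=> cf; apply/measurable_EFinP.
exact: (measurableT_comp (measurable_powR p) (measurable_cabs cf)).
Qed.

Lemma Lp_int_ge0 p f : (0 <= Lp_int p f)%E.
Proof. by apply: integral_ge0 => g _; rewrite lee_fin powR_ge0. Qed.

Lemma Lp_int_fineK p f : (Lp_int p f < +oo)%E -> (fine (Lp_int p f))%:E = Lp_int p f.
Proof. by move=> h; rewrite fineK// ge0_fin_numE// Lp_int_ge0. Qed.

Lemma Lp_normE p f : Lp_norm mu p f = (Lp_int p f `^ p^-1)%E.
Proof.
rewrite /Lp_norm /Lp_int unlock; congr (_ `^ _)%E; apply: eq_integral => g _.
by rewrite -poweR_EFin abse_EFin ger0_norm ?cabs_ge0.
Qed.

Lemma Lp_intE p f : 0 < p -> Lp_int p f = (Lp_norm mu p f `^ p)%E.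
Proof.
by move=> p0; rewrite Lp_normE -poweRrM mulVf ?gt_eqF// poweRe1// Lp_int_ge0.
Qed.

Lemma Lp_lty p f : 0 < p -> (Lp_norm mu p f < +oo)%E <-> (Lp_int p f < +oo)%E.
Proof.
by move=> p0; split=> h; [rewrite Lp_intE//|rewrite Lp_normE]; exact: poweR_lty.
Qed.

Lemma Lp_norm_ge0 p f : (0 <= Lp_norm mu p f)%E.
Proof. exact: Lnorm_ge0. Qed.

Lemma Lp_leP p f e : 0 < p -> 0 <= e ->
  (Lp_norm mu p f <= e%:E)%E <-> (Lp_int p f <= (e `^ p)%:E)%E.
Proof.
move=> p0 e0; have pn0 : p != 0 by rewrite gt_eqF.
have pos (x : \bar R) : (0 <= x)%E -> x \in `[0%E, +oo%E] by move=> x0; rewrite in_itv/= x0 leey.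
split=> h.
  rewrite Lp_intE// -poweR_EFin; apply: gt0_ler_poweR => //; rewrite ?ltW ?pos//.
  exact: Lp_norm_ge0.
have -> : e%:E = ((e `^ p)%:E `^ p^-1)%E.
  by rewrite poweR_EFin -powRrM mulfV// powRr1.
rewrite Lp_normE; apply: gt0_ler_poweR => //; rewrite ?pos ?Lp_int_ge0 ?lee_fin ?powR_ge0 ?invr_ge0 ?ltW//.
Qed.

Lemma Lp_int_le p f f' : 0 < p -> ccontinuous f -> ccontinuous f' ->
  (forall g, cabs (f g) <= cabs (f' g)) -> (Lp_int p f <= Lp_int p f')%E.
Proof.
move=> p0 cf cf' h; apply: ge0_le_integral => //.
- by move=> g _; rewrite lee_fin powR_ge0.
- exact: measurable_cabs_powR.
- exact: measurable_cabs_powR.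
- by move=> g _; rewrite lee_fin; apply: ge0_ler_powR; rewrite ?nnegrE ?cabs_ge0// ltW.
Qed.

Lemma Lp_norm_le p f f' : 0 < p -> ccontinuous f -> ccontinuous f' ->
  (forall g, cabs (f g) <= cabs (f' g)) -> (Lp_norm mu p f <= Lp_norm mu p f')%E.
Proof.
move=> p0 cf cf' h; rewrite !Lp_normE; apply: gt0_ler_poweR.
- by rewrite invr_ge0 ltW.
- by rewrite in_itv/= Lp_int_ge0 leey.
- by rewrite in_itv/= Lp_int_ge0 leey.
- exact: Lp_int_le.
Qed.

Lemma Lp_intZ p (a : C) f : ccontinuous f ->
  Lp_int p (fun g => a * f g) = ((cabs a `^ p)%:E * Lp_int p f)%E.
Proof.
move=> cf; rewrite /Lp_int -ge0_integralZl_EFin ?powR_ge0//; last exact: measurable_cabs_powR.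
  by apply: eq_integral => g _; rewrite cabsM powRM ?cabs_ge0// EFinM.
by move=> g _; rewrite lee_fin powR_ge0.
Qed.

Lemma Lp_normZ p (a : C) f : 0 < p -> ccontinuous f ->
  Lp_norm mu p (fun g => a * f g) = ((cabs a)%:E * Lp_norm mu p f)%E.
Proof.
move=> p0 cf; rewrite !Lp_normE Lp_intZ// poweRM ?lee_fin ?powR_ge0 ?Lp_int_ge0//.
by rewrite poweR_EFin -powRrM mulfV ?gt_eqF// powRr1// cabs_ge0.
Qed.

Lemma Lp_normD p f f' : 1 <= p -> ccontinuous f -> ccontinuous f' ->
  (Lp_norm mu p (fun g => (f g + f' g)%R) <= Lp_norm mu p f + Lp_norm mu p f')%E.
Proof.
move=> p1 cf cf'; have p0 : 0 < p by exact: lt_le_trans p1.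
apply: le_trans (minkowski_EFin mu (measurable_cabs cf) (measurable_cabs cf') p1).
have pE (F : Γ -> R) : (forall g, 0 <= F g) ->
    Lnorm mu p%:E (EFin \o (F : Borel Γ -> R)) = Lp_norm mu p (fun g => (F g)%:C%C).
  by move=> F0; apply: eq_Lnorm => g /=; rewrite cabs_real ger0_norm.
rewrite [leRHS](pE (fun g => cabs (f g) + cabs (f' g))); last first.
  by move=> g; rewrite addr_ge0 ?cabs_ge0.
apply: Lp_norm_le => //; first exact: ccontinuousD.
- move=> t e e0; have e20 : 0 < e / 2 by lra.
  apply: filterS2 (cf t _ e20) (cf' t _ e20) => s h1 h2.
  rewrite -rmorphB cabs_real; apply: (@le_lt_trans _ _ (cabs (f s - f t) + cabs (f' s - f' t))); last lra.
  rewrite ler_norml; have := cabs_sub_ge (f s) (f t); have := cabs_sub_ge (f' s) (f' t).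
  have := cabs_sub_ge (f t) (f s); have := cabs_sub_ge (f' t) (f' s).
  by rewrite (cabsB (f t)) (cabsB (f' t)); lra.
- by move=> g; rewrite cabs_real ger0_norm ?addr_ge0 ?cabs_ge0//; exact: cabsD.
Qed.

Lemma Lp_norm_lim p (f_ : nat -> Γ -> C) f e : 0 < p -> 0 <= e -> ccontinuous f ->
  (forall n, ccontinuous (f_ n)) ->
  (forall g d, 0 < d -> \forall n \near \oo, cabs (f_ n g - f g) <= d) ->
  (\forall n \near \oo, (Lp_norm mu p (f_ n) <= e%:E)%E) -> (Lp_norm mu p f <= e%:E)%E.
Proof.
move=> p0 e0 cf cf_ lim [N _ hN]; apply/Lp_leP => //.
(* The index is shifted by [N] so that the eventual bound holds for every term. *)
pose F n (g : Borel Γ) := ((cabs (f_ (n + N)%N g)) `^ p)%:E.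
have mF n : measurable_fun [set: Borel Γ] (F n) by exact: measurable_cabs_powR.
have F0 n (g : Borel Γ) : [set: Borel Γ] g -> (0 <= F n g)%E by rewrite lee_fin powR_ge0.
have cvF g : F^~ g @ \oo --> ((cabs (f g)) `^ p)%:E.
  apply: cvg_EFin; first exact: nearW.
  apply: (cvg_powR p0 (a_ := fun n => cabs (f_ (n + N)%N g))); first by move=> n; exact: cabs_ge0.
  apply/cvgrPdist_le => d d0; have [M _ hM] := lim g d d0; exists M => // n /= Mn.
  have /= h := hM (n + N)%N (leq_trans Mn (leq_addr _ _)).
  rewrite distrC ler_norml; have := cabs_sub_ge (f_ (n + N)%N g) (f g).
  by have := cabs_sub_ge (f g) (f_ (n + N)%N g); rewrite cabsB; lra.
have h := fatou mu measurableT mF F0.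
have -> : Lp_int p f = (\int[mu]_x limn_einf (F^~ x))%E.
  by apply: eq_integral => g _; rewrite (cvg_limn_einf_sup (cvF g)).1.
apply: le_trans h _; rewrite limn_einf_lim; apply: lime_le; first exact: is_cvg_einfs.
apply: nearW => n; apply: (@le_trans _ _ (\int[mu]_x F n x)%E).
  by apply: ereal_inf_lbound; exists n => //=.
apply/(Lp_leP (f_ (n + N)%N) p0 e0); apply: hN; exact: leq_addl.
Qed.

End LpSpaces.

Section HaarLp.
Variables (R : realType) (Γ : topologicalZmodType).
Variable mu : {measure set (Borel Γ) -> \bar R}.
Local Notation C := R[i].
Hypothesis haarP : haar mu.
Hypothesis hΓ : hausdorff_space Γ.
Implicit Types f : Γ -> C.

Lemma compact_measurable_borel (K : set Γ) : compact K -> measurable (K : set (Borel Γ)).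
Proof.
move=> /(compact_closed hΓ) cK; rewrite -[K]setCK; apply: measurableC.
by apply: open_measurable_borel; exact: closed_openC.
Qed.

Definition translate (δ : Γ) : Borel Γ -> Borel Γ := fun g => (g : Γ) - δ.

Lemma measurable_translate (δ : Γ) : measurable_fun [set: Borel Γ] (translate δ).
Proof.
apply: (@measurability _ _ (Borel Γ) (Borel Γ) setT (translate δ) (@open Γ : set (set (Borel Γ)))
  (erefl _)) => _ [U oU <-]; rewrite setTI.
apply: open_measurable_borel; rewrite openE => γ /= Uγ.
have := nbhs_shift0 (open_nbhs_nbhs (conj oU Uγ)) => h.
by apply: filterS (nbhs0_shift γ h) => g /=; rewrite addrA subrK.
Qed.

Lemma Lp_int_translate p f δ : ccontinuous f -> Lp_int mu p (fun g => f (g - δ)) = Lp_int mu p f.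
Proof.
move=> cf; pose F (g : Borel Γ) : \bar R := ((cabs (f g)) `^ p)%:E.
have mF : measurable_fun [set: Borel Γ] F by exact: measurable_cabs_powR.
have F0 g : [set: Borel Γ] g -> (0 <= F g)%E by rewrite lee_fin powR_ge0.
have h := ge0_integral_pushforward (measurable_translate δ) mu measurableT mF (fun g _ => F0 g I).
transitivity (\int[mu]_g (F \o translate δ) g)%E; first by [].
rewrite -[X in integral _ X _](preimage_setT (translate δ)) -h.
apply: eq_measure_integral; first exact: measurable_translate.
move=> mT A mA _; rewrite /= /pushforward.
have [tr _ _ _ _] := haarP; rewrite -(tr A δ mA); congr (mu _).
apply/seteqP; split=> [x /= Ax|_ [x Ax <-]]; first by exists (translate δ x); rewrite // /translate subrK.
by rewrite /preimage /= /translate addrK.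
Qed.

Lemma Lp_norm_translate p f δ : ccontinuous f ->
  Lp_norm mu p (fun g => f (g - δ)) = Lp_norm mu p f.
Proof. by move=> cf; rewrite !Lp_normE Lp_int_translate. Qed.

Lemma Lp_int_compact_support p f K B : 0 < p -> ccontinuous f -> compact K ->
  (forall g, ~ K g -> f g = 0) -> (forall g, cabs (f g) <= B) -> (Lp_int mu p f < +oo)%E.
Proof.
move=> p0 cf cK fK fB; have B0 : 0 <= B := le_trans (cabs_ge0 _) (fB 0).
have mK := compact_measurable_borel cK.
have mI : measurable_fun [set: Borel Γ] (fun g : Borel Γ => (\1_(K : set (Borel Γ)) g)%:E : \bar R).
  by apply/measurable_EFinP; exact: measurable_indic.
have I0 (g : Borel Γ) : [set: Borel Γ] g -> (0 <= (\1_(K : set (Borel Γ)) g)%:E :> \bar R)%E.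
  by rewrite lee_fin.
apply: (@le_lt_trans _ _ (\int[mu]_g ((B `^ p)%:E * (\1_(K : set (Borel Γ)) g)%:E))%E); last first.
  rewrite ge0_integralZl_EFin ?powR_ge0// integral_indic// setIT.
  apply: lte_mul_pinfty; rewrite ?lee_fin ?powR_ge0//.
  by have [_ _ h _ _] := haarP; exact: h.
apply: ge0_le_integral => //.
- by move=> g _; rewrite lee_fin powR_ge0.
- exact: measurable_cabs_powR.
- apply: emeasurable_funM => //; exact: measurable_cst.
- move=> g _; rewrite -EFinM lee_fin indicE; have [Kg|Kg] := pselect (K g).
    rewrite mem_set// mulr1; apply: ge0_ler_powR; rewrite ?nnegrE ?cabs_ge0//.
    exact: ltW.
  by rewrite memNset// mulr0 fK// cabs0 powR0 ?gt_eqF.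
Qed.

(** Pointwise, [|f| ^ q <= B ^ (q - p) * |f| ^ p]. *)
Lemma Lp_int_bounded p q f B : 0 < p -> p <= q -> ccontinuous f ->
  (forall g, cabs (f g) <= B) -> (Lp_int mu p f < +oo)%E -> (Lp_int mu q f < +oo)%E.
Proof.
move=> p0 pq cf fB fp; have q0 : 0 < q by exact: lt_le_trans pq.
have B0 : 0 <= B := le_trans (cabs_ge0 _) (fB 0).
apply: (@le_lt_trans _ _ ((B `^ (q - p))%:E * Lp_int mu p f)%E); last first.
  by apply: lte_mul_pinfty; rewrite ?lee_fin ?powR_ge0.
have P0 (g : Borel Γ) : [set: Borel Γ] g -> (0 <= (cabs (f g) `^ p)%:E)%E.
  by rewrite lee_fin powR_ge0.
have mP := measurable_cabs_powR p cf.
rewrite /Lp_int -ge0_integralZl_EFin ?powR_ge0//.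
apply: ge0_le_integral => //.
- by move=> g _; rewrite lee_fin powR_ge0.
- exact: measurable_cabs_powR.
- apply: emeasurable_funM => //; exact: measurable_cst.
- move=> g _; rewrite -EFinM lee_fin.
  have [f0|f0] := eqVneq (cabs (f g)) 0.
    by rewrite f0 !powR0 ?gt_eqF// mulr0.
  have -> : cabs (f g) `^ q = cabs (f g) `^ (q - p) * cabs (f g) `^ p.
    by rewrite -powRD ?f0 ?implybT// subrK.
  rewrite ler_wpM2r ?powR_ge0//; apply: ge0_ler_powR; rewrite ?nnegrE ?cabs_ge0//.
  by rewrite subr_ge0.
Qed.

Lemma Lp_int_gt0 p f : 0 < p -> ccontinuous f -> nbhs 0 [set g | cabs (f g) = 1] ->
  (0 < Lp_int mu p f)%E.
Proof.
move=> p0 cf; rewrite nbhsE => -[U [oU U0] Uf].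
have mU := open_measurable_borel oU.
apply: (@lt_le_trans _ _ (mu U)); first by have [_ h _ _ _] := haarP; apply: h => //; exists 0.
have <- : (\int[mu]_g (\1_(U : set (Borel Γ)) g)%:E)%E = mu U.
  by rewrite integral_indic// setIT.
apply: ge0_le_integral => //.
- by apply/measurable_EFinP; exact: measurable_indic.
- exact: measurable_cabs_powR.
- move=> g _; rewrite lee_fin indicE; have [Ug|Ug] := pselect (U g).
    by rewrite mem_set// (Uf g Ug) powR1.
  by rewrite memNset// powR_ge0.
Qed.

(* [|ψ - u ψ| <= min |ψ| (1/(n+1))], and the [p]-th powers of the right-hand sides tend to 0
   under the integral by dominated convergence. *)
Lemma Lp_cutoff p psi : 0 < p -> ccontinuous psi -> (Lp_norm mu p psi < +oo)%E ->
  (forall e, 0 < e -> exists2 K, compact K & forall g, ~ K g -> cabs (psi g) <= e) ->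
  forall e, 0 < e -> exists2 K, compact K &
    forall u : Γ -> R, ccontinuous (fun g => (u g)%:C%C : C) -> (forall g, 0 <= u g <= 1) ->
      (forall g, K g -> u g = 1) ->
      (Lp_norm mu p (fun g => psi g - (u g)%:C%C * psi g)%R <= e%:E)%E.
Proof.
move=> p0 cpsi /(Lp_lty _ _ p0) ip van e e0.
pose F n (g : Borel Γ) := Num.min (cabs (psi g)) (n.+1%:R^-1).
have F0 n g : 0 <= F n g by rewrite le_min cabs_ge0 invr_ge0 ler0n.
have mF n : measurable_fun [set: Borel Γ] (fun g => (F n g `^ p)%:E).
  apply/measurable_EFinP; apply: (measurableT_comp (measurable_powR p)).
  apply: measurable_minr; [exact: measurable_cabs|exact: measurable_cst].
have cvF (g : Borel Γ) : [set: Borel Γ] g -> (fun n => (F n g `^ p)%:E) @ \oo --> (0%:E : \bar R).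
  move=> _; apply: cvg_EFin; first exact: nearW.
  have <- : 0 `^ p = 0 :> R by rewrite powR0// gt_eqF.
  apply: (cvg_powR p0 (a_ := fun n => F n g)) => //.
  apply: (@squeeze_cvgr _ _ _ _ (fun=> 0) (fun n => n.+1%:R^-1)).
  - by apply: nearW => n; rewrite F0 ge_min lexx orbT.
  - exact: cvg_cst.
  - exact: cvg_harmonic.
have dom : mu.-integrable [set: Borel Γ] (fun g : Borel Γ => ((cabs (psi g)) `^ p)%:E).
  apply/integrableP; split; first exact: measurable_cabs_powR.
  by under eq_integral do rewrite gee0_abs ?lee_fin ?powR_ge0//.
have Fle n (g : Borel Γ) : [set: Borel Γ] g -> (`|(F n g `^ p)%:E| <= ((cabs (psi g)) `^ p)%:E)%E.
  move=> _; rewrite abse_EFin lee_fin ger0_norm ?powR_ge0//.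
  have le : F n g <= cabs (psi g) by rewrite ge_min lexx.
  by apply: ge0_ler_powR; rewrite ?nnegrE ?cabs_ge0 ?F0 ?le ?ltW.
have fin (g : Borel Γ) : [set: Borel Γ] g -> ((cabs (psi g)) `^ p)%:E \is a fin_num by [].
have cv := dominated_cvg measurableT mF cvF fin dom Fle.
rewrite integral0 in cv.
have [n hn] : exists n, (\int[mu]_g (F n g `^ p)%:E <= (e `^ p)%:E)%E.
  have ep : 0 < e `^ p by exact: powR_gt0.
  have /fine_cvgP[[N1 _ fN] /cvgrPdist_lt/(_ _ ep)[N2 _ hN]] := cv.
  pose n := maxn N1 N2; have fn := fN n (leq_maxl _ _); exists n; rewrite -(fineK fn) lee_fin.
  have := hN n (leq_maxr _ _); rewrite sub0r normrN => h.
  exact: le_trans (ler_norm _) (ltW h).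
have [|K cK hK] := van (n.+1%:R^-1); first by rewrite invr_gt0.
exists K => // u cu u01 u1; apply/(Lp_leP mu _ p0 (ltW e0)).
apply: le_trans hn; apply: ge0_le_integral => //.
- by move=> g _; rewrite lee_fin powR_ge0.
- by apply: measurable_cabs_powR; apply: ccontinuousB => //; exact: ccontinuousM.
- move=> g _; rewrite lee_fin; apply: ge0_ler_powR; rewrite ?nnegrE ?cabs_ge0 ?F0//; first exact: ltW.
  have -> : psi g - (u g)%:C%C * psi g = (1 - u g)%:C%C * psi g.
    by rewrite rmorphB rmorph1 mulrBl mul1r.
  have /andP[u0 u1'] := u01 g.
  rewrite cabsM cabs_real ger0_norm ?subr_ge0// le_min.
  have le1 : (1 - u g) * cabs (psi g) <= cabs (psi g).
    by rewrite ler_piMl ?cabs_ge0//; lra.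
  rewrite le1/=; have [Kg|Kg] := pselect (K g); first by rewrite u1// subrr mul0r invr_ge0.
  exact: le_trans le1 (hK g Kg).
Qed.

End HaarLp.

(** * Strictness of the inclusion *)

Section PSeries.
Variable R : realType.
Implicit Types c s x : R.

(** With [t = 1 / (x + 2)] one has [1 / (x + 1) = t / (1 - t)], and the claim reduces to
    [1 + c t <= (1 - t) ^ (- c)], which follows from [exp u >= 1 + u] and [ln (1 - t) <= - t]. *)
Lemma powR_telescope c x : 0 < c -> 0 <= x ->
  c * (x + 2)^-1 `^ (c + 1) <= (x + 1)^-1 `^ c - (x + 2)^-1 `^ c.
Proof.
move=> c0 x0; have x1 : 0 < x + 1 by lra.
have x2 : 0 < x + 2 by lra.
have t0 : 0 < (x + 2)^-1 by rewrite invr_gt0.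
have tle : (x + 2)^-1 <= 2^-1 by rewrite lef_pV2 ?posrE//; lra.
have y0 : 0 < 1 - (x + 2)^-1 by lra.
have -> : (x + 1)^-1 = (x + 2)^-1 * (1 - (x + 2)^-1)^-1.
  have -> : 1 - (x + 2)^-1 = (x + 1) / (x + 2) by field; rewrite gt_eqF.
  by field; rewrite !gt_eqF.
rewrite powRM ?invr_ge0; [|lra|lra].
have -> : (x + 2)^-1 `^ (c + 1) = (x + 2)^-1 `^ c * (x + 2)^-1.
  by rewrite powRD ?(gt_eqF t0) ?implybT// powRr1// ltW.
set z := (x + 2)^-1 `^ c; have z0 : 0 <= z by exact: powR_ge0.
suff : 1 + c * (x + 2)^-1 <= (1 - (x + 2)^-1)^-1 `^ c.
  by move=> /(ler_wpM2l z0); lra.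
rewrite /powR gt_eqF ?invr_gt0// lnV ?posrE//.
apply: le_trans (expR_ge1Dx _); rewrite lerD2l ler_pM2l// lerNr.
by have := @le_ln1Dx _ (- (x + 2)^-1); apply; lra.
Qed.

Lemma pseries_bounded s : 1 < s ->
  exists B, forall N, \sum_(n < N) (n.+1%:R^-1 : R) `^ s <= B.
Proof.
move=> s1; pose c := s - 1; have c0 : 0 < c by rewrite subr_gt0.
have sc : s = c + 1 by rewrite /c subrK.
exists (1 + c^-1) => N.
suff h : forall n, c * \sum_(k < n.+1) (k.+1%:R^-1 : R) `^ s <= c + 1 - (n.+1%:R^-1) `^ c.
  apply: (@le_trans _ _ (\sum_(k < N.+1) (k.+1%:R^-1 : R) `^ s)).
    by rewrite big_ord_recr lerDl powR_ge0.
  rewrite -(ler_pM2l c0); apply: le_trans (h N) _.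
  by rewrite mulrDr mulr1 mulfV ?gt_eqF// lerBlDr lerDl powR_ge0.
elim=> [|n IH].
  by rewrite big_ord_recr big_ord0/= add0r invr1 !powR1 mulr1 addrK.
rewrite big_ord_recr mulrDr /= {2}sc.
have := @powR_telescope c n%:R c0 (ler0n _ _).
have -> : n%:R + 2 = n.+2%:R :> R by rewrite -natrD addn2.
have -> : n%:R + 1 = n.+1%:R :> R by rewrite natr1.
by move: IH; lra.
Qed.

Lemma harmonic_unbounded (B : R) : exists N, B < \sum_(n < N) n.+1%:R^-1.
Proof.
apply: contrapT => /forallNP hB; apply: (@dvg_harmonic R).
apply: nondecreasing_is_cvgn; first by apply: nondecreasing_series => n _ _; exact: harmonic_ge0.
exists B => _ [n _ <-]; rewrite /series/= big_mkord leNgt; apply/negP; exact: hB.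
Qed.

End PSeries.

Section SpreadSequences.
Variable G : topologicalZmodType.

Lemma compact_seq_translates (D : set G) (s : seq G) : compact D ->
  compact [set x | exists2 t, t \in s & D (x - t)].
Proof.
move=> cD; elim: s => [|t s IH].
  rewrite (_ : [set x | _] = set0); first exact: compact0.
  by apply/seteqP; split=> // x [].
have -> : [set x | exists2 u, u \in t :: s & D (x - u)] =
    [set x | exists a b, [/\ D a, [set t] b & x = a + b]] `|` [set x | exists2 u, u \in s & D (x - u)].
  apply/seteqP; split=> [x [u]|x [[a [_ [Da -> ->]]]|[u us Du]]].
  - rewrite inE => /orP[/eqP -> Du|us Du]; last by right; exists u.
    by left; exists (x - t), t; rewrite subrK.
  - by exists t; rewrite ?mem_head// addrK.
  - by exists u => //; rewrite inE us orbT.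
by apply: compactU => //; apply: compact_add => //; exact: compact_set1.
Qed.

(** Finitely many translates of [D] cannot cover a noncompact group, so each term avoids those
    attached to the earlier terms, which [l n] collects. *)
Lemma exists_spread_sequence (D : set G) : ~ compact [set: G] -> compact D ->
  exists g_ : nat -> G, forall m n, (m < n)%N -> ~ D (g_ n - g_ m).
Proof.
move=> ncG cD; have /choice[f hf] : forall s : seq G, exists x, forall t, t \in s -> ~ D (x - t).
  move=> s; apply: contrapT => /forallNP h; apply: ncG.
  rewrite (_ : setT = [set x | exists2 t, t \in s & D (x - t)]); first exact: compact_seq_translates.
  apply/seteqP; split=> // x _; apply: contrapT => hx; apply: (h x) => t ts Dt.
  by apply: hx; exists t.
pose l n := iter n (fun s => f s :: s) [::].
exists (fun n => f (l n)) => m n mn; apply: hf.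
elim: n mn => // n IH; rewrite ltnS leq_eqVlt => /orP[/eqP ->|/IH h] /=; rewrite inE ?eqxx//.
by rewrite h orbT.
Qed.

End SpreadSequences.

Section StrictInclusion.
Variables (R : realType) (G Γ : topologicalZmodType) (pair : G -> Γ -> R[i]) (V : set Γ).
Variable mu : {measure set (Borel Γ) -> \bar R}.
Local Notation C := R[i].
Hypothesis dualP : dual_pairing pair.
Hypothesis oV : open V.
Hypothesis V0 : V 0.
Hypothesis cV : compact (closure V).
Hypothesis haarP : haar mu.
Hypothesis ncΓ : ~ compact [set: Γ].
Local Notation bse_le := (bse_le pair V).
Local Notation Vs := (Vbar_shift V).

(* [E - E] contains no difference of two of the [γ_ n], so every [Vs γ] meets at most one of the
   supports of the functions [h (- - γ_ n)]. *)
Lemma exists_spread_bumps : exists (h : Γ -> R) (γ_ : nat -> Γ) (E : set Γ) (B : R),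
  [/\ [/\ forall g, 0 <= h g <= 1, ccontinuous (fun g => (h g)%:C%C : C),
          forall g, ~ V g -> h g = 0, nbhs 0 [set g | h g = 1] &
          forall γ, bse_le (fun g => (h g)%:C%C) γ B],
      compact E,
      forall γ g n, Vs γ g -> V (g - γ_ n) -> E (γ - γ_ n) &
      forall γ g g' m n, Vs γ g -> Vs γ g' -> V (g - γ_ m) -> V (g' - γ_ n) -> m = n].
Proof.
have [h [h01 hc hV h1 [B hB]]] := exists_bump dualP oV V0 cV.
have cE := compact_sub cV cV; set E := [set x | _] in cE.
have [γ_ hγ] := exists_spread_sequence ncΓ (compact_sub cE cE).
have EV γ g n : Vs γ g -> V (g - γ_ n) -> E (γ - γ_ n).
  move=> /VsP Vg Vgn; exists (g - γ_ n), (g - γ); split=> //; first exact: subset_closure.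
  by rewrite subrACA subrr sub0r opprB.
exists h, γ_, E, B; split=> // γ g g' m n Vg Vg' Vm Vn.
have Em := EV _ _ _ Vg Vm; have En := EV _ _ _ Vg' Vn.
have EE a b : E (γ - γ_ a) -> E (γ - γ_ b) ->
    exists x y, [/\ E x, E y & γ_ b - γ_ a = x - y].
  move=> Ea Eb; exists (γ - γ_ a), (γ - γ_ b); split=> //.
  by rewrite subrACA subrr sub0r opprB.
by case: (ltngtP m n) => // /hγ; [have := EE m n Em En|have := EE n m En Em].
Qed.

Lemma exists_Aq_not_Ap p q : 1 <= p -> p < q ->
  exists psi, Ap pair V mu q psi /\ ~ Ap pair V mu p psi.
Proof.
move=> p1 pq; have p0 : 0 < p by lra.
have q0 : 0 < q by lra.
have [h [γ_ [E [B [[h01 hc hV h1 hB] cE EV inj]]]]] := exists_spread_bumps.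
have B0 : 0 <= B := bse_le_ge0 (hB 0).
have hΓ := dual_hausdorff dualP.
(* The [p]-th powers of these heights form the harmonic series, the [q]-th powers a convergent
   series of exponent [q / p > 1]. *)
pose a n : R := (n.+1%:R^-1) `^ p^-1.
have a0 n : 0 <= a n by exact: powR_ge0.
have a1 n : a n <= 1.
  have e1 : 1 `^ p^-1 = 1 :> R by rewrite powR1.
  rewrite /a -[leRHS]e1; apply: ge0_ler_powR; rewrite ?nnegrE ?invr_ge0 ?ler0n ?ler01//.
    exact: ltW.
  by rewrite invf_le1 ?ltr0n// ler1n.
have acv : a @ \oo --> 0.
  have <- : 0 `^ p^-1 = 0 :> R by rewrite powR0// gt_eqF// invr_gt0.
  apply: cvg_powR; [by rewrite invr_gt0|by move=> n; rewrite invr_ge0|exact: cvg_harmonic].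
pose f n g : C := (a n)%:C%C * (h (g - γ_ n))%:C%C.
have fc n : ccontinuous (f n).
  by apply: ccontinuousZ; exact: (@ccontinuous_translate _ _ (fun g => (h g)%:C%C)).
have f0 n g : ~ V (g - γ_ n) -> f n g = 0 by move=> /hV hg; rewrite /f hg mulr0.
(* At each [g] at most one index qualifies, by [inj], so the choice made by [cid] is harmless. *)
pose psi g : C := if pselect (exists n, V (g - γ_ n)) is left e then f (projT1 (cid e)) g else 0.
have psiE n g : V (g - γ_ n) -> psi g = f n g.
  move=> Vn; rewrite /psi; case: pselect => [e|[]]; last by exists n.
  case: cid => m Vm /=; congr (f _ g).
  by apply: (inj g g g) Vm Vn; apply/VsP; rewrite subrr; exact: subset_closure.
have psi0 g : (forall n, ~ V (g - γ_ n)) -> psi g = 0.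
  by move=> hn; rewrite /psi; case: pselect => // e; have [n Vn] := e; case: (hn n).
have loc γ : (exists2 n, E (γ - γ_ n) & forall g, Vs γ g -> psi g = f n g) \/
    (forall g, Vs γ g -> psi g = 0).
  have [[n [g0 Vg0 Vn]]|hn] := pselect (exists n, exists2 g, Vs γ g & V (g - γ_ n)).
    left; exists n; first exact: EV Vg0 Vn.
    move=> g Vg; have [/psiE//|Vgn] := pselect (V (g - γ_ n)).
    rewrite f0// psi0// => m Vm; apply: Vgn.
    by rewrite -(inj _ _ _ _ _ Vg Vg0 Vm Vn).
  right=> g Vg; apply: psi0 => n Vn; apply: hn; by exists n, g.
have fB n γ : bse_le (f n) γ (a n * B).
  have := bse_leZ (a n)%:C%C (bse_le_translate dualP (hB (γ - γ_ n))).
  by rewrite cabs_real ger0_norm.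
have Apsi : Aalg pair V psi.
  apply/(AalgP dualP oV V0 cV); split.
  - move=> γ e e0; have nV : \forall g \near γ, Vs γ g.
      apply: filterS (nbhs0_shift γ (open_nbhs_nbhs (conj oV V0))) => g /= Vg.
      by apply/VsP; exact: subset_closure.
    have [[n _ hn]|hn] := loc γ.
      by apply: (ccontinuous_local _ (fc n) e0); apply: filterS nV => g; exact: hn.
    by apply: (ccontinuous_local _ (@ccontinuous_cst _ _ 0) e0); apply: filterS nV => g; exact: hn.
  - exists B => γ; have [[n _ hn]|hn] := loc γ.
      apply: (bse_leW _ (bse_le_local (fun g Vg => esym (hn g Vg)) (fB n γ))).
      by rewrite ler_piMl.
    by apply: bse_le0 => // g; exact: hn.
  - move=> e e0; have d0 : 0 < e / (B + 1) by rewrite divr_gt0//; lra.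
    move/cvgrPdist_lt : acv => /(_ _ d0)[N _ hN].
    (* Off the first [N] translates of [E] only bumps of index at least [N] are met, and their
       heights are below [e / (B + 1)]. *)
    exists [set x | exists2 t, t \in map γ_ (iota 0 N) & E (x - t)].
      exact: compact_seq_translates.
    move=> γ Kγ; have [[n En hn]|hn] := loc γ; last by apply: bse_le0 (ltW e0) _ => g; exact: hn.
    apply: (bse_leW _ (bse_le_local (fun g Vg => esym (hn g Vg)) (fB n γ))).
    have [Nn|nN] := leqP N n; last first.
      by case: Kγ; exists (γ_ n) => //; apply: map_f; rewrite mem_iota.
    apply: le_trans (ler_mul_div1 B0 e0); rewrite mulrC; apply: ler_wpM2l => //.
    have := hN n Nn; rewrite sub0r normrN ger0_norm//; exact: ltW.
have [cpsi _ _] := (AalgP dualP oV V0 cV psi).1 Apsi.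
have fI r n : 0 < r ->
    Lp_int mu r (f n) = ((n.+1%:R^-1 `^ (r / p))%:E * Lp_int mu r (fun g => (h g)%:C%C))%E.
  move=> r0; have hcn := ccontinuous_translate (γ_ n) hc.
  have -> : Lp_int mu r (f n) = ((cabs (a n)%:C%C `^ r)%:E * Lp_int mu r (fun g => (h (g - γ_ n)%R)%:C%C))%E.
    exact: (Lp_intZ mu r _ hcn).
  have -> : Lp_int mu r (fun g => (h (g - γ_ n))%:C%C) = Lp_int mu r (fun g => (h g)%:C%C).
    exact: (Lp_int_translate haarP r _ hc).
  rewrite cabs_real ger0_norm//; congr (_%:E * _)%E.
  by rewrite /a -powRrM mulrC.
have Ifin r : 0 < r -> (Lp_int mu r (fun g => (h g)%:C%C) < +oo)%E.
  move=> r0; apply: (Lp_int_compact_support haarP hΓ (K := closure V) (B := 1)) => //.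
    by move=> g Vg; rewrite hV// => /subset_closure.
  by move=> g; rewrite cabs_real ger0_norm; case/andP: (h01 g).
have Igt0 r : 0 < r -> (0 < Lp_int mu r (fun g => (h g)%:C%C))%E.
  move=> r0; apply: (Lp_int_gt0 haarP) => //; apply: filterS h1 => g /= ->.
  by rewrite cabs_real normr1.
have P0 r n (g : Borel Γ) : [set: Borel Γ] g -> (0 <= (cabs (f n g) `^ r)%:E)%E.
  by rewrite lee_fin powR_ge0.
exists psi; split.
  (* Pointwise, [|psi| ^ q] is at most the sum of the [|f n| ^ q], whose integrals are those of the
     bump times the terms of the convergent series. *)
  split=> //; apply/Lp_lty => //.
  have [|Z hZ] := @pseries_bounded R (q / p); first by rewrite ltr_pdivlMr// mul1r.
  apply: (@le_lt_trans _ _ (Z%:E * Lp_int mu q (fun g => (h g)%:C%C))%E); last first.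
    apply: lte_mul_pinfty; rewrite ?lee_fin ?Ifin//.
    by have := hZ 0%N; rewrite big_ord0.
  apply: (@le_trans _ _ (\int[mu]_g \sum_(0 <= n <oo) (cabs (f n g) `^ q)%:E)%E).
    apply: ge0_le_integral => //.
    - by move=> g _; rewrite lee_fin powR_ge0.
    - exact: measurable_cabs_powR.
    - apply: (@ge0_emeasurable_sum _ _ _ _ _ xpredT); first by move=> n g Dg _; exact: P0.
      by move=> n _; exact: measurable_cabs_powR.
    - move=> g _; have [[n Vn]|hn] := pselect (exists n, V (g - γ_ n)).
        apply: le_trans (nneseries_lim_ge n.+1 _); last by move=> k _ _; exact: P0.
        rewrite big_nat_recr//= (psiE n g Vn) leeDr// sume_ge0// => k _; exact: P0.
      rewrite psi0; last by move=> n Vn; apply: hn; exists n.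
      by rewrite cabs0 powR0 ?gt_eqF//; apply: nneseries_ge0 => n _ _; exact: P0.
  rewrite (integral_nneseries mu measurableT (fun n => measurable_cabs_powR q (fc n)) (P0 q)).
  apply: lime_le; first by apply: is_cvg_nneseries => n _ _; exact: Lp_int_ge0.
  apply: nearW => N; rewrite (eq_bigr (fun n => ((n.+1%:R^-1 `^ (q / p))%:E * Lp_int mu q (fun g => (h g)%:C%C))%E)); last first.
    by move=> n _; exact: fI.
  rewrite -ge0_sume_distrl; last by move=> n _; rewrite lee_fin powR_ge0.
  by rewrite sumEFin lee_wpmul2r ?Lp_int_ge0// lee_fin big_mkord.
(* The first [N] bumps contribute [c] times a partial sum of the harmonic series to the integral of
   [|psi| ^ p]. *)
move=> [_ /Lp_lty]; move/(_ p0) => Ipsi.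
pose c := fine (Lp_int mu p (fun g => (h g)%:C%C)).
have cE' : Lp_int mu p (fun g => (h g)%:C%C) = c%:E.
  exact: esym (Lp_int_fineK (Ifin p p0)).
have c0 : 0 < c by have := Igt0 p p0; rewrite cE' lte_fin.
have psiF : Lp_int mu p psi = (fine (Lp_int mu p psi))%:E.
  exact: esym (Lp_int_fineK Ipsi).
have [N] := harmonic_unbounded (fine (Lp_int mu p psi) / c).
rewrite ltr_pdivrMr// ltNge => /negP; apply.
rewrite -lee_fin -psiF.
have -> : ((\sum_(n < N) n.+1%:R^-1) * c)%:E = (\sum_(n < N) Lp_int mu p (f n))%E.
  rewrite EFinM -cE' -sumEFin ge0_sume_distrl; last by move=> n _; rewrite lee_fin invr_ge0.
  by apply: eq_bigr => n _; rewrite fI// divff ?gt_eqF// powRr1// invr_ge0.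
rewrite -(ge0_integral_sum mu measurableT (fun n : 'I_N => measurable_cabs_powR p (fc n)) (fun n => P0 p n)).
apply: ge0_le_integral => //.
- by move=> g _; apply: sume_ge0 => n _; exact: P0.
- by apply: emeasurable_sum => n; exact: measurable_cabs_powR.
- exact: measurable_cabs_powR.
move=> g _; rewrite sumEFin lee_fin.
have [[n Vn]|hn] := pselect (exists n, V (g - γ_ n)); last first.
  rewrite big1 ?powR_ge0// => n _; rewrite f0 ?cabs0 ?powR0 ?gt_eqF//.
  by move=> Vn; apply: hn; exists n.
have fz m : m != n -> cabs (f m g) `^ p = 0.
  move=> mn; rewrite f0 ?cabs0 ?powR0 ?gt_eqF// => Vm; case/eqP: mn.
  by apply: (inj g g g) Vm Vn; apply/VsP; rewrite subrr; exact: subset_closure.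
have [nN|Nn] := ltnP n N.
  rewrite (bigD1 (Ordinal nN))//= big1 ?addr0; first by rewrite (psiE n).
  by move=> m mn; apply: fz; apply: contra mn => /eqP mn; apply/eqP/val_inj.
rewrite big1 ?powR_ge0// => m _; apply: fz.
by rewrite ltn_eqF// (leq_trans (ltn_ord m)).
Qed.

End StrictInclusion.

(** * The Segal algebra *)

Section ComplexCompleteness.
Variable R : realType.
Local Notation C := R[i].

Lemma real_cauchy_lim (x : nat -> R) :
  (forall e, 0 < e -> exists n0, forall m n, (n0 <= m)%N -> (n0 <= n)%N -> `|x m - x n| < e) ->
  exists l : R, x @ \oo --> l.
Proof.
move=> cx; suff : cvg (x @ \oo) by move=> ?; exists (lim (x @ \oo)).
apply: cauchy_cvg; apply: cauchy_exP => e e0; have [n0 h] := cx e e0.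
by exists (x n0), n0 => // n /= nn0; rewrite -ball_normE /=; exact: h.
Qed.

Lemma complex_cauchy_lim (z : nat -> C) :
  (forall e : R, 0 < e -> exists n0, forall m n, (n0 <= m)%N -> (n0 <= n)%N ->
    cabs (z m - z n) < e) ->
  exists l, forall e, 0 < e -> \forall n \near \oo, cabs (z n - l) <= e.
Proof.
move=> cz.
have [a ha] : exists a : R, (fun n => complex.Re (z n)) @ \oo --> a.
  apply: real_cauchy_lim => e /cz[n0 h]; exists n0 => m n mn nn.
  by apply: le_lt_trans (h m n mn nn); rewrite -ReN -ReD; exact: cabs_Re.
have [b hb] : exists b : R, (fun n => complex.Im (z n)) @ \oo --> b.
  apply: real_cauchy_lim => e /cz[n0 h]; exists n0 => m n mn nn.
  by apply: le_lt_trans (h m n mn nn); rewrite -ImN -ImD; exact: cabs_Im.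
exists (a +i* b)%C => e e0; have e20 : 0 < e / 2 by lra.
move/cvgrPdist_le : ha => /(_ _ e20); move/cvgrPdist_le : hb => /(_ _ e20).
apply: filterS2 => n hIm hRe; apply: le_trans (cabs_le _) _.
by rewrite ReD ImD ReN ImN /= distrC [X in _ + X]distrC; lra.
Qed.

End ComplexCompleteness.

Section SegalAlgebra.
Variables (R : realType) (G Γ : topologicalZmodType) (pair : G -> Γ -> R[i]) (V : set Γ).
Variable mu : {measure set (Borel Γ) -> \bar R}.
Local Notation C := R[i].
Hypothesis dualP : dual_pairing pair.
Hypothesis oV : open V.
Hypothesis V0 : V 0.
Hypothesis cV : compact (closure V).
Hypothesis haarP : haar mu.
Local Notation bse_le := (bse_le pair V).
Local Notation A := (Aalg pair V).
Local Notation nA := (bse_norm pair V).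

Let AP := AalgP dualP oV V0 cV.

Lemma Aalg_cont psi : A psi -> ccontinuous psi.
Proof. by move=> /AP[]. Qed.

Lemma bse_norm_fineK psi : A psi -> (fine (nA psi))%:E = nA psi.
Proof. by move=> [[_ h] _]; rewrite fineK// ge0_fin_numE// bse_norm_ge0. Qed.

Lemma Aalg_bounded psi : A psi -> forall g, cabs (psi g) <= fine (nA psi).
Proof. by move=> /Aalg_bse_le h g; exact: (bse_le_pt dualP V0 (h g)). Qed.

Lemma bse_normZ (a : C) psi : A psi -> nA (fun g => a * psi g) = ((cabs a)%:E * nA psi)%E.
Proof.
move=> Apsi; have le (b : C) phi : A phi -> (nA (fun g => (b * phi g)%R) <= (cabs b)%:E * nA phi)%E.
  move=> Aphi; rewrite -(bse_norm_fineK Aphi) -EFinM; apply/bse_normP => γ.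
  exact: (bse_leZ b (Aalg_bse_le Aphi (γ := γ))).
apply/eqP; rewrite eq_le le//=; have [a0|a0] := eqVneq a 0.
  by rewrite a0 cabs0 mul0e; exact: bse_norm_ge0.
have Aa : A (fun g => a * psi g).
  by have := Aalg_lin dualP oV V0 cV a Apsi (Aalg0 dualP oV V0 cV); under eq_fun do rewrite addr0.
have := le a^-1 _ Aa; under eq_fun do rewrite mulKf//.
rewrite -(bse_norm_fineK Apsi) -(bse_norm_fineK Aa) -!EFinM !lee_fin.
by move=> /(ler_wpM2l (cabs_ge0 a)); rewrite mulrA -cabsM divff// cabs1 mul1r.
Qed.

Lemma bse_normD phi psi : A phi -> A psi -> (nA (fun g => (phi g + psi g)%R) <= nA phi + nA psi)%E.
Proof.
move=> h1 h2; rewrite -(bse_norm_fineK h1) -(bse_norm_fineK h2) -EFinD; apply/bse_normP => γ.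
by apply: bse_leD; exact: Aalg_bse_le.
Qed.

Lemma bse_normM phi psi : A phi -> A psi -> (nA (fun g => (phi g * psi g)%R) <= nA phi * nA psi)%E.
Proof.
move=> h1 h2; rewrite -(bse_norm_fineK h1) -(bse_norm_fineK h2) -EFinM; apply/bse_normP => γ.
by apply: (bse_leM dualP); exact: Aalg_bse_le.
Qed.

Lemma Aalg_closed phi :
  (forall e, 0 < e -> exists2 psi, A psi & forall γ, bse_le (fun g => psi g - phi g) γ e) -> A phi.
Proof.
move=> h; have app e : 0 < e -> exists2 psi, A psi &
    forall γ B, bse_le psi γ B -> bse_le phi γ (B + e).
  move=> /h[psi Apsi hpsi]; exists psi => // γ B hB.
  by apply: bse_le_local (bse_leB hB (hpsi γ)) => g _; rewrite subKr.
apply/AP; split.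
- move=> t e e0; have [|psi Apsi hpsi] := h (e / 4); first lra.
  have e40 : 0 < e / 4 by lra.
  apply: filterS (Aalg_cont Apsi t e40) => s hs.
  have := bse_le_pt dualP V0 (hpsi s); have := bse_le_pt dualP V0 (hpsi t); rewrite (cabsB (psi s)) => k1 k2.
  have := cabs_sub_trans (psi s) (phi s) (phi t); have := cabs_sub_trans (psi t) (psi s) (phi t).
  lra.
- have [psi Apsi hpsi] := app 1 ltr01; exists (fine (nA psi) + 1) => γ.
  by apply: hpsi; exact: Aalg_bse_le.
- move=> e e0; have [|psi Apsi hpsi] := app (e / 2); first lra.
  have [_ _ t] := (AP psi).1 Apsi; have [|K cK hK] := t (e / 2); first lra.
  exists K => // γ /hK/hpsi; apply: bse_leW; lra.
Qed.

Variable p : R.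
Hypothesis p1 : 1 <= p.
Local Notation S := (Ap pair V mu p).
Local Notation N := (Ap_norm pair V mu p).
Local Notation nL := (Lp_norm mu p).

Let p0 : 0 < p. Proof. exact: lt_le_trans p1. Qed.

Lemma Lp_norm_fineK psi : (nL psi < +oo)%E -> (fine (nL psi))%:E = nL psi.
Proof. by move=> h; rewrite fineK// ge0_fin_numE// Lp_norm_ge0. Qed.

Lemma Lp_norm_mul phi psi : S phi -> A psi ->
  (nL (fun g => (phi g * psi g)%R) <= nL phi * nA psi)%E.
Proof.
move=> [Aphi Lphi] Apsi; have cphi := Aalg_cont Aphi; have cpsi := Aalg_cont Apsi.
rewrite -(bse_norm_fineK Apsi); set b := fine _.
have b0 : 0 <= b by rewrite fine_ge0// bse_norm_ge0.
have <- : nL (fun g => b%:C%C * phi g) = (nL phi * b%:E)%E.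
  by rewrite Lp_normZ// cabs_real ger0_norm// muleC.
apply: Lp_norm_le => //; [exact: ccontinuousM|exact: ccontinuousZ|move=> g].
rewrite !cabsM cabs_real ger0_norm// mulrC ler_wpM2r ?cabs_ge0//.
exact: Aalg_bounded.
Qed.

Lemma Ap_compact_support (u : Γ -> C) K : A u -> compact K -> (forall g, ~ K g -> u g = 0) -> S u.
Proof.
move=> Au cK hK; split=> //; apply/(Lp_lty _ _ p0).
apply: (Lp_int_compact_support haarP (dual_hausdorff dualP) p0 (Aalg_cont Au) cK hK (B := fine (nA u))).
exact: Aalg_bounded.
Qed.

Lemma Ap_lin (a : C) phi psi : S phi -> S psi -> S (fun g => a * phi g + psi g).
Proof.
move=> [A1 L1] [A2 L2]; split; first exact: Aalg_lin.
have c1 := Aalg_cont A1; have c2 := Aalg_cont A2.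
apply: le_lt_trans (Lp_normD mu p1 (ccontinuousZ a c1) c2) _.
apply: lte_add_pinfty => //; rewrite Lp_normZ//.
by apply: lte_mul_pinfty; rewrite ?lee_fin ?cabs_ge0.
Qed.

Lemma ApM phi psi : S phi -> A psi -> S (fun g => phi g * psi g).
Proof.
move=> hphi Apsi; have [Aphi Lphi] := hphi; split; first exact: AalgM.
apply: le_lt_trans (Lp_norm_mul hphi Apsi) _; rewrite muleC -(bse_norm_fineK Apsi).
by apply: lte_mul_pinfty; rewrite // lee_fin fine_ge0// bse_norm_ge0.
Qed.

(** One cut-off serves both density and approximate units, being 1 on the compact sets requested by
    [Aalg_cutoff] and by [Lp_cutoff]. The last clause is conditional because density concerns
    elements of [A] outside [S]. *)
Lemma Ap_cutoff psi e : A psi -> 0 < e ->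
  exists u, [/\ S (fun g => (u g)%:C%C * psi g), S (fun g => (u g)%:C%C),
    (nA (fun g => (psi g - (u g)%:C%C * psi g)%R) <= e%:E)%E &
    S psi -> (nL (fun g => (psi g - (u g)%:C%C * psi g)%R) <= e%:E)%E].
Proof.
move=> Apsi e0; have [B B0 hB] := exists_cutoff dualP oV V0 cV.
have d0 : 0 < e / (B + 1) by rewrite divr_gt0//; lra.
have [K1 cK1 hK1] := Aalg_cutoff dualP oV V0 cV Apsi d0.
have [K2 cK2 hK2] : exists2 K, compact K & S psi -> forall u : Γ -> R,
    ccontinuous (fun g => (u g)%:C%C : C) -> (forall g, 0 <= u g <= 1) ->
    (forall g, K g -> u g = 1) ->
    (nL (fun g => (psi g - (u g)%:C%C * psi g)%R) <= e%:E)%E.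
  have [[_ Lpsi]|hS] := pselect (S psi); last by exists set0 => //; exact: compact0.
  have [K cK hK] := Lp_cutoff p0 (Aalg_cont Apsi) Lpsi
    (fun d d0 => Aalg_vanish dualP oV V0 cV Apsi d0) e0.
  by exists K.
have [u [u01 cu u1 [K' cK' uK'] uB]] := hB _ (compactU cK1 cK2).
have Au : A (fun g => (u g)%:C%C).
  by apply: (Aalg_compact_support dualP oV V0 cV cu uB cK') => g /uK' ->.
exists u; split.
- apply: (Ap_compact_support _ cK'); first exact: AalgM.
  by move=> g /uK' ->; rewrite mul0r.
- by apply: (Ap_compact_support Au cK') => g /uK' ->.
- apply/bse_normP => γ; have := hK1 u B B0 uB (fun g Kg => u1 g (or_introl Kg)) γ.
  by apply: bse_leW; rewrite mulrC addrC divfK// gt_eqF//; lra.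
- by move=> /hK2; apply=> // g Kg; apply: u1; right.
Qed.

Lemma Ap_normE psi : S psi -> N psi = (fine (nA psi) + fine (nL psi))%:E.
Proof. by move=> [Apsi Lpsi]; rewrite EFinD bse_norm_fineK// Lp_norm_fineK. Qed.

Lemma Ap_complete : segal_complete S N.
Proof.
move=> u Su cu.
have Sd m n : S (fun g => u m g - u n g).
  by have := Ap_lin (-1) (Su n) (Su m); under eq_fun do rewrite mulN1r addrC.
have cu1 e : 0 < e -> exists n0, forall m n, (n0 <= m)%N -> (n0 <= n)%N ->
    (forall γ, bse_le (fun g => u m g - u n g) γ e) /\ (nL (fun g => (u m g - u n g)%R) <= e%:E)%E.
  move=> /cu[n0 h]; exists n0 => m n hm hn; have := ltW (h m n hm hn) => {}h; split.
    by apply/bse_normP; apply: le_trans h; rewrite leeDl// Lp_norm_ge0.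
  by apply: le_trans h; rewrite leeDr// bse_norm_ge0.
have /choice[phi hphi] : forall g, exists l, forall e, 0 < e -> \forall n \near \oo, cabs (u n g - l) <= e.
  move=> g; apply: complex_cauchy_lim => e e0; have [|n0 h] := cu1 (e / 2); first lra.
  exists n0 => m n hm hn; have [/(_ g)/(bse_le_pt dualP V0) /= h1 _] := h m n hm hn; lra.
(* For fixed [n], letting [m] grow carries the Cauchy bounds from [u n - u m] to [u n - phi], in
   both parts of the norm. *)
have lim n g e : 0 < e -> \forall m \near \oo, cabs (u n g - u m g - (u n g - phi g)) <= e.
  by move=> e0; apply: filterS (hphi g e e0) => m; rewrite subrACA subrr sub0r cabsN.
have cvA e : 0 < e -> exists n0, forall n, (n0 <= n)%N ->
    forall γ, bse_le (fun g => u n g - phi g) γ e.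
  move=> /cu1[n0 h]; exists n0 => n hn γ.
  apply: (bse_le_lim (lim n)); exists n0 => // m /= hm; exact: (h n m hn hm).1.
have Aphi : A phi.
  apply: Aalg_closed => e /cvA[n0 h]; exists (u n0); first by case: (Su n0).
  exact: h.
have cphi := Aalg_cont Aphi.
have cvL e : 0 < e -> exists n0, forall n, (n0 <= n)%N ->
    (nL (fun g => (u n g - phi g)%R) <= e%:E)%E.
  move=> e0; have [n0 h] := cu1 e e0; exists n0 => n hn.
  have cun := Aalg_cont (Su n).1.
  apply: (Lp_norm_lim p0 (ltW e0) _ _ (lim n)).
  - exact: ccontinuousB.
  - by move=> m; exact: Aalg_cont (Sd n m).1.
  - by exists n0 => // m /= hm; exact: (h n m hn hm).2.
exists phi.
  split=> //; have [n0 h] := cvL 1 ltr01.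
  have cd : ccontinuous (fun g => u n0 g - phi g).
    by apply: ccontinuousB => //; exact: Aalg_cont (Su n0).1.
  have -> : phi = (fun g => (-1) * (u n0 g - phi g) + u n0 g).
    by apply/funext => g; rewrite mulN1r opprB subrK.
  apply: le_lt_trans (Lp_normD mu p1 (ccontinuousZ (-1) cd) (Aalg_cont (Su n0).1)) _.
  apply: lte_add_pinfty; last by case: (Su n0).
  rewrite Lp_normZ// cabsN cabs1 mul1e; exact: le_lt_trans (h n0 (leqnn _)) (ltry _).
move=> e e0; have e40 : 0 < e / 4 by lra.
have [n1 h1] := cvA _ e40; have [n2 h2] := cvL _ e40; exists (maxn n1 n2) => n.
rewrite geq_max => /andP[/h1/bse_normP k1 /h2 k2].
by apply: le_lt_trans (leeD k1 k2) _; rewrite -EFinD lte_fin; lra.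
Qed.

Lemma Ap_is_segal : is_segal pair V S N.
Proof.
split; [split; [split|]| | split; [split|]| |].
- by move=> psi [].
- apply: (Ap_compact_support (Aalg0 dualP oV V0 cV) (@compact0 _)) => //.
- by move=> phi psi a; exact: Ap_lin.
- by move=> phi psi; exact: ApM.
- move=> psi e Apsi e0; have [|u [Supsi _ h _]] := Ap_cutoff Apsi (e := e / 2); first lra.
  by exists (fun g => (u g)%:C%C * psi g) => //; apply: le_lt_trans h _; rewrite lte_fin; lra.
- move=> phi Sphi; split; first by rewrite adde_ge0 ?bse_norm_ge0 ?Lp_norm_ge0.
  by rewrite Ap_normE// ltry.
- move=> phi Sphi N0; apply/funext => g; apply/cabs_eq0/eqP; rewrite eq_le cabs_ge0 andbT.
  apply: (bse_le_pt dualP V0); apply: (bse_normP pair V phi 0).1.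
  rewrite -[0%:E]N0 leeDl//.
  exact: Lp_norm_ge0.
- move=> phi a Sphi; have [Aphi Lphi] := Sphi.
  rewrite /Ap_norm bse_normZ// Lp_normZ//; last exact: Aalg_cont.
  by rewrite ge0_muleDr ?bse_norm_ge0 ?Lp_norm_ge0.
- move=> phi psi [A1 L1] [A2 L2]; rewrite /Ap_norm addeACA; apply: leeD; first exact: bse_normD.
  by apply: Lp_normD => //; exact: Aalg_cont.
- exact: Ap_complete.
- split=> [phi _|phi psi Sphi Apsi]; first by rewrite leeDl// Lp_norm_ge0.
  rewrite /Ap_norm ge0_muleDl ?bse_norm_ge0 ?Lp_norm_ge0//; apply: leeD; last exact: Lp_norm_mul.
  by apply: bse_normM => //; case: Sphi.
- move=> phi e Sphi e0; have [|u [_ Su h1 h2]] := Ap_cutoff Sphi.1 (e := e / 4); first lra.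
  exists (fun g => (u g)%:C%C) => //; apply: le_lt_trans (leeD h1 (h2 Sphi)) _.
  by rewrite -EFinD lte_fin; lra.
Qed.

Lemma Ap_translation_invariant : isometric_translation_invariant S N.
Proof.
move=> psi γ [Apsi Lpsi]; have e := Lp_norm_translate haarP p γ (Aalg_cont Apsi).
split; last by rewrite /Ap_norm e bse_norm_translate.
by split; [exact: Aalg_translate|rewrite e].
Qed.

Lemma Ap_subset q : p <= q -> S `<=` Ap pair V mu q.
Proof.
move=> pq psi [Apsi /(Lp_lty _ _ p0) Lpsi]; split=> //.
apply/(Lp_lty _ _ (lt_le_trans p0 pq)).
exact: Lp_int_bounded p0 pq (Aalg_cont Apsi) (Aalg_bounded Apsi) Lpsi.
Qed.

End SegalAlgebra.

Theorem theorem6p4 (R : realType) (G Γ : topologicalZmodType)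
  (pair : G -> Γ -> R[i])
  (mu : {measure set (@g_sigma_algebraType (pt Γ) (@open Γ)) -> \bar R})
  (V : set Γ) (p q : R) :
  LCA G -> non_discrete G -> dual_pairing pair -> haar mu ->
  open V -> V 0 -> compact (closure V) ->
  1 <= p -> p < q ->
  (is_segal pair V (Ap pair V mu p) (Ap_norm pair V mu p) /\
   isometric_translation_invariant (Ap pair V mu p) (Ap_norm pair V mu p)) /\
  ((Ap pair V mu p `<=` Ap pair V mu q) /\
   exists psi, Ap pair V mu q psi /\ ~ Ap pair V mu p psi).
Proof.
move=> lcaG ndG dualP haarP oV V0 cV p1 pq; split; split.
- exact: Ap_is_segal.
- exact: Ap_translation_invariant.
- by apply: Ap_subset => //; exact: ltW.
- by apply: exists_Aq_not_Ap => //; exact: (dual_noncompact dualP lcaG ndG).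
Qed.
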